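(* Let $R$ be an $\mathbb{R}_{\ge0}$-graded domain finitely generated over $R_0=\mathbb{k}$, with $\dim R\ge1$, and let $M$ be a finitely generated torsion-free $\mathbb{R}$-graded $R$-module. Then there exists a unique filtration $$0=M_0\subset M_1\subset\dots\subset M_l=M$$ by graded submodules such that 1. each $M_i/M_{i-1}$ is torsion-free and semistable; 2. $\mu(M_1)>\mu(M_2/M_1)>\dots>\mu(M_l/M_{l-1})$.
   Context: $\mathbb{k}$ is an algebraically closed field. Let $n=\dim R$. For a finitely generated $\mathbb{R}$-graded $R$-module $N$ put $N_{\le x}=\bigoplus_{\lambda\le x}N_\lambda$, and let $a_n(N),a_{n-1}(N)\in\mathbb{R}$ be the (existing, unique) numbers with $\dim_{\mathbb{k}}N_{\le x}=\frac{a_n(N)}{n!}x^n+O(x^{n-1})$ and $\lim_{T\to\infty}\frac1{T^n}\int_1^T\big(\dim N_{\le x}-\frac{a_n(N)}{n!}x^n-\frac{a_{n-1}(N)}{(n-1)!}x^{n-1}\big)dx=0$. The degree is $\deg N=a_{n-1}(N)-\operatorname{rank}(N)a_{n-1}(R)$ and, when $a_n(N)\neq0$, the slope is $\mu(N)=\deg(N)/a_n(N)$. A nonzero finitely generated torsion-free graded module $N$ is semistable if $\mu(N')\le\mu(N)$ for every nonzero graded submodule $N'\subset N$. (In particular the quotients $M_i/M_{i-1}$ in the statement are nonzero.) *)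

(* Defs.v *)
From HB Require Import structures.
From mathcomp Require Import all_boot all_order all_algebra.
From mathcomp Require Import all_classical all_reals all_analysis.

Set Implicit Arguments.
Unset Strict Implicit.
Unset Printing Implicit Defensive.

Import Order.TTheory GRing.Theory Num.Theory.
Import numFieldNormedType.Exports.

Local Open Scope classical_set_scope.
Local Open Scope quotient_scope.
Local Open Scope ring_scope.

Section SubQuotientModules.
Variables (R : nzRingType) (V : lmodType R).

Record submod (A : submodClosed V) := Submod {
  submod_val :> V;
  submod_valP : submod_val \in A }.

HB.instance Definition _ (A : submodClosed V) := [isSub for @submod_val A].
HB.instance Definition _ (A : submodClosed V) := [Choice of submod A by <:].
HB.instance Definition _ (A : submodClosed V) :=
  [SubChoice_isSubLmodule of submod A by <:].

(* The library only knows a [submodClosed] predicate to be closed under sums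
   and scaling; quotients need closure under opposites too. *)
Definition zsubmod (B : submodClosed V) : {pred V} := fun v => v \in B.

Lemma zsubmod_closed (B : submodClosed V) : zmod_closed (zsubmod B).
Proof.
split=> [|u v uB vB]; first exact: (rpred0 B).
by rewrite -[- v]scaleN1r; apply: (rpredD uB); apply: rpredZ.
Qed.

HB.instance Definition _ (B : submodClosed V) :=
  GRing.isZmodClosed.Build V (zsubmod B) (zsubmod_closed B).

Definition quotmod (B : submodClosed V) : Type := Quotient.quot (zsubmod B).

HB.instance Definition _ (B : submodClosed V) :=
  GRing.Zmodule.on (quotmod B).

Definition quotmod_pi (B : submodClosed V) (v : V) : quotmod B :=
  \pi_(Quotient.quot (zsubmod B)) v.

Definition quotmod_scale (B : submodClosed V) (a : R) (x : quotmod B) :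
    quotmod B :=
  quotmod_pi B (a *: repr (x : Quotient.quot (zsubmod B))).

Lemma quotmod_piP (B : submodClosed V) (x : quotmod B) :
  exists v, quotmod_pi B v = x.
Proof. by exists (repr (x : Quotient.quot (zsubmod B))); exact: reprK. Qed.

Lemma quotmod_pi_eq (B : submodClosed V) (u v : V) :
  (quotmod_pi B u = quotmod_pi B v) <-> (u - v \in B).
Proof.
have -> : (u - v \in B) = (quotmod_pi B u == quotmod_pi B v).
  exact: (@Quotient.idealrBE _ (zsubmod B)).
by split=> [->|/eqP].
Qed.

Lemma quotmod_piD (B : submodClosed V) (u v : V) :
  quotmod_pi B (u + v) = quotmod_pi B u + quotmod_pi B v.
Proof. by rewrite /quotmod_pi [LHS]raddfD. Qed.

Lemma quotmod_piZ (B : submodClosed V) (a : R) (v : V) :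
  quotmod_scale a (quotmod_pi B v) = quotmod_pi B (a *: v).
Proof.
apply/quotmod_pi_eq; rewrite -scalerBr; apply: rpredZ.
by apply/quotmod_pi_eq; exact: reprK.
Qed.

Lemma quotmod_scalerA (B : submodClosed V) (a b : R) (x : quotmod B) :
  quotmod_scale a (quotmod_scale b x) = quotmod_scale (a * b) x.
Proof. by have [v <-] := quotmod_piP x; rewrite !quotmod_piZ scalerA. Qed.

Lemma quotmod_scale1r (B : submodClosed V) : left_id 1 (@quotmod_scale B).
Proof. by move=> x; have [v <-] := quotmod_piP x; rewrite quotmod_piZ scale1r. Qed.

Lemma quotmod_scalerDr (B : submodClosed V) :
  right_distributive (@quotmod_scale B) +%R.
Proof.
move=> a x y; have [[u <-] [v <-]] := (quotmod_piP x, quotmod_piP y).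
by rewrite -quotmod_piD !quotmod_piZ scalerDr quotmod_piD.
Qed.

Lemma quotmod_scalerDl (B : submodClosed V) (x : quotmod B) :
  {morph (@quotmod_scale B)^~ x : a b / a + b}.
Proof.
move=> a b /=; have [v <-] := quotmod_piP x.
by rewrite !quotmod_piZ scalerDl quotmod_piD.
Qed.

HB.instance Definition _ (B : submodClosed V) :=
  GRing.Zmodule_isLmodule.Build R (quotmod B) (@quotmod_scalerA B)
    (@quotmod_scale1r B) (@quotmod_scalerDr B) (@quotmod_scalerDl B).

(* [restr_submod A B] is A :&: B as a submodule of A; hence
   [quotmod (restr_submod A B)] is the module A / (A :&: B), which is A / B
   whenever B is contained in A. *)
Definition restr_submod (A B : submodClosed V) : {pred submod A} :=
  fun x => submod_val x \in B.
Arguments restr_submod : clear implicits.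

Lemma restr_submod_closed (A B : submodClosed V) :
  GRing.submod_closed (restr_submod A B).
Proof.
split; first by rewrite unfold_in /=; exact: (rpred0 B).
move=> a u v uB vB; rewrite unfold_in /=; apply: (rpredD _ vB); exact: rpredZ.
Qed.

HB.instance Definition _ (A B : submodClosed V) :=
  GRing.isSubmodClosed.Build R (submod A) (restr_submod A B)
    (restr_submod_closed A B).

End SubQuotientModules.
Arguments restr_submod {R V} A B x.

Definition subquot (R : nzRingType) (V : lmodType R) (A B : submodClosed V) :
  lmodType R := quotmod (restr_submod A B).

(* n is the supremum of the lengths d of chains P 0 < ... < P d of primes;
   only the values P 0, ..., P d matter. [prime_idealr] includes properness. *)
Definition krull_dim (R : comNzRingType) (n : nat) : Prop :=
  let chain d (P : nat -> prime_idealr R) :=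
    forall i, (i < d)%N ->
      {subset P i <= P i.+1} /\ exists2 x, x \in P i.+1 & x \notin P i in
  (exists P, chain n P) /\ (forall d P, chain d P -> (d <= n)%N).

Definition fg_algebra (k : fieldType) (R : comAlgType k) : Prop :=
  exists s : seq R, forall S : subalgClosed R,
    {subset s <= S} -> forall x, x \in S.

Section Modules.
Variables (R : nzRingType) (V : lmodType R).

Definition nonzero_module : Prop := exists v : V, v != 0.

Definition fg_module : Prop :=
  exists (d : nat) (e : 'I_d -> V), forall v, exists c : 'I_d -> R,
    v = \sum_i c i *: e i.

Definition torsion_free : Prop :=
  forall (r : R) (v : V), r *: v = 0 -> r = 0 \/ v = 0.

Definition lin_indep (d : nat) (e : 'I_d -> V) : Prop :=
  forall c : 'I_d -> R, \sum_i c i *: e i = 0 -> forall i, c i = 0.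

Definition has_rank (d : nat) : Prop :=
  (exists e : 'I_d -> V, lin_indep e) /\
  (forall d' (e : 'I_d' -> V), lin_indep e -> (d' <= d)%N).

(* Over a domain this is the dimension of V tensored with the fraction field. *)
Definition rank : nat := xget 0%N [set d | has_rank d].

End Modules.
Arguments nonzero_module {R} V.
Arguments fg_module {R} V.
Arguments torsion_free {R} V.
Arguments rank {R} V.

Section Gradings.
Variable RR : realType.

(* The sum of the G l over l in D; for a grading G it is direct. *)
Definition homogeneous_sums (V : zmodType) (G : RR -> set V) (D : set RR) :
    set V :=
  [set v | exists (s : seq RR) (f : RR -> V),
    (forall l, l \in s -> D l /\ G l (f l)) /\ v = \sum_(l <- s) f l].

Definition is_grading (V : zmodType) (G : RR -> set V) : Prop :=
  [/\ forall l, G l 0 /\ (forall u v, G l u -> G l v -> G l (u - v)),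
      homogeneous_sums G setT = setT
    & forall (s : seq RR) (f : RR -> V), uniq s ->
        (forall l, l \in s -> G l (f l)) -> \sum_(l <- s) f l = 0 ->
        forall l, l \in s -> f l = 0].

Definition graded_algebra (k : fieldType) (R : comAlgType k)
    (GR : RR -> set R) : Prop :=
  [/\ is_grading GR,
      forall l m x y, GR l x -> GR m y -> GR (l + m) (x * y),
      forall l, l < 0 -> GR l = [set 0]
    & GR 0 = range (fun c : k => c%:A)].

Definition graded_module (R : nzRingType) (GR : RR -> set R)
    (V : lmodType R) (G : RR -> set V) : Prop :=
  is_grading G /\ forall l m r v, GR l r -> G m v -> G (l + m) (r *: v).

(* N is the sum of its intersections with the G l. *)
Definition graded_submodule (R : nzRingType) (V : lmodType R)
    (G : RR -> set V) (N : submodClosed V) : Prop :=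
  forall v, v \in N ->
    homogeneous_sums (fun l => G l `&` [set u | u \in N]) setT v.

Definition sub_grading (R : nzRingType) (V : lmodType R) (G : RR -> set V)
    (A : submodClosed V) : RR -> set (submod A) :=
  fun l => [set x | G l (submod_val x)].
Arguments sub_grading {R V} G A l _.

Definition quot_grading (R : nzRingType) (V : lmodType R) (G : RR -> set V)
    (B : submodClosed V) : RR -> set (quotmod B) :=
  fun l => quotmod_pi B @` G l.
Arguments quot_grading {R V} G B l _.

Definition subquot_grading (R : nzRingType) (V : lmodType R)
    (G : RR -> set V) (A B : submodClosed V) : RR -> set (subquot A B) :=
  quot_grading (sub_grading G A) (restr_submod A B).
Arguments subquot_grading {R V} G A B l _.

End Gradings.
Arguments sub_grading {RR R V} G A l _.
Arguments quot_grading {RR R V} G B l _.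
Arguments subquot_grading {RR R V} G A B l _.

(* Lets the library's [=O_] notation apply at +oo. *)
Canonical pinfty_filter_on (K : numFieldType) :=
  FilterType (pinfty_nbhs K) (@proper_pinfty_nbhs K).

Section Slopes.
Variables (RR : realType) (k : fieldType) (R : comAlgType k).

(* Scalars of k act on an R-module through c |-> c%:A. *)
Definition has_kdim (V : lmodType R) (S : set V) (d : nat) : Prop :=
  exists e : 'I_d -> V,
    [/\ forall i, S (e i),
        forall c : 'I_d -> k,
          \sum_i (c i)%:A *: e i = 0 -> forall i, c i = 0
      & forall v, S v -> exists c : 'I_d -> k, v = \sum_i (c i)%:A *: e i].

Definition kdim (V : lmodType R) (S : set V) : nat :=
  xget 0%N [set d | has_kdim S d].

Definition hilbert (V : lmodType R) (G : RR -> set V) (x : RR) : RR :=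
  (kdim (homogeneous_sums G [set l | l <= x]))%:R.

(* To be instantiated with the Krull dimension of R. *)
Variable n : nat.

Definition is_leading_coef (h : RR -> RR) (a : RR) : Prop :=
  (fun x => h x - a / n`!%:R * x ^+ n) =O_ (pinfty_nbhs RR)
    (fun x => x ^+ n.-1).

Definition is_second_coef (h : RR -> RR) (a b : RR) : Prop :=
  (T ^+ n)^-1 *
    (\int[lebesgue_measure]_(x in `[1, T])
       (h x - a / n`!%:R * x ^+ n - b / (n.-1)`!%:R * x ^+ n.-1))
    @[T --> +oo] --> (0 : RR).

Definition leading_coef (V : lmodType R) (G : RR -> set V) : RR :=
  xget 0 [set a | is_leading_coef (hilbert G) a].

Definition second_coef (V : lmodType R) (G : RR -> set V) : RR :=
  xget 0 [set b | is_second_coef (hilbert G) (leading_coef G) b].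

Variable GR : RR -> set R.

Definition degree (V : lmodType R) (G : RR -> set V) : RR :=
  second_coef G - (rank V)%:R * second_coef (V := R^o) GR.

Definition slope (V : lmodType R) (G : RR -> set V) : RR :=
  degree G / leading_coef G.

Definition semistable (V : lmodType R) (G : RR -> set V) : Prop :=
  [/\ graded_module GR G, nonzero_module V, fg_module V, torsion_free V
    & forall N : submodClosed V, graded_submodule G N ->
        nonzero_module (submod N) -> slope (sub_grading G N) <= slope G].

Definition HN_filtration (M : lmodType R) (GM : RR -> set M)
    (l : nat) (F : nat -> submodClosed M) : Prop :=
  [/\ F 0%N =i pred1 0 /\ F l =i predT,
      forall i, (i < l)%N -> {subset F i <= F i.+1},
      forall i, (i <= l)%N -> graded_submodule GM (F i),
      forall i, (i < l)%N ->
        torsion_free (subquot (F i.+1) (F i)) /\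
        semistable (subquot_grading GM (F i.+1) (F i))
    & forall i, (i.+1 < l)%N ->
        slope (subquot_grading GM (F i.+2) (F i.+1)) <
        slope (subquot_grading GM (F i.+1) (F i))].

End Slopes.

(* Main.v *)
Require Import Defs.
From HB Require Import structures.
From mathcomp Require Import all_boot all_order all_algebra.
From mathcomp Require Import all_classical all_reals all_analysis.
From mathcomp Require Import ring lra zify.

(** The graded submodules of [M] form a modular lattice. On it the rank and, up to
    a multiple of the rank, the second coefficient of the Hilbert function are
    modular functions, since [(A + B) / B] and [A / (A `&` B)] are the same graded
    module. The slope of a subquotient [A / B] is the quotient of the differences
    of a degree and of a rank ([slope_difference]), so that the theorem becomes a
    statement about two modular functions on a lattice, which is
    [abstract_HN_exists] and [abstract_HN_unique]: the step of the filtration above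
    [B] is the largest element whose slope over [B] is maximal. For this the
    degrees have to be bounded above; that the supremum of the slopes is attained
    then follows from the finiteness of the set of ranks and from saturation
    ([max_destab_exists]).

    What has to be established about Hilbert functions is that they have the two
    coefficients, monotone in the submodule. Choose homogeneous generators of [R]
    and [M] and order the monomials by degree, then lexicographically. Modulo a
    submodule, the monomials which are not congruent to combinations of smaller
    ones form a basis, and their exponents form finitely many down-sets of some
    [nat ^ s] ([std_codim], [std_downset]). By Dickson's lemma ([downset_dcc]) a
    down-set is cut out by finitely many sums along arithmetic progressions of
    down-sets with one variable less, and such sums turn an expansion of order [m]
    into one of order [m.+1] ([downset_expansion]). Each expansion also describes
    an antiderivative of the counting function, which is what the integrals that
    define the second coefficient need ([has_expansion]). Dickson's lemma also
    gives the noetherianity of [M] ([submodule_fg]).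

    Ranks come in by comparison with free modules. Adding to a graded submodule
    [A] homogeneous generators of [M], as long as they are independent modulo what
    there is already, produces [B] with the Hilbert function of [A] plus shifted
    copies of that of [R], and with [c *: M] contained in [B] for some nonzero [c]
    ([add_generators]). For [A = 0] this shows that the leading coefficient of [M]
    is its rank times that of [R] ([rank_expansion]). In general the number of
    added generators and their degrees are bounded, and so are the degrees of
    graded submodules ([second_bounded]).

    All this refers to the order of growth [m] of [R]. If [n] is not [m], then all
    leading coefficients of order [n], hence all slopes, are [0], and the lattice
    argument is applied to the degree function [0] ([reduced_degree]). *)

Set Implicit Arguments.
Unset Strict Implicit.
Unset Printing Implicit Defensive.

Import Order.TTheory GRing.Theory Num.Theory.
Import numFieldNormedType.Exports.

Local Open Scope classical_set_scope.
Local Open Scope ring_scope.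

(** * Relative dimension of vector spaces *)

Section RelativeDimension.
Variables (K : fieldType) (W : lmodType K).
Implicit Types (S L : set W).

Definition subspace S := S 0 /\ forall c u v, S u -> S v -> S (c *: u + v).

Definition free_mod (I : finType) L (e : I -> W) :=
  forall c : I -> K, L (\sum_i c i *: e i) -> forall i, c i = 0.

Definition span_mod (I : finType) S L (e : I -> W) :=
  forall v, S v -> exists c : I -> K, L (v - \sum_i c i *: e i).

(** The dimension of [S] modulo [L], expressed by families in [S] so that no
    quotient space has to be formed. *)
Definition has_codim S L d :=
  exists e : 'I_d -> W, [/\ forall i, S (e i), free_mod L e & span_mod S L e].

Lemma subspaceZ S c u : subspace S -> S u -> S (c *: u).
Proof. by move=> [S0 SZ] Su; rewrite -[c *: u]addr0; apply: SZ. Qed.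

Lemma subspaceD S u v : subspace S -> S u -> S v -> S (u + v).
Proof. by move=> [S0 SZ] Su Sv; rewrite -[u]scale1r; apply: SZ. Qed.

Lemma subspaceN S u : subspace S -> S u -> S (- u).
Proof. by move=> Ss Su; rewrite -scaleN1r; apply: subspaceZ. Qed.

Lemma subspaceB S u v : subspace S -> S u -> S v -> S (u - v).
Proof. by move=> Ss Su Sv; apply: subspaceD => //; apply: subspaceN. Qed.

Lemma subspace_sum S (I : Type) (r : seq I) (P : pred I) (F : I -> W) :
  subspace S -> (forall i, P i -> S (F i)) -> S (\sum_(i <- r | P i) F i).
Proof.
move=> Ss SF; elim/big_ind: _ => //; first by case: Ss.
by move=> u v; apply: subspaceD.
Qed.

Lemma subspace0 : subspace [set 0].
Proof. by split=> //= c u v -> ->; rewrite scaler0 addr0. Qed.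

Lemma subspaceI S L : subspace S -> subspace L -> subspace (S `&` L).
Proof.
move=> [S0 SZ] [L0 LZ]; split=> // c u v [Su Lu] [Sv Lv].
by split; [apply: SZ | apply: LZ].
Qed.

Lemma sum_enum_val (V : nmodType) (I : finType) (F : I -> V) :
  \sum_i F i = \sum_(i < #|I|) F (enum_val i).
Proof. by rewrite (reindex _ (onW_bij _ (@enum_val_bij I))). Qed.

Lemma free_mod_ord (I : finType) L (e : I -> W) :
  free_mod L e -> free_mod L (fun i : 'I_#|I| => e (enum_val i)).
Proof.
move=> eF c cL i; rewrite -[i]enum_valK; apply: (eF (fun j => c (enum_rank j))).
rewrite sum_enum_val; congr (L _): cL.
by apply: eq_bigr => j _; rewrite enum_valK.
Qed.

Lemma codim_fin (I : finType) S L (e : I -> W) :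
  (forall i, S (e i)) -> free_mod L e -> span_mod S L e -> has_codim S L #|I|.
Proof.
move=> Se eF eS; exists (fun i => e (enum_val i)); split=> //.
  exact: free_mod_ord.
move=> v /eS [c cL]; exists (fun i => c (enum_val i)).
by rewrite sum_enum_val in cL.
Qed.

(** If the free family were longer, writing it on the spanning one modulo [L] would
    give a matrix with more rows than columns, and a vector of its left kernel would
    be a relation of the free family. *)
Lemma free_span_le (I J : finType) S L (e : I -> W) (f : J -> W) :
  subspace L -> (forall i, S (e i)) -> free_mod L e -> span_mod S L f ->
  (#|I| <= #|J|)%N.
Proof.
move=> Ls Se eF fS; rewrite leqNgt; apply/negP => ltJI.
have /choice[C CP] : forall i, exists c : J -> K, L (e i - \sum_j c j *: f j).
  by move=> i; apply: fS.
pose A := \matrix_(i < #|I|, j < #|J|) C (enum_val i) (enum_val j).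
have : kermx A != 0.
  rewrite kermx_eq0 /row_free; apply/eqP => rA.
  by have := rank_leq_col A; rewrite rA leqNgt ltJI.
move=> /rowV0Pn[u /sub_kermxP uA] /negP; apply.
pose c i := u 0 (enum_rank i).
have cC j : \sum_i c i * C i j = 0.
  have := congr1 (fun B : 'rV_#|J| => B 0 (enum_rank j)) uA.
  rewrite mxE [RHS]mxE => uAj; rewrite sum_enum_val -[RHS]uAj.
  by apply: eq_bigr => i _; rewrite mxE /c enum_valK enum_rankK.
have cL : L (\sum_i c i *: e i).
  have -> : \sum_i c i *: e i = \sum_i c i *: (e i - \sum_j C i j *: f j).
    under [RHS]eq_bigr do rewrite scalerBr.
    rewrite sumrB [X in _ - X](_ : _ = 0) ?subr0 //.
    under eq_bigr do rewrite scaler_sumr.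
    rewrite exchange_big big1 // => j _.
    under eq_bigr do rewrite scalerA.
    by rewrite -scaler_suml cC scale0r.
  by apply: subspace_sum => // i _; apply: subspaceZ.
apply/eqP/rowP => i; rewrite mxE -[i]enum_valK.
exact: (eF c cL (enum_val i)).
Qed.

Lemma has_codim_free_le (I : finType) S L d (e : I -> W) :
  subspace L -> has_codim S L d -> (forall i, S (e i)) -> free_mod L e ->
  (#|I| <= d)%N.
Proof.
move=> Ls [f [_ _ fS]] Se eF.
by rewrite -[d in (_ <= d)%N]card_ord; apply: (free_span_le Ls Se eF fS).
Qed.

Lemma has_codim_uniq S L d d' :
  subspace L -> has_codim S L d -> has_codim S L d' -> d = d'.
Proof.
move=> Ls Sd Sd'; apply/eqP; rewrite eqn_leq.
have [[e [Se eF _]] [e' [Se' eF' _]]] := (Sd, Sd').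
have := has_codim_free_le Ls Sd' Se eF.
by have := has_codim_free_le Ls Sd Se' eF'; rewrite !card_ord => -> ->.
Qed.

(** A free family of maximal length spans. *)
Lemma has_codim_bounded S L N :
  subspace S -> subspace L ->
  (forall d (e : 'I_d -> W), (forall i, S (e i)) -> free_mod L e -> (d <= N)%N) ->
  exists d, has_codim S L d.
Proof.
move=> Ss Ls bnd.
pose P d := `[< exists e : 'I_d -> W, (forall i, S (e i)) /\ free_mod L e >].
have P0 : exists d, P d.
  by exists 0%N; apply/asboolP; exists (fun=> 0); split=> [|c _] [].
have PN d : P d -> (d <= N)%N by move=> /asboolP[e [Se eF]]; exact: bnd Se eF.
case: (ex_maxnP P0 PN) => d /asboolP[e [Se eF]] dmax.
exists d, e; split=> // v Sv; apply: contrapT => nv.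
have: P #|{: 'I_d + unit}|.
  apply/asboolP.
  pose f (i : 'I_d + unit) := if i is inl j then e j else v.
  exists (fun i => f (enum_val i)); split.
    by move=> i; case: (enum_val i) => [j|[]] /=.
  apply: free_mod_ord => c.
  rewrite big_sumType /= [X in _ + X](bigD1 tt) //= [X in _ + (_ + X)]big1 => [|[]//].
  rewrite addr0 => cL.
  have c0 : c (inr tt) = 0.
    apply: contrapT => /eqP c0; apply: nv.
    exists (fun j => - (c (inr tt))^-1 * c (inl j)).
    have := subspaceZ (c (inr tt))^-1 Ls cL; congr (L _).
    rewrite scalerDr scalerA mulVf // scale1r addrC scaler_sumr -sumrN.
    by congr (_ + _); apply: eq_bigr => i _; rewrite scalerA mulNr scaleNr opprK.
  move: cL; rewrite c0 scale0r addr0 => cL [j|[]] //.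
  exact: (eF (fun j => c (inl j)) cL).
by move=> /dmax; rewrite card_sum card_ord card_unit addn1 ltnn.
Qed.

Lemma has_codim_sub S S' L d :
  subspace S' -> subspace L -> S' `<=` S -> has_codim S L d ->
  exists2 d', has_codim S' L d' & (d' <= d)%N.
Proof.
move=> Ss' Ls sub Sd.
have bnd d' (e : 'I_d' -> W) : (forall i, S' (e i)) -> free_mod L e -> (d' <= d)%N.
  move=> Se eF; rewrite -[d']card_ord.
  by apply: (has_codim_free_le Ls Sd) eF => i; apply: sub.
have [d' S'd'] := has_codim_bounded Ss' Ls bnd.
exists d' => //; have [e [Se eF _]] := S'd'; exact: bnd Se eF.
Qed.

Lemma has_codim_le S S' L d d' :
  subspace L -> S' `<=` S -> has_codim S L d -> has_codim S' L d' -> (d' <= d)%N.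
Proof.
move=> Ls sub Sd [e [Se eF _]]; rewrite -[d']card_ord.
by apply: (has_codim_free_le Ls Sd) eF => i; apply: sub.
Qed.

Lemma has_codim_add S L N p q :
  subspace L -> subspace N -> N `<=` L -> L `<=` S ->
  has_codim S L p -> has_codim L N q -> has_codim S N (p + q).
Proof.
move=> Ls Ns NL LS [e [Se eF eS]] [f [Lf fF fS]].
have -> : (p + q)%N = #|{: 'I_p + 'I_q}| by rewrite card_sum !card_ord.
pose g (i : 'I_p + 'I_q) := match i with inl j => e j | inr j => f j end.
apply: (@codim_fin _ _ _ g).
- by case=> i /=; [exact: Se | apply: LS; exact: Lf].
- move=> c; rewrite big_sumType /= => cN.
  have sfL : L (\sum_i c (inr i) *: f i).
    by apply: subspace_sum => // i _; apply: subspaceZ.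
  have ce : forall i, c (inl i) = 0.
    apply: (eF (fun i => c (inl i))).
    by have := subspaceB Ls (NL _ cN) sfL; rewrite addrK.
  case=> i //; apply: (fF (fun i => c (inr i))); move: cN.
  by rewrite big1 ?add0r // => j _; rewrite ce scale0r.
- move=> v /eS[c /fS[c' cc']].
  exists (fun i => match i with inl j => c j | inr j => c' j end).
  by rewrite big_sumType /= opprD addrA.
Qed.

End RelativeDimension.

(** The conditions say that [phi] induces a bijection of [S / L] onto [S' / L'].
    This is applied to inclusions, projections, multiplications by an element and
    to the second isomorphism theorem. *)
Lemma has_codim_map (K : fieldType) (W W' : lmodType K) (phi : W -> W')
    (S L : set W) (S' L' : set W') d :
  linear phi -> subspace S -> subspace L' ->
  (forall v, S v -> S' (phi v)) ->
  (forall v, S v -> (L' (phi v) <-> L v)) ->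
  (forall v', S' v' -> exists2 v, S v & L' (v' - phi v)) ->
  has_codim S L d -> has_codim S' L' d.
Proof.
move=> philin Ss Ls' SS' LL' surj [e [Se eF eS]].
have phi0 : phi 0 = 0 by have := philin (-1) 0 0; rewrite !scaleN1r !oppr0 add0r addNr.
have phisum (c : 'I_d -> K) : phi (\sum_i c i *: e i) = \sum_i c i *: phi (e i).
  have E : {morph phi : u v / u + v}.
    by move=> u v; rewrite -[u]scale1r philin !scale1r.
  rewrite (big_morph phi E phi0); apply: eq_bigr => i _.
  by rewrite -[c i *: e i]addr0 philin phi0 addr0.
have phiB u v : phi (u - v) = phi u - phi v.
  by rewrite -scaleN1r addrC philin scaleN1r addrC.
have Ssum (c : 'I_d -> K) : S (\sum_i c i *: e i).
  by apply: subspace_sum => // i _; apply: subspaceZ.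
exists (fun i => phi (e i)); split=> [i|c cL|v' /surj[v Sv vL]].
- exact: SS'.
- by apply: eF; apply/LL' => //; rewrite phisum.
- have [c cL] := eS v Sv; exists c.
  have := subspaceD Ls' vL ((LL' _ (subspaceB Ss Sv (Ssum c))).2 cL).
  by rewrite phiB phisum addrA subrK.
Qed.

(** * Homogeneous decompositions *)

Section Decompositions.
Variables (RR : realType) (V : zmodType) (G : RR -> set V).
Hypothesis grG : is_grading G.
Implicit Types D : set RR.
Local Notation hs := (homogeneous_sums G).

Let G0 l : G l 0. Proof. by have [/(_ l)[]] := grG. Qed.
Let GB l u v : G l u -> G l v -> G l (u - v).
Proof. by have [/(_ l)[_ h] _ _] := grG; apply: h. Qed.
Let GN l u : G l u -> G l (- u).
Proof. by move=> Gu; rewrite -sub0r; apply: GB. Qed.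
Let GD l u v : G l u -> G l v -> G l (u + v).
Proof. by move=> Gu Gv; rewrite -[v]opprK; apply: GB => //; apply: GN. Qed.

Lemma hs_mono D D' : D `<=` D' -> hs D `<=` hs D'.
Proof.
move=> sDD v [s [f [sf ->]]]; exists s, f; split=> // l /sf[Dl Gl].
by split=> //; apply: sDD.
Qed.

Lemma hs_mem D l v : D l -> G l v -> hs D v.
Proof.
move=> Dl Glv; exists [:: l], (fun=> v); split; last by rewrite big_seq1.
by move=> m; rewrite inE => /eqP ->.
Qed.

(** Decompositions indexed by a duplicate-free list, for which the third clause
    of [is_grading] gives uniqueness. *)
Let reduced D v := exists (s : seq RR) (f : RR -> V),
  [/\ uniq s, forall l, l \in s -> D l /\ G l (f l),
      forall l, l \notin s -> f l = 0 & v = \sum_(l <- s) f l].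

Let reduced_add1 D l u v : D l -> G l u -> reduced D v -> reduced D (u + v).
Proof.
move=> Dl Gu [s [f [us sf f0 ->]]].
pose f' m := f m + (if m == l then u else 0).
have [ls|ls] := boolP (l \in s).
  exists s, f'; split=> // [m ms|m ms|].
  - have [Dm Gm] := sf m ms; split=> //; rewrite /f'; case: eqP => [ml|_].
      by apply: GD => //; rewrite ml.
    by rewrite addr0.
  - rewrite /f' f0 // add0r; case: eqP => // ml.
    by rewrite ml ls in ms.
  - rewrite big_split /= [X in _ = _ + X](bigD1_seq l) //= eqxx.
    by rewrite [X in _ + (_ + X)]big1 ?addr0 1?addrC // => m /negbTE ->.
exists (l :: s), f'; split=> [|m|m|].
- by rewrite /= ls us.
- rewrite inE /f'; case: eqP => [-> _|_ /= ms].
    by rewrite f0 // add0r.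
  by rewrite addr0; apply: sf.
- by rewrite inE negb_or /f' => /andP[/negbTE -> /f0 ->]; rewrite addr0.
- rewrite big_cons /f' f0 // add0r eqxx; congr (_ + _).
  rewrite big_seq [RHS]big_seq; apply: eq_bigr => m ms.
  case: eqP => [ml|]; last by rewrite addr0.
  by rewrite -ml ms in ls.
Qed.

Let hs_reduced_add D u v : hs D u -> reduced D v -> reduced D (u + v).
Proof.
move=> [s [f [sf ->]]] rv; elim: s sf => [|l s IH] sf.
  by rewrite big_nil add0r.
rewrite big_cons -addrA; have [Dl Gl] := sf l (mem_head _ _).
apply: (reduced_add1 Dl Gl).
by apply: IH => m ms; apply: sf; rewrite inE ms orbT.
Qed.

Let reduced_hs D v : reduced D v -> hs D v.
Proof. by move=> [s [f [_ sf _ ->]]]; exists s, f. Qed.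

Let hs_reduced D v : hs D v -> reduced D v.
Proof.
move=> Dv; rewrite -[v]addr0; apply: hs_reduced_add => //.
by exists [::], (fun=> 0); split=> //; rewrite big_nil.
Qed.

Lemma hs_uniq_form D v : hs D v -> exists (s : seq RR) (f : RR -> V),
  [/\ uniq s, forall l, l \in s -> D l /\ G l (f l) & v = \sum_(l <- s) f l].
Proof. by move=> /hs_reduced[s [f [us sf _ vE]]]; exists s, f. Qed.

Lemma hs0 D : hs D 0.
Proof. by exists [::], (fun=> 0); split=> //; rewrite big_nil. Qed.

Lemma hsD D u v : hs D u -> hs D v -> hs D (u + v).
Proof. by move=> Du Dv; apply: reduced_hs; apply: hs_reduced_add => //; apply: hs_reduced. Qed.

Lemma hsN D u : hs D u -> hs D (- u).
Proof.
move=> [s [f [sf ->]]]; exists s, (fun l => - f l); split; last by rewrite sumrN.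
by move=> l /sf[Dl Gl]; split=> //; apply: GN.
Qed.

Lemma hsB D u v : hs D u -> hs D v -> hs D (u - v).
Proof. by move=> Du Dv; apply: hsD => //; apply: hsN. Qed.

Lemma hs_sum D (I : Type) (r : seq I) (P : pred I) (F : I -> V) :
  (forall i, P i -> hs D (F i)) -> hs D (\sum_(i <- r | P i) F i).
Proof. by move=> DF; elim/big_ind: _ => //; [exact: hs0 | exact: hsD]. Qed.

Lemma hs_setT v : hs setT v.
Proof. by have [_ -> _] := grG. Qed.

(** The difference of the two decompositions is a decomposition of [0]. *)
Lemma hs_disjoint D D' v : (forall l, D l -> D' l -> False) ->
  hs D v -> hs D' v -> v = 0.
Proof.
move=> DD' /hs_reduced[s [f [us sf f0 vf]]] /hs_reduced[t [g [ut tg g0 vg]]].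
have dst l : l \in s -> l \notin t.
  by move=> /sf[Dl _]; apply/negP => /tg[/(DD' l Dl)].
have ust : uniq (s ++ t).
  rewrite cat_uniq us ut andbT /=; apply/hasPn => l lt /=.
  by apply/negP => /dst; rewrite lt.
have [_ _ dir] := grG.
have fg0 : \sum_(l <- s ++ t) (f l - g l) = 0.
  rewrite big_cat /= !sumrB -vf -vg.
  rewrite [X in v - X]big1_seq => [|l /andP[_ ls]]; last by rewrite g0 ?dst.
  rewrite [X in _ + (X - _)]big1_seq; first by rewrite subr0 sub0r subrr.
  by move=> l /andP[_ lt]; rewrite f0 //; apply: contraL lt => /dst.
rewrite vf big1_seq // => l /andP[_ ls].
have := dir (s ++ t) (fun l => f l - g l) ust _ fg0 l.
rewrite mem_cat ls g0 ?dst // subr0; apply=> // m.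
rewrite mem_cat => /orP[ms|mt]; first by rewrite g0 ?dst // subr0; case: (sf m ms).
rewrite f0; last by apply: contraL mt => /dst.
by rewrite sub0r; apply: GN; case: (tg m mt).
Qed.

Lemma hs_split D0 D v : hs D0 v ->
  exists2 u, hs (D0 `&` D) u & hs (D0 `&` ~` D) (v - u).
Proof.
move=> [s [f [sf ->]]].
exists (\sum_(l <- s | `[<D l>]) f l).
  exists [seq l <- s | `[<D l>]], f; split; last by rewrite big_filter.
  by move=> l; rewrite mem_filter => /andP[/asboolP Dl /sf[]].
rewrite [X in X - _](bigID (fun l => `[<D l>])) /= addrAC subrr add0r.
exists [seq l <- s | ~~ `[<D l>]], f; split; last by rewrite big_filter.
by move=> l; rewrite mem_filter => /andP[/asboolPn Dl /sf[]].
Qed.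

Lemma hs_split_uniq D u u' : hs D u -> hs (~` D) (u - u') -> hs D u' -> u = u'.
Proof.
move=> Du nD Du'; apply/eqP; rewrite -subr_eq0; apply/eqP.
by apply: (hs_disjoint _ (hsB Du Du') nD) => l Dl /(_ Dl).
Qed.

Lemma hs_trunc_uniq D v u u' : hs D u -> hs (~` D) (v - u) ->
  hs D u' -> hs (~` D) (v - u') -> u = u'.
Proof.
move=> Du nDu Du' nDu'; apply: hs_split_uniq Du _ Du'.
by have := hsB nDu' nDu; rewrite opprB addrC addrA subrK.
Qed.

End Decompositions.

Section GradedModules.
Variables (RR : realType) (R : nzRingType) (GR : RR -> set R).
Variables (V : lmodType R) (G : RR -> set V).
Hypothesis gm : graded_module GR G.

Lemma hs_scale (D E F : set RR) r v : (forall l m, D l -> E m -> F (l + m)) ->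
  homogeneous_sums GR D r -> homogeneous_sums G E v ->
  homogeneous_sums G F (r *: v).
Proof.
move=> DEF [s [f [sf ->]]] [t [g [tg ->]]].
have [grG Gscale] := gm.
rewrite scaler_suml big_seq; apply: hs_sum => // l /sf[Dl Gl].
rewrite scaler_sumr big_seq; apply: hs_sum => // m /tg[Em Gm].
by apply: (hs_mem (DEF _ _ Dl Em)); apply: Gscale.
Qed.

End GradedModules.

(** * Exponent vectors and their weights *)

Section Exponents.
Variable RR : realType.
Implicit Types (ws : seq RR) (a b c : seq nat) (x w : RR).

Fixpoint weight ws a : RR :=
  match ws, a with
  | w :: ws', t :: a' => w *+ t + weight ws' a'
  | _, _ => 0
  end.

(** The first exponent is bounded by [x / w]; for negative [x] the truncation makes
    the bound [0], and the list is emptied by the test at the end. *)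
Fixpoint monos ws x : seq (seq nat) :=
  match ws with
  | [::] => if 0 <= x then [:: [::]] else [::]
  | w :: ws' => [seq t :: a | t <- iota 0 (Num.truncn (x / w)).+1,
                              a <- monos ws' (x - w *+ t)]
  end.

Lemma monos_cons w ws x : monos (w :: ws) x =
  [seq t :: a | t <- iota 0 (Num.truncn (x / w)).+1, a <- monos ws (x - w *+ t)].
Proof. by []. Qed.

Definition addv a b := [seq p.1 + p.2 | p <- zip a b]%N.

Lemma weight_ge0 ws a : all (> 0) ws -> 0 <= weight ws a.
Proof.
elim: ws a => [|w ws IH] [|t a] //= /andP[w0 ws0].
by rewrite addr_ge0 ?IH // mulrn_wge0 ?ltW.
Qed.

Lemma weight_addv ws a b : size a = size ws -> size b = size ws ->
  weight ws (addv a b) = weight ws a + weight ws b.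
Proof.
elim: ws a b => [|w ws IH] [|t a] [|u b] //=; first by rewrite addr0.
by move=> [sa] [sb]; rewrite IH // mulrnDr addrACA.
Qed.

Lemma size_addv a b : size a = size b -> size (addv a b) = size a.
Proof. by move=> sab; rewrite size_map size1_zip ?sab. Qed.

Lemma mem_monos ws x a : all (> 0) ws ->
  (a \in monos ws x) = (size a == size ws) && (weight ws a <= x).
Proof.
elim: ws x a => [|w ws IH] x a.
  by move=> _ /=; case: a => [|t a] /=; case: (0 <= x).
rewrite monos_cons => /andP[w0 ws0]; apply/allpairsPdep/andP => [[t [b [tx bx ->]]]|].
  move: bx; rewrite IH // => /andP[/eqP sb bx] /=; split; first by rewrite sb.
  by rewrite addrC -lerBrDr.
case: a => [[]//|t a] [/eqP[sa]] => [ax]; rewrite /= in ax; exists t, a; split=> //; last first.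
  by rewrite IH // sa eqxx lerBrDr addrC.
rewrite mem_iota add0n /= ltnS.
have wtx : w *+ t <= x by apply: le_trans ax; rewrite lerDl weight_ge0.
have x0 : 0 <= x by apply: le_trans wtx; rewrite mulrn_wge0 ?ltW.
by rewrite truncn_ge_nat ?divr_ge0 ?(ltW w0) // ler_pdivlMr // mulr_natl.
Qed.

Lemma uniq_monos ws x : uniq (monos ws x).
Proof.
elim: ws x => [|w ws IH] x; first by rewrite /=; case: ifP.
rewrite monos_cons; apply: allpairs_uniq_dep; first exact: iota_uniq.
  by move=> t _; exact: IH.
by move=> [t a] [u b] _ _ /= [-> ->].
Qed.

Lemma monos_neg ws x : all (> 0) ws -> x < 0 -> monos ws x = [::].
Proof.
move=> ws0 x0; case E: (monos ws x) => [//|a s].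
have : a \in monos ws x by rewrite E mem_head.
rewrite mem_monos // => /andP[_ ax].
by have := le_lt_trans (weight_ge0 a ws0) (le_lt_trans ax x0); rewrite ltxx.
Qed.

Definition slice (D : set (seq nat)) (t : nat) : set (seq nat) :=
  [set a | D (t :: a)].

(** The counting function of [D] for [f = fun=> 1], and its antiderivative for
    [f = id]. *)
Definition mono_sum ws (D : set (seq nat)) (f : RR -> RR) x : RR :=
  \sum_(a <- monos ws x | `[<D a>]) f (x - weight ws a).

Lemma mono_sum_cons w ws D f x :
  mono_sum (w :: ws) D f x =
  \sum_(t < (Num.truncn (x / w)).+1) mono_sum ws (slice D t) f (x - w *+ t).
Proof.
rewrite {1}/mono_sum monos_cons big_mkcond big_allpairs_dep.
rewrite -[RHS](big_mkord xpredT
  (fun t : nat => mono_sum ws (slice D t) f (x - w *+ t))) /index_iota subn0.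
apply: eq_bigr => t _; rewrite /mono_sum [RHS]big_mkcond; apply: eq_bigr => a _.
by rewrite /= opprD addrA.
Qed.

Lemma mono_sum_neg ws D f x : all (> 0) ws -> x < 0 -> mono_sum ws D f x = 0.
Proof. by move=> ws0 x0; rewrite /mono_sum monos_neg // big_nil. Qed.

End Exponents.

Definition downset (D : set (seq nat)) :=
  forall a b, all2 leq a b -> D b -> D a.

Lemma all2_leq_refl a : all2 leq a a.
Proof. by elim: a => //= t a ->; rewrite leqnn. Qed.

Lemma slice_downset D t : downset D -> downset (slice D t).
Proof. by move=> dD a b ab; apply: dD => /=; rewrite leqnn. Qed.

Lemma slice_anti D t u : downset D -> (t <= u)%N -> slice D u `<=` slice D t.
Proof. by move=> dD tu a; apply: dD; rewrite /= tu all2_leq_refl. Qed.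

Lemma chain_anti T (D : nat -> set T) t u :
  (forall t, D t.+1 `<=` D t) -> (t <= u)%N -> D u `<=` D t.
Proof.
move=> Danti /subnK <-; elim: (u - t)%N => [//|n IH].
by rewrite addSn; apply: subset_trans IH.
Qed.

Lemma uniform_bound (P : nat -> nat -> Prop) d :
  (forall u, (u < d)%N -> exists N, P u N) ->
  (forall u N N', (N <= N')%N -> P u N -> P u N') ->
  exists N, forall u, (u < d)%N -> P u N.
Proof.
move=> H mono; elim: d H => [|d IH] H; first by exists 0%N.
have [|N1 H1] := IH; first by move=> u ud; apply: H; exact: leqW.
have [N2 H2] := H d (ltnSn d); exists (maxn N1 N2) => u.
rewrite ltnS leq_eqVlt => /orP[/eqP ->|ud]; first exact: mono (leq_maxr _ _) H2.
exact: mono (leq_maxl _ _) (H1 u ud).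
Qed.

(** Dickson's lemma, as the descending chain condition on down-sets. In one
    more variable the slices [slice (D t) u] decrease in both [t] and [u]; the
    diagonal stabilizes at some [N], which settles all [u >= N], and only the
    finitely many chains with [u < N] are left. *)
Lemma downset_dcc s (D : nat -> set (seq nat)) :
  (forall t, downset (D t)) -> (forall t, D t.+1 `<=` D t) ->
  exists N, forall t, (N <= t)%N -> forall a, size a = s -> D N a -> D t a.
Proof.
elim: s D => [|s IH] D dD Danti.
  have [[N DN]|nD] := pselect (exists N, ~ D N [::]).
    by exists N => t _ a /size0nil ->.
  exists 0%N => t _ a /size0nil -> _; apply: contrapT => nDt; apply: nD.
  by exists t.
have [N diag] : exists N, forall t, (N <= t)%N -> forall a, size a = s ->
    slice (D N) N a -> slice (D t) t a.
  apply: (IH (fun t => slice (D t) t)) => [t|t a]; first exact: slice_downset.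
  by move=> /(slice_anti (dD _) (leqnSn t)); exact: Danti.
have [N' col] : exists N', forall u, (u < N)%N -> forall t, (N' <= t)%N ->
    forall a, size a = s -> slice (D N') u a -> slice (D t) u a.
  apply: (uniform_bound (P := fun u N' => forall t, (N' <= t)%N ->
    forall a, size a = s -> slice (D N') u a -> slice (D t) u a)) => [u _|u M M' MM' H].
    exact: (IH (fun t => slice (D t) u) (fun t => @slice_downset _ u (dD t))
      (fun t a => Danti t (u :: a))).
  move=> t M't a sa Da; apply: H => //; first exact: leq_trans M't.
  exact: (chain_anti Danti MM') Da.
exists (maxn N N') => t; rewrite geq_max => /andP[Nt N't] [//|u a] [sa] Da.
have [uN|Nu] := ltnP u N.
  by apply: col => //; apply: (chain_anti Danti) Da; rewrite leq_maxr.
have Da' : slice (D N) N a.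
  apply: (slice_anti (dD _) Nu).
  by apply: (chain_anti Danti) Da; rewrite leq_maxl.
have := diag (maxn t u); rewrite leq_max Nt => /(_ isT a sa Da').
move=> /(slice_anti (dD _) (leq_maxr t u)).
by apply: (chain_anti Danti); rewrite leq_maxl.
Qed.

(** * Functions with a two-term asymptotic expansion *)

Section Asymptotics.
Variable RR : realType.
Implicit Types (f g N J : RR -> RR) (p q : {poly RR}) (x y w c : RR).

Definition loc_bounded g := forall B : RR, exists C : RR, forall y, `|y| <= B -> `|g y| <= C.

(** [y ^+ m.-1], except that it is [0] and not [1] for [m = 0]: at level [0] the
    error terms below have to vanish eventually, not just to stay bounded. *)
Definition pred_power m y : RR := if m is m'.+1 then y ^+ m' else 0.

Definition bigO_error m g := loc_bounded g /\
  exists c K : RR, forall y, K <= y -> `|g y| <= c * pred_power m y.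

Definition littleo_error m g := loc_bounded g /\
  forall e : RR, 0 < e -> exists K : RR, forall y, K <= y -> `|g y| <= e * y ^+ m.

(** [N] is to be [a * x ^+ m] up to the order of [x ^+ m.-1], and [J], which will
    be an antiderivative of [N], has a second term [b * x ^+ m]. Carrying whole
    polynomials makes translations and summations exact on the main terms. *)
Definition expansion m a b N J := exists p q,
  [/\ (size p <= m.+1)%N, (size q <= m.+2)%N, p`_m = a,
      q`_m.+1 *+ m.+1 = a & q`_m = b] /\
  bigO_error m (fun y => N y - p.[y]) /\ littleo_error m (fun y => J y - q.[y]).

Lemma loc_boundedD f g : loc_bounded f -> loc_bounded g ->
  loc_bounded (fun y => f y + g y).
Proof.
move=> bf bg B; have [[C1 H1] [C2 H2]] := (bf B, bg B).
exists (C1 + C2) => y yB; apply: le_trans (ler_normD _ _) _.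
by apply: lerD; [apply: H1 | apply: H2].
Qed.

Lemma loc_boundedN f : loc_bounded f -> loc_bounded (fun y => - f y).
Proof. by move=> bf B; have [C H] := bf B; exists C => y /H; rewrite normrN. Qed.

Lemma loc_bounded_shift f c : loc_bounded f -> loc_bounded (fun y => f (y - c)).
Proof.
move=> bf B; have [C H] := bf (B + `|c|); exists C => y yB; apply: H.
by apply: le_trans (ler_normB _ _) _; rewrite lerD2r.
Qed.

Lemma loc_bounded_poly p : loc_bounded (fun y => p.[y]).
Proof.
move=> B; exists (\sum_(i < size p) `|p`_i| * B ^+ i) => y yB.
rewrite horner_coef; apply: le_trans (ler_norm_sum _ _ _) _.
apply: ler_sum => i _; rewrite normrM normrX ler_wpM2l //.
by rewrite lerXn2r // nnegrE (le_trans _ yB).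
Qed.

Lemma poly_le_power p m : (size p <= m.+1)%N ->
  exists c : RR, forall y, 1 <= y -> `|p.[y]| <= c * y ^+ m.
Proof.
move=> sp; exists (\sum_(i < m.+1) `|p`_i|) => y y1.
rewrite (horner_coef_wide _ sp); apply: le_trans (ler_norm_sum _ _ _) _.
rewrite mulr_suml; apply: ler_sum => i _; rewrite normrM ler_wpM2l //.
rewrite ger0_norm ?exprn_ge0 ?(le_trans ler01) //.
by apply: ler_weXn2l => //; rewrite -ltnS.
Qed.

Lemma bigO_error_poly p m : (size p <= m)%N -> bigO_error m (fun y => p.[y]).
Proof.
move=> sp; split; first exact: loc_bounded_poly.
case: m sp => [|m] sp.
  exists 0, 0 => y _; move: sp; rewrite leqn0 size_poly_eq0 => /eqP ->.
  by rewrite horner0 normr0 mul0r.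
by have [c H] := poly_le_power sp; exists c, 1.
Qed.

Lemma bigO_errorD m f g : bigO_error m f -> bigO_error m g ->
  bigO_error m (fun y => f y + g y).
Proof.
move=> [bf [c1 [K1 H1]]] [bg [c2 [K2 H2]]]; split; first exact: loc_boundedD.
exists (c1 + c2), (Num.max K1 K2) => y; rewrite ge_max => /andP[y1 y2].
by apply: le_trans (ler_normD _ _) _; rewrite mulrDl lerD ?H1 ?H2.
Qed.

Lemma bigO_errorN m f : bigO_error m f -> bigO_error m (fun y => - f y).
Proof.
move=> [bf [c [K H]]]; split; first exact: loc_boundedN.
by exists c, K => y /H; rewrite normrN.
Qed.

Lemma littleo_errorD m f g : littleo_error m f -> littleo_error m g ->
  littleo_error m (fun y => f y + g y).
Proof.
move=> [bf Hf] [bg Hg]; split; first exact: loc_boundedD.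
move=> e e0; have e2 : 0 < e / 2 by rewrite divr_gt0.
have [[K1 H1] [K2 H2]] := (Hf _ e2, Hg _ e2).
exists (Num.max K1 K2) => y; rewrite ge_max => /andP[y1 y2].
apply: le_trans (ler_normD _ _) _; rewrite [e]splitr mulrDl.
by rewrite lerD ?H1 ?H2.
Qed.

Lemma littleo_errorN m f : littleo_error m f -> littleo_error m (fun y => - f y).
Proof.
move=> [bf Hf]; split; first exact: loc_boundedN.
by move=> e /Hf[K H]; exists K => y /H; rewrite normrN.
Qed.

Lemma bigO_littleo m g : bigO_error m g -> littleo_error m g.
Proof.
move=> [bg [c [K H]]]; split=> // e e0.
case: m H => [|m] /= H.
  by exists K => y /H /le_trans; apply; rewrite mulr0 mulr_ge0 ?ltW.
exists (Num.max K (Num.max 0 (c / e))) => y; rewrite !ge_max.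
move=> /and3P[/H h y0 yc]; apply: le_trans h _.
by rewrite exprS mulrA ler_wpM2r ?exprn_ge0 // mulrC -ler_pdivrMr.
Qed.

Lemma littleo_bigO m g : littleo_error m g -> bigO_error m.+1 g.
Proof. by move=> [bg /(_ 1 ltr01)[K H]]; split=> //; exists 1, K. Qed.

Lemma shift_power c m y : `|c| <= y -> c <= y -> (y - c) ^+ m <= 2 ^+ m * y ^+ m.
Proof.
move=> cy c_y; rewrite -exprMn; have y0 : 0 <= y by apply: le_trans cy.
rewrite lerXn2r ?nnegrE ?subr_ge0 ?mulr_ge0 //.
rewrite mulr2n mulrDl mul1r lerD2l.
by apply: le_trans cy; rewrite -normrN ler_norm.
Qed.

Lemma bigO_error_shift m g c : bigO_error m g -> bigO_error m (fun y => g (y - c)).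
Proof.
move=> [bg [d [K H]]]; split; first exact: loc_bounded_shift.
case: m H => [|m] /= H.
  by exists d, (K + c) => y yK; apply: H; rewrite lerBrDr.
exists (`|d| * 2 ^+ m), (Num.max (K + c) `|c|) => y.
rewrite ge_max => /andP[yK yc]; apply: le_trans (H _ _) _; first by rewrite lerBrDr.
have cy : c <= y by apply: le_trans yc; exact: ler_norm.
rewrite -mulrA; apply: (@le_trans _ _ (`|d| * (y - c) ^+ m)).
  by rewrite ler_wpM2r ?ler_norm // exprn_ge0 // subr_ge0.
by rewrite ler_wpM2l // shift_power.
Qed.

Lemma littleo_error_shift m g c :
  littleo_error m g -> littleo_error m (fun y => g (y - c)).
Proof.
move=> [bg H]; split; first exact: loc_bounded_shift.
move=> e e0; have em : 0 < e / 2 ^+ m by rewrite divr_gt0 ?exprn_gt0.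
have [K HK] := H _ em.
exists (Num.max (K + c) `|c|) => y; rewrite ge_max => /andP[yK yc].
apply: le_trans (HK _ _) _; first by rewrite lerBrDr.
have cy : c <= y by apply: le_trans yc; exact: ler_norm.
rewrite -mulrA ler_wpM2l ?(ltW e0) // ler_pdivrMl ?exprn_gt0 //.
exact: shift_power.
Qed.

Lemma expansionD m a b N J a' b' N' J' :
  expansion m a b N J -> expansion m a' b' N' J' ->
  expansion m (a + a') (b + b') (fun x => N x + N' x) (fun x => J x + J' x).
Proof.
move=> [p [q [[sp sq pm qm qb] [eN eJ]]]] [p' [q' [[sp' sq' pm' qm' qb'] [eN' eJ']]]].
exists (p + p'), (q + q'); split; first split.
- by rewrite (leq_trans (size_polyD _ _)) // geq_max sp sp'.
- by rewrite (leq_trans (size_polyD _ _)) // geq_max sq sq'.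
- by rewrite coefD pm pm'.
- by rewrite coefD mulrnDl qm qm'.
- by rewrite coefD qb qb'.
have E (u v s t : RR) : (u + v) - (s + t) = (u - s) + (v - t) by rewrite opprD addrACA.
split.
- rewrite (_ : (fun y => _) = fun y => (N y - p.[y]) + (N' y - p'.[y])).
    exact: bigO_errorD.
  by apply/funext => y; rewrite hornerD E.
- rewrite (_ : (fun y => _) = fun y => (J y - q.[y]) + (J' y - q'.[y])).
    exact: littleo_errorD.
  by apply/funext => y; rewrite hornerD E.
Qed.

Lemma expansionN m a b N J : expansion m a b N J ->
  expansion m (- a) (- b) (fun x => - N x) (fun x => - J x).
Proof.
move=> [p [q [[sp sq pm qm qb] [eN eJ]]]].
exists (- p), (- q); split.
  by rewrite !size_polyN !coefN mulNrn pm qm qb; split.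
split.
- rewrite (_ : (fun y => _) = fun y => - (N y - p.[y])); first exact: bigO_errorN.
  by apply/funext => y; rewrite hornerN opprB opprK addrC.
- rewrite (_ : (fun y => _) = fun y => - (J y - q.[y])); first exact: littleo_errorN.
  by apply/funext => y; rewrite hornerN opprB opprK addrC.
Qed.

(** The leading term of the antiderivative is kept as second term one level
    higher, where that of the function itself is part of the error. *)
Lemma expansion_up m a b N J : expansion m a b N J ->
  expansion m.+1 0 (a / m.+1%:R) N J.
Proof.
move=> [p [q [[sp sq pm qm qb] [eN eJ]]]]; exists p, q; split; first split.
- exact: leqW.
- exact: leqW.
- by rewrite nth_default.
- by rewrite nth_default ?mul0rn.
- by rewrite -qm -[_ *+ m.+1]mulr_natr mulfK // pnatr_eq0.
split; first by apply: littleo_bigO; exact: bigO_littleo.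
by apply: bigO_littleo; apply: littleo_bigO.
Qed.

Lemma expansion_shift m a b N J c : expansion m a b N J ->
  exists b', expansion m a b' (fun x => N (x - c)) (fun x => J (x - c)).
Proof.
move=> [p [q [[sp sq pm qm qb] [eN eJ]]]].
have comp_coef (r : {poly RR}) n : (size r <= n.+1)%N ->
    (r \Po ('X - c%:P))`_n = r`_n /\ (size (r \Po ('X - c%:P)) <= n.+1)%N.
  move=> sr; split; last first.
    by rewrite size_comp_poly2 // size_XsubC.
  have [rn|rn] := eqVneq (size r) n.+1; last first.
    have sr' : (size r <= n)%N by rewrite -ltnS ltn_neqAle rn sr.
    by rewrite !nth_default // size_comp_poly2 // size_XsubC.
  have := @lead_coef_comp _ r ('X - c%:P).
  rewrite size_XsubC lead_coefXsubC expr1n mulr1 => /(_ isT).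
  by rewrite !lead_coefE size_comp_poly2 ?size_XsubC // rn.
have [p1 p2] := comp_coef _ _ sp; have [q1 q2] := comp_coef _ _ sq.
exists (q \Po ('X - c%:P))`_m, (p \Po ('X - c%:P)), (q \Po ('X - c%:P)).
split; first by rewrite p1 q1.
split.
- rewrite (_ : (fun y => _) = fun y => (fun x => N x - p.[x]) (y - c)).
    exact: (bigO_error_shift c eN).
  by apply/funext => y; rewrite horner_comp hornerXsubC.
- rewrite (_ : (fun y => _) = fun y => (fun x => J x - q.[x]) (y - c)).
    exact: (littleo_error_shift c eJ).
  by apply/funext => y; rewrite horner_comp hornerXsubC.
Qed.

(** * Summation along an arithmetic progression *)

Definition step_sum w g x := \sum_(j < (Num.truncn (x / w)).+1) g (x - w *+ j).

Lemma step_sumD w f g x :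
  step_sum w (fun y => f y + g y) x = step_sum w f x + step_sum w g x.
Proof. exact: big_split. Qed.

Lemma loc_bounded_step_sum w g : 0 < w -> loc_bounded g -> loc_bounded (step_sum w g).
Proof.
move=> w0 bg B; have [C H] := bg B; exists (C *+ (Num.truncn (B / w)).+1) => x xB.
have C0 : 0 <= C by apply: le_trans (H x xB).
apply: le_trans (ler_norm_sum _ _ _) _.
apply: (@le_trans _ _ (\sum_(j < (Num.truncn (x / w)).+1) C)).
  apply: ler_sum => -[j /= jx] _; apply: H.
  have [x0|x0] := leP 0 x.
    move: jx; rewrite ltnS truncn_ge_nat ?divr_ge0 ?(ltW w0) // ler_pdivlMr //.
    rewrite mulr_natl => jx; rewrite ger0_norm ?subr_ge0 //.
    apply: le_trans xB; rewrite ger0_norm // gerBl.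
    by rewrite mulrn_wge0 // ltW.
  have/negP x1 : ~ (1 <= x / w).
    by move=> h; have := le_trans ler01 h; rewrite pmulr_lge0 ?invr_gt0 // leNgt x0.
  move: jx; rewrite (truncn0Pn _ x1) ltnS leqn0 => /eqP ->.
  by rewrite mulr0n subr0.
rewrite sumr_const card_ord ler_wpMn2l // ltnS.
apply: le_truncn; rewrite ler_pM2r ?invr_gt0 //.
by apply: le_trans xB; exact: ler_norm.
Qed.

Lemma step_sumS w g x : 0 < w -> w <= x ->
  step_sum w g x = g x + step_sum w g (x - w).
Proof.
move=> w0 wx; rewrite /step_sum.
have -> : Num.truncn (x / w) = (Num.truncn ((x - w) / w)).+1.
  rewrite -[x in LHS](subrK w) mulrDl divff ?gt_eqF // addrC.
  by rewrite truncnD ?truncn1 ?rpred1 // nnegrE divr_ge0 ?subr_ge0 // ltW.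
rewrite big_ord_recl mulr0n subr0; congr (_ + _); apply: eq_bigr => j _.
by rewrite /= /bump /= add1n mulrS opprD addrA.
Qed.

(** The bound is propagated by [F x = g x + F (x - w)], because
    [x ^+ j * w <= x ^+ j.+1 - (x - w) ^+ j.+1]. *)
Lemma step_sum_bound w g c K j : 0 < w -> 0 <= c -> loc_bounded g ->
  (forall y, K <= y -> `|g y| <= c * y ^+ j) ->
  exists C : RR, forall x, 0 <= x -> `|step_sum w g x| <= c / w * x ^+ j.+1 + C.
Proof.
move=> w0 c0 bg gK; pose K1 := Num.max K w.
have [C HC] := loc_bounded_step_sum w0 bg (K1 + w).
exists C => x x0.
have [n xn] : exists n, x <= K1 + w + w *+ n.
  exists (Num.truncn (x / w)).+1.
  have := truncnS_gt (x / w); rewrite ltr_pdivrMr // mulr_natl => /ltW xw.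
  apply: le_trans xw _; rewrite lerDr addr_ge0 ?ltW //.
  by rewrite /K1 lt_max w0 orbT.
elim: n x x0 xn => [|n IH] x x0 xn.
  apply: le_trans (HC x _) _; first by rewrite ger0_norm // -[K1 + w]addr0.
  by rewrite lerDr mulr_ge0 ?divr_ge0 ?exprn_ge0 // ltW.
have [xn'|xn'] := leP x (K1 + w + w *+ n); first exact: IH.
have K1x : K1 <= x.
  apply: le_trans (ltW xn'); rewrite -addrA lerDl addr_ge0 ?(ltW w0) //.
  by rewrite mulrn_wge0 ?(ltW w0).
have [Kx wx] : K <= x /\ w <= x by move: K1x; rewrite ge_max => /andP[].
rewrite step_sumS //; apply: le_trans (ler_normD _ _) _.
have IHx : `|step_sum w g (x - w)| <= c / w * (x - w) ^+ j.+1 + C.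
  by apply: IH; rewrite ?subr_ge0 // lerBlDr -addrA -mulrSr.
apply: le_trans (lerD (gK x Kx) IHx) _; rewrite addrA lerD2r.
have -> : c / w * x ^+ j.+1 = c * x ^+ j + c / w * ((x - w) * x ^+ j).
  by rewrite exprS; field; rewrite gt_eqF.
rewrite lerD2l ler_wpM2l ?divr_ge0 ?(ltW w0) // exprS ler_wpM2l ?subr_ge0 //.
by rewrite lerXn2r ?nnegrE ?subr_ge0 // gerBl ltW.
Qed.

(** The difference operator [P |-> P - P \Po ('X - w)] lowers degrees by exactly
    one, hence is onto; the sum of [p] along a progression telescopes. *)
Lemma poly_antidifference w n p : 0 < w -> (size p <= n)%N ->
  exists P : {poly RR}, [/\ (size P <= n.+1)%N, P`_n *+ n * w = p`_n.-1
    & forall x, P.[x] - P.[x - w] = p.[x]].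
Proof.
move=> w0; have power m : exists2 r : {poly RR}, (size r <= m)%N &
    'X^(m.+1) - ('X - w%:P) ^+ m.+1 = (w *+ m.+1) *: 'X^m + r.
  elim: m => [|m [r sr E]].
    exists 0; first by rewrite size_poly0.
    by rewrite !expr1 subKr expr0 addr0 alg_polyC.
  exists (- ((w *+ m.+1 * w) *: 'X^m) + ('X - w%:P) * r).
    rewrite (leq_trans (size_polyD _ _)) // geq_max; apply/andP; split.
      rewrite size_polyN (leq_trans (size_scale_leq _ _)) //.
      by rewrite size_polyXn.
    rewrite (leq_trans (size_polyMleq _ _)) // size_XsubC /=.
    by rewrite add1n ltnS.
  have -> : ('X - w%:P) ^+ m.+2 =
      ('X - w%:P) * ('X^(m.+1) - ((w *+ m.+1) *: 'X^m + r)).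
    by rewrite -E subKr exprS.
  rewrite -!mul_polyC !polyCM ![(w *+ _)%:P]polyCMn !exprS.
  by rewrite -[w%:P *+ m.+2]mulr_natr -[w%:P *+ m.+1]mulr_natr -!natr1; ring.
elim: n p => [|m IH] p sp.
  exists 0; split=> [||x]; rewrite ?size_poly0 ?coef0 ?mul0rn ?mul0r //.
    by rewrite nth_default // leqW.
  by move: sp; rewrite leqn0 size_poly_eq0 => /eqP ->; rewrite !horner0 subr0.
have [r sr E] := power m.
have wm : w *+ m.+1 != 0 by rewrite mulrn_eq0 /= gt_eqF.
pose u := p`_m / (w *+ m.+1).
have sp' : (size (p - u *: ((w *+ m.+1) *: 'X^m + r))%R <= m)%N.
  apply/leq_sizeP => j mj; rewrite coefB coefZ coefD coefZ coefXn.
  rewrite [r`_j]nth_default ?addr0 ?(leq_trans sr) //.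
  have [->|jm] := eqVneq j m; first by rewrite mulr1 divfK // subrr.
  rewrite nth_default ?mulr0 ?subr0 // (leq_trans sp) //.
  by rewrite ltn_neqAle eq_sym jm.
have [P [sP _ HP]] := IH _ sp'.
exists (P + u *: 'X^(m.+1)); split.
- rewrite (leq_trans (size_polyD _ _)) // geq_max leqW //=.
  by rewrite (leq_trans (size_scale_leq _ _)) // size_polyXn.
- rewrite coefD coefZ coefXn eqxx mulr1 nth_default // add0r.
  by rewrite -mulr_natr -mulrA mulr_natl divfK.
- move=> x; rewrite !hornerD !hornerZ !hornerXn opprD addrACA HP.
  rewrite -mulrBr [_.[x] in LHS]hornerD hornerN hornerZ -E !hornerE; ring.
Qed.

Lemma step_sum_poly w p P : 0 < w -> (forall x, P.[x] - P.[x - w] = p.[x]) ->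
  exists C : RR, forall x, 0 <= x -> `|step_sum w (fun y => p.[y]) x - P.[x]| <= C.
Proof.
move=> w0 HP; have [C H] := loc_bounded_poly P w; exists C => x x0.
have -> : step_sum w (fun y => p.[y]) x =
    P.[x] - P.[x - w *+ (Num.truncn (x / w)).+1].
  rewrite /step_sum; elim: (Num.truncn _).+1 => [|n IH].
    by rewrite big_ord0 mulr0n subr0 subrr.
  have -> : x - w *+ n.+1 = x - w *+ n - w by rewrite mulrSr opprD addrA.
  by rewrite big_ord_recr /= IH -HP; ring.
rewrite addrAC subrr add0r normrN; apply: H.
have xw : 0 <= x / w by rewrite divr_ge0 // ltW.
have /andP[] := truncn_itv xw; rewrite ler_pdivlMr // ltr_pdivrMr // !mulr_natl.
by move=> h1 h2; rewrite ltr0_norm ?subr_lt0 // opprB lerBlDr mulrS lerD2l.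
Qed.

(** The polynomials are summed exactly by [step_sum_poly], up to a constant, and
    the errors are summed by [step_sum_bound], which raises their order by one. *)
Lemma expansion_step_sum w m a b N J : 0 < w -> expansion m a b N J ->
  exists b', expansion m.+1 (a / (w *+ m.+1)) b' (step_sum w N) (step_sum w J).
Proof.
move=> w0 [p [q [[sp sq pm qm qb] [[bN [c [K HN]]] [bJ HJ]]]]].
have [P [sP Pm HP]] := poly_antidifference w0 sp.
have [Q [sQ Qm HQ]] := poly_antidifference w0 sq.
have [CP boundP] := step_sum_poly w0 HP; have [CQ boundQ] := step_sum_poly w0 HQ.
have PmE : P`_m.+1 = a / (w *+ m.+1).
  rewrite -pm -[p`_m]Pm -mulr_natr -[w *+ _]mulr_natr; field.
  by rewrite nat1r pnatr_eq0 /= gt_eqF.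
have lb g r s : loc_bounded (fun y => g y - r.[y]) ->
    loc_bounded (fun y => step_sum w g y - s.[y]).
  move=> br; apply: loc_boundedD; last by apply: loc_boundedN; exact: loc_bounded_poly.
  apply: loc_bounded_step_sum => //.
  rewrite (_ : g = fun y => (g y - r.[y]) + r.[y]); last first.
    by apply/funext => y; rewrite subrK.
  by apply: loc_boundedD => //; exact: loc_bounded_poly.
have split_sum g (r s : {poly RR}) x : step_sum w g x - s.[x] =
    step_sum w (fun y => g y - r.[y]) x + (step_sum w (fun y => r.[y]) x - s.[x]).
  rewrite addrA -step_sumD; congr (_ - _); apply: eq_bigr => j _.
  by rewrite subrK.
exists Q`_m.+1, P, Q; split; first split => //.
  apply: (@mulIf _ w); first by rewrite gt_eqF.
  rewrite Qm /= -qm -[w *+ _]mulr_natr -[q`_m.+1 *+ _]mulr_natr; field.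
  by rewrite nat1r pnatr_eq0 /= gt_eqF.
split; split; [exact: lb bN| |exact: lb bJ|].
- have [C HC] : exists C : RR, exists d : RR, forall x, 0 <= x ->
      `|step_sum w (fun y => N y - p.[y]) x| <= d * x ^+ m + C.
    case: m HN {HJ sp sq pm qm qb sP Pm sQ Qm PmE} => [|m] /= HN.
      have [|C HC] := step_sum_bound (c := 0) (j := 0) (K := K) w0 (lexx 0) bN.
        by move=> y /HN; rewrite mulr0 mul0r.
      by exists C, 0 => x /HC; rewrite !mul0r.
    have [|C HC] := step_sum_bound (c := `|c|) (j := m) (K := Num.max 0 K) w0
        (normr_ge0 c) bN.
      move=> y; rewrite ge_max => /andP[y0 /HN h]; apply: le_trans h _.
      by rewrite ler_wpM2r ?exprn_ge0 ?ler_norm.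
    by exists C, (`|c| / w).
  case: HC => d HC; exists (d + `|C| + `|CP|), 1 => x x1 /=.
  have x0 : 0 <= x by apply: le_trans x1.
  have xm : 1 <= x ^+ m by rewrite exprn_ege1.
  rewrite (split_sum N p P); apply: le_trans (ler_normD _ _) _.
  rewrite mulrDl; apply: lerD; last first.
    apply: le_trans (boundP x x0) _; apply: le_trans (ler_norm _) _.
    by rewrite ler_peMr.
  apply: le_trans (HC x x0) _; rewrite mulrDl lerD2l.
  by apply: le_trans (ler_norm _) _; rewrite ler_peMr.
- move=> e e0; have e2w : 0 < e / 2 * w by rewrite mulr_gt0 // divr_gt0.
  have [K' HK'] := HJ _ e2w.
  have [C HC] := step_sum_bound w0 (ltW e2w) bJ HK'.
  exists (Num.max 1 ((`|C| + `|CQ|) / (e / 2))) => x; rewrite ge_max.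
  move=> /andP[x1 xC]; have x0 : 0 <= x by apply: le_trans x1.
  rewrite (split_sum J q Q); apply: le_trans (ler_normD _ _) _.
  apply: le_trans (lerD (HC x x0) (boundQ x x0)) _.
  rewrite mulfK ?gt_eqF // [e in _ <= e * _]splitr mulrDl -addrA lerD2l.
  apply: (@le_trans _ _ (`|C| + `|CQ|)); first by apply: lerD; exact: ler_norm.
  apply: (@le_trans _ _ (e / 2 * x)).
    by rewrite mulrC -ler_pdivrMr // divr_gt0.
  rewrite ler_wpM2l ?divr_ge0 ?(ltW e0) // exprS ler_peMr //.
  by rewrite exprn_ege1.
Qed.

End Asymptotics.

(** * Counting functions of down-sets *)

Section Counting.
Variable RR : realType.
Implicit Types (N J f g : RR -> RR) (x y w c : RR) (ws : seq RR).

(** Positivity of the leading coefficients is what prevents cancellations, so that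
    a sum of two expansions of different orders has the larger one. *)
Definition pos_expansion N J :=
  (forall x, N x = 0 /\ J x = 0) \/
  exists m a b, 0 < a /\ expansion m a b N J.

Lemma expansion_lift m m' a b N J : (m < m')%N -> expansion m a b N J ->
  exists b', expansion m' 0 b' N J.
Proof.
move=> mm' E; have E1 := expansion_up E.
rewrite -(subnK mm'); elim: (m' - m.+1)%N => [|n [b' En]]; first by eexists; exact: E1.
by eexists; rewrite addSn; exact: expansion_up En.
Qed.

Lemma pos_expansionD N J N' J' : pos_expansion N J -> pos_expansion N' J' ->
  pos_expansion (fun x => N x + N' x) (fun x => J x + J' x).
Proof.
move=> [z|[m [a [b [a0 E]]]]].
  have -> : (fun x => N x + N' x) = N' by apply/funext => x; rewrite (z x).1 add0r.
  by have -> : (fun x => J x + J' x) = J' by apply/funext => x; rewrite (z x).2 add0r.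
move=> [z|[m' [a' [b' [a'0 E']]]]].
  have -> : (fun x => N x + N' x) = N by apply/funext => x; rewrite (z x).1 addr0.
  have -> : (fun x => J x + J' x) = J by apply/funext => x; rewrite (z x).2 addr0.
  by right; exists m, a, b.
right; have [mm'|m'm|mE] := ltngtP m m'.
- have [b1 E1] := expansion_lift mm' E.
  by exists m', (0 + a'), (b1 + b'); split; [rewrite add0r | exact: expansionD].
- have [b1 E1] := expansion_lift m'm E'.
  by exists m, (a + 0), (b + b1); split; [rewrite addr0 | exact: expansionD].
- move: E; rewrite mE => E.
  by exists m', (a + a'), (b + b'); split; [exact: addr_gt0 | exact: expansionD].
Qed.

Lemma pos_expansion_sum (I : Type) (r : seq I) (N J : I -> RR -> RR) :
  (forall i, pos_expansion (N i) (J i)) ->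
  pos_expansion (fun x => \sum_(i <- r) N i x) (fun x => \sum_(i <- r) J i x).
Proof.
move=> H; elim: r => [|i r IH]; first by left => x; rewrite !big_nil.
have -> : (fun x => \sum_(j <- i :: r) N j x) = (fun x => N i x + \sum_(j <- r) N j x).
  by apply/funext => x; rewrite big_cons.
have -> : (fun x => \sum_(j <- i :: r) J j x) = (fun x => J i x + \sum_(j <- r) J j x).
  by apply/funext => x; rewrite big_cons.
exact: pos_expansionD.
Qed.

Lemma pos_expansion_shift c N J : pos_expansion N J ->
  pos_expansion (fun x => N (x - c)) (fun x => J (x - c)).
Proof.
move=> [z|[m [a [b [a0 E]]]]]; first by left => x; apply: z.
by right; have [b' E'] := expansion_shift c E; exists m, a, b'.
Qed.

Lemma pos_expansion_step_sum w N J : 0 < w -> pos_expansion N J ->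
  pos_expansion (step_sum w N) (step_sum w J).
Proof.
move=> w0 [z|[m [a [b [a0 E]]]]].
  by left => x; split; apply: big1 => j _; case: (z (x - w *+ j)).
right; have [b' E'] := expansion_step_sum w0 E.
exists m.+1, (a / (w *+ m.+1)), b'; split=> //.
by rewrite divr_gt0 // pmulrn_lgt0.
Qed.

Lemma sum_ord_widen (h : nat -> RR) n m : (n <= m)%N ->
  (forall t, (n <= t)%N -> h t = 0) -> \sum_(t < n) h t = \sum_(t < m) h t.
Proof.
move=> /subnKC <- h0; rewrite big_split_ord /= [X in _ + X]big1 ?addr0 //.
by move=> i _; rewrite h0 // leq_addr.
Qed.

Lemma mono_sum_eq ws D D' f x : all (> 0) ws ->
  (forall a, size a = size ws -> D a <-> D' a) ->
  mono_sum ws D f x = mono_sum ws D' f x.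
Proof.
move=> ws0 DD'; rewrite /mono_sum big_seq_cond [RHS]big_seq_cond.
apply: eq_bigl => a; rewrite mem_monos //; case: eqP => //= sa; congr (_ && _).
exact/asbool_equiv_eq/DD'.
Qed.

(** Once the slices are constant from [n] on, those with index at least [n]
    contribute a sum along a progression of step [w]. *)
Lemma mono_sum_slices w ws D f n : 0 < w -> all (> 0) ws ->
  (forall t, (n <= t)%N -> forall a, size a = size ws ->
    slice D n a <-> slice D t a) ->
  mono_sum (w :: ws) D f =
  fun x => \sum_(t < n) mono_sum ws (slice D t) f (x - w *+ t) +
           step_sum w (mono_sum ws (slice D n) f) (x - w *+ n).
Proof.
move=> w0 ws0 st; apply/funext => x; rewrite mono_sum_cons /step_sum.
have vanish (D' : set (seq nat)) y t : ((Num.truncn (y / w)).+1 <= t)%N ->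
    mono_sum ws D' f (y - w *+ t) = 0.
  move=> yt; apply: mono_sum_neg => //; rewrite subr_lt0.
  have := truncnS_gt (y / w); rewrite ltr_pdivrMr // mulr_natl.
  by move=> /lt_le_trans; apply; apply: ler_wpMn2l => //; exact: ltW.
set T := (Num.truncn (x / w)).+1; set T' := (Num.truncn _).+1.
have T'T : (T' <= T)%N.
  rewrite ltnS le_truncn // ler_pM2r ?invr_gt0 // gerBl mulrn_wge0 //.
  exact: ltW.
rewrite (@sum_ord_widen (fun t => mono_sum ws (slice D t) f (x - w *+ t)) T (n + T)).
- rewrite big_split_ord /=; congr (_ + _).
  rewrite (@sum_ord_widen (fun j => mono_sum ws (slice D n) f (x - w *+ n - w *+ j))
             T' T) //.
    apply: eq_bigr => j _; rewrite mulrnDr opprD addrA.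
    apply: mono_sum_eq => // a sa; have := st (n + j)%N (leq_addr _ _) a sa.
    by case=> h1 h2; split.
  by move=> j; exact: vanish.
- exact: leq_addl.
- by move=> t; exact: vanish.
Qed.

(** Induction on the number of variables, Dickson's lemma making the slices
    eventually constant. Nothing cancels, since all the terms are counts. *)
Theorem downset_expansion ws D : all (> 0) ws -> downset D ->
  pos_expansion (mono_sum ws D (fun=> 1)) (mono_sum ws D id).
Proof.
elim: ws D => [|w ws IH] D.
  move=> _ dD; have [D0|nD0] := pselect (D [::]); last first.
    left => x; rewrite /mono_sum /=; case: ifP => _; rewrite ?big_nil //.
    by rewrite !big_cons !big_nil; case: asboolP.
  have E f x : 0 <= x -> mono_sum [::] D f x = f x.
    by rewrite /mono_sum /= => ->; rewrite big_cons big_nil subr0 addr0 asboolT.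
  have E' f x : x < 0 -> mono_sum [::] D f x = 0.
    by move=> x0; rewrite mono_sum_neg.
  have lb f p : (forall x, 0 <= x -> f x = p.[x]) ->
      loc_bounded (fun y => mono_sum [::] D f y - p.[y]).
    move=> fp; apply: loc_boundedD; last by apply: loc_boundedN; exact: loc_bounded_poly.
    move=> B; have [C H] := loc_bounded_poly p B; exists (Num.max 0 C) => y yB.
    have [y0|y0] := leP 0 y; last by rewrite E' // normr0 le_max lexx.
    by rewrite E // fp // le_max H ?orbT.
  right; exists 0%N, 1, 0; split=> //; exists 1, 'X; split.
    by rewrite size_poly1 size_polyX coefX coefC !coefX.
  split; split.
  - by apply: lb => x _; rewrite hornerC.
  - by exists 0, 0 => y y0; rewrite E // hornerC subrr normr0 mul0r.
  - by apply: lb => x _; rewrite hornerX.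
  - move=> e e0; exists 0 => y y0.
    by rewrite E // hornerX subrr normr0 mulr_ge0 ?exprn_ge0 // ltW.
move=> /= /andP[w0 ws0] dD.
have [n st] := downset_dcc (size ws) (fun t => @slice_downset D t dD)
  (fun t => @slice_anti D t _ dD (leqnSn t)).
have st' t : (n <= t)%N -> forall a, size a = size ws ->
    slice D n a <-> slice D t a.
  move=> nt a sa; split; first exact: st.
  exact: slice_anti.
rewrite !(mono_sum_slices _ w0 ws0 st').
apply: pos_expansionD.
  under eq_fun do rewrite -(big_mkord xpredT
    (fun t : nat => mono_sum ws (slice D t) (fun=> 1) (_ - w *+ t))).
  under [X in pos_expansion _ X]eq_fun do rewrite -(big_mkord xpredT
    (fun t : nat => mono_sum ws (slice D t) id (_ - w *+ t))).
  apply: pos_expansion_sum => t.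
  by apply: pos_expansion_shift; apply: IH => //; exact: slice_downset.
apply: pos_expansion_shift; apply: pos_expansion_step_sum => //.
by apply: IH => //; exact: slice_downset.
Qed.

End Counting.

(** * Monomial bases of quotient modules *)

Section MonomialOrder.
Variable RR : realType.
Variables (ws ls : seq RR).
Hypothesis ws_gt0 : all (> 0) ws.
Implicit Types (a b c : seq nat) (m : nat * seq nat).

Fixpoint ltlex a b : bool :=
  match a, b with
  | t :: a', u :: b' => (t < u)%N || (t == u) && ltlex a' b'
  | _, _ => false
  end.

Lemma ltlex_irr a : ltlex a a = false.
Proof. by elim: a => //= t a ->; rewrite ltnn eqxx. Qed.

Lemma ltlex_trans : transitive ltlex.
Proof.
elim=> [|t b IH] [|s a] [|u c] //= /orP[st|/andP[/eqP -> ab]].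
  by move=> /orP[tu|/andP[/eqP <- _]]; rewrite ?st ?(ltn_trans st tu).
move=> /orP[->//|/andP[-> bc]]; by rewrite (IH _ _ ab bc) orbT.
Qed.

Lemma ltlex_total a b : size a = size b -> a != b -> ltlex a b || ltlex b a.
Proof.
elim: a b => [|t a IH] [|u b] //= [sab].
by rewrite eqseq_cons; case: ltngtP => //= _ /(IH _ sab).
Qed.

Lemma ltlex_addv a b c : size a = size c -> size b = size c ->
  ltlex (addv a c) (addv b c) = ltlex a b.
Proof.
elim: c a b => [|u c IH] [|s a] [|t b] //= [sa] [sb].
by rewrite ltn_add2r eqn_add2r IH.
Qed.

(** The pair [(j, a)] stands for the monomial of exponent [a] times the [j]-th
    generator of the module. *)
Definition valid m := (m.1 < size ls)%N && (size m.2 == size ws).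

Definition wgt m : RR := nth 0 ls m.1 + weight ws m.2.

(** Comparing weights first makes the sets of smaller monomials finite. *)
Definition prec m m' :=
  (wgt m < wgt m') || (wgt m == wgt m') && ltlex (m.1 :: m.2) (m'.1 :: m'.2).

Definition shift m c := (m.1, addv m.2 c).

Definition monl (x : RR) : seq (nat * seq nat) :=
  [seq (j, a) | j <- iota 0 (size ls), a <- monos ws (x - nth 0 ls j)].

Lemma mem_monl x m : (m \in monl x) = valid m && (wgt m <= x).
Proof.
rewrite /valid /wgt addrC -lerBrDr -andbA -mem_monos //.
case: m => j a; apply/allpairsPdep/andP => [[j' [a' [jl aw [-> ->]]]]|[jl aw]].
  by move: jl; rewrite mem_iota.
by exists j, a; rewrite mem_iota.
Qed.

Lemma uniq_monl x : uniq (monl x).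
Proof.
apply: allpairs_uniq_dep; first exact: iota_uniq.
  by move=> j _; exact: uniq_monos.
by move=> [j a] [i b] _ _ /= [-> ->].
Qed.

Lemma prec_irr m : prec m m = false.
Proof. by rewrite /prec ltxx eqxx ltlex_irr. Qed.

Lemma prec_trans : transitive prec.
Proof.
move=> m2 m1 m3 /orP[lt12|/andP[/eqP e12 l12]] /orP[lt23|/andP[/eqP e23 l23]].
- by rewrite /prec (lt_trans lt12 lt23).
- by rewrite /prec -e23 lt12.
- by rewrite /prec e12 lt23.
- by rewrite /prec e12 e23 eqxx (ltlex_trans l12 l23) orbT.
Qed.

Lemma prec_total m m' : valid m -> valid m' -> m != m' -> prec m m' || prec m' m.
Proof.
move=> /andP[_ /eqP s1] /andP[_ /eqP s2] mm'.
rewrite /prec; case: ltgtP => //= _.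
have := @ltlex_total (m.1 :: m.2) (m'.1 :: m'.2); rewrite /= s1 s2; apply=> //.
Qed.

Lemma prec_wgt m m' : prec m m' -> wgt m <= wgt m'.
Proof. by move=> /orP[/ltW//|/andP[/eqP ->]]. Qed.

Lemma wgt_shift m c : size m.2 = size ws -> size c = size ws ->
  wgt (shift m c) = wgt m + weight ws c.
Proof. by move=> sm sc; rewrite /wgt /= weight_addv // addrA. Qed.

Lemma valid_shift m c : valid m -> size c = size ws -> valid (shift m c).
Proof. by move=> /andP[h1 /eqP h2] sc; rewrite /valid /= h1 size_addv ?h2 ?sc /=. Qed.

Lemma prec_shift m m' c : valid m -> valid m' -> size c = size ws ->
  prec m m' -> prec (shift m c) (shift m' c).
Proof.
move=> /andP[_ /eqP s1] /andP[_ /eqP s2] sc.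
rewrite /prec !wgt_shift // ltrD2r (inj_eq (addIr _)) /=.
by rewrite ltlex_addv ?s1 ?s2.
Qed.

End MonomialOrder.

Lemma seq_extremum (T : eqType) (r : rel T) (s : seq T) :
  transitive r -> {in s &, forall x y, x != y -> r x y || r y x} -> s <> [::] ->
  exists2 x, x \in s & {in s, forall y, y != x -> r y x}.
Proof.
move=> rt; elim: s => [//|x s IH] tot _.
have [->|/eqP s0] := eqVneq s [::].
  exists x; first exact: mem_head.
  by move=> y; rewrite inE => /eqP ->; rewrite eqxx.
have [|y ys ymax] := IH _ s0.
  by move=> u v us vs; apply: tot; rewrite inE ?us ?vs orbT.
have [xy|xy] := boolP ((x == y) || r x y).
  exists y; first by rewrite inE ys orbT.
  move=> z; rewrite inE => /orP[/eqP -> zy|/ymax//].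
  by move: xy; rewrite (negbTE zy).
move: xy; rewrite negb_or => /andP[xny nrxy].
have ryx : r y x.
  have := tot x y; rewrite mem_head inE ys orbT (negbTE nrxy).
  by apply.
exists x; first exact: mem_head.
move=> z; rewrite inE => /orP[/eqP ->|zs _]; first by rewrite eqxx.
have [->//|zy] := eqVneq z y.
exact: rt (ymax z zs zy) ryx.
Qed.

Section LinearSpan.
Variables (K : fieldType) (W : lmodType K).
Implicit Types (P Q : set W).

Inductive lspan P : set W :=
| lspan_nil : lspan P 0
| lspan_cons c u v : P u -> lspan P v -> lspan P (c *: u + v).

Lemma lspan_mem P u : P u -> lspan P u.
Proof. by move=> Pu; rewrite -[u]scale1r -[_ *: u]addr0; right=> //; left. Qed.

Lemma lspan_subspace P : subspace (lspan P).
Proof.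
split=> [|c u v Pu Pv]; first by left.
elim: Pu => [|d w t Pw _ IH]; first by rewrite scaler0 add0r.
by rewrite scalerDr scalerA -addrA; right.
Qed.

Lemma lspan_sub P S : subspace S -> P `<=` S -> lspan P `<=` S.
Proof.
by move=> [S0 SZ] PS v; elim=> // c u w Pu _ Sw; apply: SZ => //; exact: PS.
Qed.

Lemma lspan_seq (T : eqType) (s : seq T) (t0 : T) (F : T -> W) v :
  lspan [set F t | t in [set` s]] v ->
  exists c : 'I_(size s) -> K, v = \sum_i c i *: F (nth t0 s i).
Proof.
elim=> [|c u w [t /= ts <-] _ [d ->]].
  by exists (fun=> 0); rewrite big1 // => i _; rewrite scale0r.
have ti : (index t s < size s)%N by rewrite index_mem.
exists (fun i => (if i == Ordinal ti then c else 0) + d i).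
under [RHS]eq_bigr do rewrite scalerDl.
rewrite big_split /=; congr (_ + _).
rewrite (bigD1 (Ordinal ti)) //= eqxx nth_index // big1 ?addr0 //.
by move=> i /negbTE ->; rewrite scale0r.
Qed.

End LinearSpan.

Lemma lspan_map (K : fieldType) (W W' : lmodType K) (phi : W -> W')
    (P : set W) (Q : set W') :
  linear phi -> (forall u, P u -> Q (phi u)) ->
  forall v, lspan P v -> lspan Q (phi v).
Proof.
move=> lphi PQ v; elim=> [|c u w Pu _ Qw].
  by have := lphi (-1) 0 0; rewrite !scaleN1r oppr0 add0r addNr => ->; left.
by rewrite lphi; right=> //; exact: PQ.
Qed.

(** An alias, because the module structure of [V] itself is the one over [R]; [k]
    acts through the algebra [R]. *)
Definition kmod (k : fieldType) (R : comAlgType k) (V : lmodType R) : Type := V.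

Section KMod.
Variables (k : fieldType) (R : comAlgType k) (V : lmodType R).

HB.instance Definition _ := GRing.Zmodule.on (kmod V).

Let kscale (c : k) (v : kmod V) : kmod V := c%:A *: (v : V).

Let kscaleA c d v : kscale c (kscale d v) = kscale (c * d) v.
Proof. by rewrite /kscale scalerA -scalerAl mul1r scalerA. Qed.
Let kscale1 : left_id 1 kscale.
Proof. by move=> v; rewrite /kscale scale1r scale1r. Qed.
Let kscaleDr : right_distributive kscale +%R.
Proof. by move=> c u v; rewrite /kscale scalerDr. Qed.
Let kscaleDl v : {morph kscale^~ v : c d / c + d}.
Proof. by move=> c d; rewrite /kscale !scalerDl. Qed.

HB.instance Definition _ :=
  GRing.Zmodule_isLmodule.Build k (kmod V) kscaleA kscale1 kscaleDr kscaleDl.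

Lemma kmod_scaleE (c : k) (v : kmod V) : c *: v = (c%:A : R) *: (v : V) :> V.
Proof. by []. Qed.

Lemma has_kdimP (S : set V) d :
  has_kdim S d <-> has_codim (S : set (kmod V)) [set 0] d.
Proof.
split=> [[e [Se eF eS]]|[e [Se eF eS]]]; exists e; split=> //.
- by move=> v /eS[c vE]; exists c; apply/eqP; rewrite subr_eq0; apply/eqP.
- by move=> v /eS[c /eqP]; rewrite subr_eq0 => /eqP vE; exists c.
Qed.

Lemma kdim_eq (S : set V) d : has_kdim S d -> kdim S = d.
Proof.
move=> Sd; apply: xget_subset1 => // d1 d2 /has_kdimP h1 /has_kdimP h2.
exact: (has_codim_uniq (@subspace0 _ _) h1 h2).
Qed.

Lemma scale_klinear (r : R) : linear (fun v : kmod V => r *: (v : V) : kmod V).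
Proof.
move=> c u v /=; rewrite !kmod_scaleE scalerDr; congr (_ + _).
by rewrite !scalerA mulrC.
Qed.

End KMod.

Definition upto (RR : realType) (V : zmodType) (G : RR -> set V) (x : RR) : set V :=
  homogeneous_sums G [set l | l <= x].

Lemma upto_exists (RR : realType) (V : zmodType) (G : RR -> set V) v :
  is_grading G -> exists x, upto G x v.
Proof.
move=> grG; have [s [f [sf ->]]] := hs_setT grG v.
exists (\big[Num.max/0]_(l <- s) l), s, f; split=> // l ls.
by split; [exact: le_bigmax_seq | case: (sf l ls)].
Qed.

Section Monomials.
Variables (k : fieldType) (R : comAlgType k) (V : lmodType R).
Implicit Types (xs : seq R) (vs : seq V).

Fixpoint mon xs (a : seq nat) : R :=
  match xs, a with
  | x :: xs', t :: a' => x ^+ t * mon xs' a'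
  | _, _ => 1
  end.

Definition mvec xs vs (m : nat * seq nat) : kmod V := mon xs m.2 *: nth 0 vs m.1.

Lemma mon_addv xs a b : size a = size xs -> size b = size xs ->
  mon xs (addv a b) = mon xs a * mon xs b.
Proof.
elim: xs a b => [|x xs IH] [|t a] [|u b] //=; first by rewrite mulr1.
by move=> [sa] [sb]; rewrite IH // exprD mulrACA.
Qed.

Lemma mvec_shift xs vs m c : size m.2 = size xs -> size c = size xs ->
  mvec xs vs (shift m c) = mon xs c *: (mvec xs vs m : V).
Proof. by move=> sm sc; rewrite /mvec /= mon_addv // scalerA mulrC. Qed.

End Monomials.

Section StandardMonomials.
Variables (RR : realType) (k : fieldType) (R : comAlgType k) (GR : RR -> set R).
Hypothesis grR : graded_algebra GR.

Lemma graded_scalar (c : k) : GR 0 (c%:A).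
Proof. by have [_ _ _ ->] := grR; exists c. Qed.

Lemma graded_one : GR 0 1.
Proof. by have := graded_scalar 1; rewrite scale1r. Qed.

Section OneModule.
Variables (V : lmodType R) (G : RR -> set V).
Hypothesis grV : graded_module GR G.

Lemma hs_subspace (D : set RR) : subspace (homogeneous_sums G D : set (kmod V)).
Proof.
have [grG _] := grV.
split=> [|c u v Du Dv]; first exact: hs0.
apply: hsD => //; rewrite kmod_scaleE.
apply: (@hs_scale _ _ _ _ _ grV [set 0] D D) => //.
  by move=> l m -> Dm; rewrite add0r.
by apply: (hs_mem (l := 0)) => //; exact: graded_scalar.
Qed.

Lemma upto_subspace x : subspace (upto G x : set (kmod V)).
Proof. exact: hs_subspace. Qed.

Variables (xs : seq R) (ws : seq RR) (vs : seq V) (ls : seq RR).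

Definition homogeneous_generators :=
  [/\ size xs = size ws /\ size vs = size ls, all (> 0) ws,
      forall i, (i < size ws)%N -> GR ws`_i xs`_i,
      forall j, (j < size ls)%N -> G ls`_j vs`_j
    & forall v : kmod V, lspan [set mvec xs vs m | m in [set m | valid ws ls m]] v].

Hypothesis gens : homogeneous_generators.
Let ws_gt0 : all (> 0) ws. Proof. by case: gens. Qed.
Let sxs : size xs = size ws. Proof. by case: gens => [[]]. Qed.
Local Notation mvec := (mvec xs vs).
Local Notation valid := (valid ws ls).
Local Notation prec := (prec ws ls).
Local Notation wgt := (wgt ws ls).
Local Notation monl := (monl ws ls).

Lemma mon_graded a : size a = size ws -> GR (weight ws a) (mon xs a).
Proof.
have [_ _ gx _ _] := gens; have [_ GM _ _] := grR.
elim: xs ws a sxs gx => [|x xs' IH] [|w ws'] [|t a] //= sx gx //.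
  by move=> _; exact: graded_one.
case: sx => sx [sa]; apply: (GM (w *+ t)); last by apply: IH => // i; exact: (gx i.+1).
elim: t => [|t IHt]; last by rewrite mulrS exprS; apply: GM => //; exact: (gx 0%N).
by rewrite mulr0n expr0; exact: graded_one.
Qed.

Lemma mvec_graded m : valid m -> G (wgt m) (mvec m).
Proof.
have [_ _ _ gv _] := gens; have [_ GS] := grV.
move=> /andP[jl /eqP sm]; rewrite /wgt addrC; apply: GS; last exact: gv.
exact: mon_graded.
Qed.

(** Only monomials of weight at most [x] are needed: the others contribute an
    element without components of degree at most [x]. *)
Lemma upto_span x v : upto G x v -> lspan [set mvec m | m in [set` monl x]] v.
Proof.
have [_ _ _ _ gen] := gens; have [grG _] := grV.
move=> xv; pose small := [set mvec m | m in [set` monl x]].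
suff [u [su lu]] : exists u : kmod V, lspan small u /\
    homogeneous_sums G (~` [set l | l <= x]) (v - u : V).
  have xu : upto G x u.
    apply: (lspan_sub (upto_subspace x)) su => _ [m /= + <-].
    rewrite mem_monl // => /andP[vm mx].
    by apply: (hs_mem (l := wgt m)) => //; exact: mvec_graded.
  by rewrite (hs_split_uniq grG xv lu xu).
elim: (gen v) => [|c w t [m /= vm <-] _ [u [su lu]]].
  by exists 0; split; [left | rewrite subr0; exact: hs0].
have [mx|mx] := leP (wgt m) x.
  exists (c *: mvec m + u); split.
    by right=> //; exists m => //=; rewrite mem_monl // vm mx.
  by rewrite opprD addrACA subrr add0r.
exists u; split=> //; rewrite -addrA.
have := (hs_subspace (~` [set l | l <= x])).2; apply=> //.
apply: (hs_mem (l := wgt m)); last exact: mvec_graded.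
by apply/negP; rewrite -ltNge.
Qed.

Definition nonstd (A : submodClosed V) m := exists u : kmod V,
  lspan [set mvec m' | m' in [set m' | valid m' && prec m' m]] u /\
  (mvec m - u : V) \in A.

(** Only its lists of length [size ws] matter, which are the exponent vectors. *)
Definition std (A : submodClosed V) j : set (seq nat) :=
  [set a | size a = size ws -> ~ nonstd A (j, a)].

Lemma all2_leqP a b : all2 leq a b -> exists2 c, size c = size a & b = addv a c.
Proof.
elim: a b => [|t a IH] [|u b] //=; first by exists [::].
move=> /andP[tu /IH[c sc ->]]; exists ((u - t)%N :: c); first by rewrite /= sc.
by rewrite /addv /= subnKC.
Qed.

(** Multiplying by a monomial preserves the order of monomials and [A]. *)
Lemma std_downset A j : (j < size ls)%N -> downset (std A j).
Proof.
move=> jl a b /all2_leqP[c sc ->] sb sa [u [su uA]]; move: sb.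
rewrite /std /= size_addv ?sc // => /(_ sa); apply.
have sc' : size c = size ws by rewrite sc.
have va : valid (j, a) by rewrite /valid /= jl sa eqxx.
exists (mon xs c *: (u : V)); split.
  apply: (lspan_map (@scale_klinear _ _ V (mon xs c)) _ su) => _ [m /= /andP[vm pm] <-].
  exists (shift m c).
    by rewrite /= valid_shift //= (@prec_shift _ ws ls m (j, a) c).
  by rewrite mvec_shift // ?sxs //; case/andP: vm => _ /eqP.
rewrite -[(j, _)]/(shift (j, a) c) mvec_shift ?sxs //.
by have := rpredZ (mon xs c) uA; rewrite [_ *: _]scalerBr.
Qed.

Definition stdl (A : submodClosed V) x := [seq m <- monl x | ~~ `[< nonstd A m >]].

Lemma stdlP A x m : m \in stdl A x -> valid m /\ ~ nonstd A m.
Proof. by rewrite mem_filter mem_monl // => /and3P[/asboolP ns vm _]. Qed.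

(** The smallest monomial which is not congruent to a combination of standard ones
    would be nonstandard, hence congruent to a combination of smaller ones. *)
Lemma std_span A x m : m \in monl x ->
  exists2 u : kmod V, lspan [set mvec m' | m' in [set` stdl A x]] u &
    (mvec m - u : V) \in A.
Proof.
pose good m := `[< exists2 u : kmod V, lspan [set mvec m' | m' in [set` stdl A x]] u &
    (mvec m - u : V) \in A >].
suff bad0 : [seq m <- monl x | ~~ good m] = [::].
  move=> mx; apply/asboolP; rewrite -[asbool _]/(good m); apply: contraPT bad0 => bm.
  have : m \in [seq m <- monl x | ~~ good m] by rewrite mem_filter bm.
  by case: [seq m <- monl x | ~~ good m].
apply: contrapT => bad0.
have [||m0 m0bad m0min] := @seq_extremum _ (fun m m' => prec m' m) _ _ _ bad0.
- by move=> m2 m1 m3 h1 h2; exact: prec_trans h2 h1.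
- move=> m1 m2; rewrite !mem_filter !mem_monl // => /and3P[_ v1 _] /and3P[_ v2 _].
  by move=> m12; rewrite orbC; exact: prec_total.
move: m0bad; rewrite mem_filter mem_monl // => /and3P[/asboolP bm0 vm0 m0x].
have [ns|ns] := pselect (nonstd A m0); last first.
  apply: bm0; exists (mvec m0); last by rewrite subrr rpred0.
  apply: lspan_mem; exists m0 => //=.
  by rewrite mem_filter mem_monl // vm0 m0x !andbT; apply/asboolPn.
apply: bm0; have [u [su uA]] := ns.
suff [t st tA] : exists2 t : kmod V, lspan [set mvec m' | m' in [set` stdl A x]] t &
    (u - t : V) \in A.
  exists t => //; rewrite -[mvec m0](subrK (u : V)) -addrA; exact: rpredD.
elim: su => [|c w s [m' /= /andP[vm' pm'] <-] _ [t st tA]].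
  by exists 0; [left | rewrite subr0 rpred0].
have m'x : m' \in monl x by rewrite mem_monl // vm' (le_trans (prec_wgt pm')).
have : good m'.
  apply: contraT => bm'; have := m0min m'; rewrite mem_filter bm' m'x.
  have [mm|mm] := eqVneq m' m0; first by move: pm'; rewrite mm prec_irr.
  move=> /(_ isT isT) pm0; have := prec_trans pm' pm0; by rewrite prec_irr.
move=> /asboolP[u' su' u'A]; exists (c *: u' + t).
  by apply: (lspan_subspace _).2.
rewrite opprD addrACA; apply: rpredD => //.
by rewrite -scalerBr kmod_scaleE rpredZ.
Qed.

Lemma std_span_upto A x v : upto G x v ->
  exists2 u : kmod V, lspan [set mvec m | m in [set` stdl A x]] u &
    (v - u : V) \in A.
Proof.
move=> xv; elim: (upto_span xv) => [|c w t [m /= mx <-] _ [u su uA]].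
  by exists 0; [left | rewrite subr0 rpred0].
have [u' su' u'A] := std_span A mx; exists (c *: u' + u).
  by apply: (lspan_subspace _).2.
rewrite opprD addrACA; apply: rpredD => //.
by have := rpredZ c%:A u'A; rewrite [_ *: _]scalerBr.
Qed.

(** If some coefficient were nonzero, the largest monomial with this property would
    be congruent modulo [A] to a combination of smaller ones. *)
Lemma std_free (A : submodClosed V) s (c : 'I_(size s) -> k) :
  uniq s -> (forall m, m \in s -> valid m /\ ~ nonstd A m) ->
  (\sum_i c i *: mvec (nth (0%N, [::]) s i) : V) \in A -> forall i, c i = 0.
Proof.
pose m0 : nat * seq nat := (0%N, [::]).
move=> us sP cA i; apply: contrapT => /eqP ci.
pose supp := [seq m <- s | [exists j : 'I_(size s), (nth m0 s j == m) && (c j != 0)]].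
have supp0 : supp <> [::].
  have : nth m0 s i \in supp.
    rewrite mem_filter mem_nth // andbT; apply/existsP; exists i.
    by rewrite eqxx ci.
  by case: supp.
have suppS m : m \in supp -> m \in s by rewrite mem_filter => /andP[].
have [||m ms mmax] := @seq_extremum _ prec supp _ _ supp0.
- exact: prec_trans.
- move=> m1 m2 /suppS/sP[v1 _] /suppS/sP[v2 _]; exact: prec_total.
move: ms; rewrite mem_filter => /andP[/existsP[j /andP[/eqP jm cj]] ms].
have [vm nsm] := sP m ms; apply: nsm.
exists (- (c j)^-1 *: \sum_(l | l != j) c l *: mvec (nth m0 s l)); split.
  apply: subspaceZ; first exact: lspan_subspace.
  apply: subspace_sum => [|l lj]; first exact: lspan_subspace.
  have [->|cl] := eqVneq (c l) 0; first by rewrite scale0r; left.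
  apply: subspaceZ; first exact: lspan_subspace.
  have ls_ : nth m0 s l \in s by apply: mem_nth.
  apply: lspan_mem; exists (nth m0 s l) => //=; rewrite (sP _ ls_).1 /=.
  apply: mmax; last by rewrite -jm nth_uniq.
  by rewrite mem_filter ls_ andbT; apply/existsP; exists l; rewrite eqxx cl.
have := rpredZ (c j)^-1%:A cA; rewrite -kmod_scaleE (bigD1 j) //= jm.
rewrite scalerDr scalerA mulVf // scale1r scaleNr opprK; exact.
Qed.

Lemma std_codim (A : submodClosed V) x :
  has_codim (upto G x : set (kmod V)) (upto G x `&` [set v | v \in A])
    (size (stdl A x)).
Proof.
pose m0 : nat * seq nat := (0%N, [::]).
have std_upto i : (i < size (stdl A x))%N -> upto G x (mvec (nth m0 (stdl A x) i)).
  move=> /(mem_nth m0); rewrite mem_filter mem_monl // => /and3P[_ vm mx].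
  by apply: (hs_mem (l := wgt (nth m0 (stdl A x) i))) => //; exact: mvec_graded.
exists (fun i => mvec (nth m0 (stdl A x) i)); split=> [i|c [_ cA]|v xv].
- exact: std_upto.
- apply: std_free cA; first by rewrite filter_uniq // uniq_monl.
  exact: stdlP.
have [u su uA] := std_span_upto A xv.
have [c uE] := lspan_seq m0 su; exists c; rewrite -uE; split=> //.
apply: (subspaceB (upto_subspace x) xv); rewrite uE.
apply: subspace_sum => [|i _]; first exact: upto_subspace.
by apply: (subspaceZ _ (upto_subspace x)); exact: std_upto.
Qed.

Lemma size_stdl A x : (size (stdl A x))%:R =
  \sum_(j <- iota 0 (size ls)) mono_sum ws (std A j) (fun=> 1) (x - ls`_j) :> RR.
Proof.
rewrite size_filter -sum1_count natr_sum big_mkcond big_allpairs_dep.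
apply: eq_bigr => j _; rewrite /mono_sum [RHS]big_mkcond.
rewrite big_seq [RHS]big_seq; apply: eq_bigr => a; rewrite mem_monos // => /andP[/eqP sa _].
have -> : `[< std A j a >] = ~~ `[< nonstd A (j, a) >].
  by rewrite -asbool_neg; apply: asbool_equiv_eq; split=> [h|h _] //; exact: h.
by case: ifP.
Qed.

(** This transports the descending chain condition on down-sets to submodules. The
    remainder of an element of [B] modulo [A] is a combination of standard monomials
    of [A], hence of [B], which lies in [B], and so vanishes by [std_free]. *)
Lemma std_inj (A B : submodClosed V) : {subset A <= B} ->
  (forall j a, (j < size ls)%N -> size a = size ws -> std A j a -> std B j a) ->
  {subset B <= A}.
Proof.
move=> AB stdAB v vB.
have [grG _] := grV; have [x xv] := upto_exists v grG.
have [u su uA] := std_span_upto A xv.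
have [c uE] := lspan_seq (0%N, [::]) su.
suff c0 : forall i, c i = 0.
  move: uA; rewrite uE big1 ?subr0 // => i _.
  by rewrite c0 scale0r.
apply: (@std_free B (stdl A x)).
- by rewrite filter_uniq // uniq_monl.
- move=> [j a] /stdlP[vja nA]; split=> //.
  have /andP[/= jl /eqP sa] := vja.
  exact: (stdAB j a jl sa (fun _ => nA) sa).
- rewrite -uE -[u : V](subKr v); apply: (rpredD vB); rewrite -scaleN1r rpredZ //.
  exact: AB.
Qed.

End OneModule.
End StandardMonomials.

(** * Homogeneous generators and noetherianity *)

(** [submodClosed] is a structure on boolean predicates; this is its instance on a
    classical set. *)
Definition mksub (R : nzRingType) (V : lmodType R) (S : set V)
    (closedS : GRing.submod_closed (fun v => `[< S v >])) : submodClosed V :=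
  HB.pack_for (submodClosed V) (fun v => `[< S v >])
    (GRing.isSubmodClosed.Build R V (fun v => `[< S v >]) closedS).

Lemma submod_closed_set (R : nzRingType) (V : lmodType R) (S : set V) :
  S 0 -> (forall r u v, S u -> S v -> S (r *: u + v)) ->
  GRing.submod_closed (fun v => `[< S v >]).
Proof.
move=> S0 SZ; split; first exact/asboolP.
by move=> r u v /asboolP Su /asboolP Sv; apply/asboolP; exact: SZ.
Qed.

Lemma mem_mksub (R : nzRingType) (V : lmodType R) (S : set V) closedS v :
  (v \in @mksub R V S closedS) <-> S v.
Proof. by split=> [/asboolP|Sv] //; apply/asboolP. Qed.

Lemma homogeneous_pieces (RR : realType) (V : zmodType) (G : RR -> set V) (s : seq V) :
  is_grading G -> exists hv : seq (RR * V), (forall p, p \in hv -> G p.1 p.2) /\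
    forall v, v \in s -> exists2 e : seq (RR * V), {subset e <= hv} & v = \sum_(p <- e) p.2.
Proof.
move=> grG; elim: s => [|v s [hv [hvG hvs]]]; first by exists [::].
have [t [f [tf vE]]] := hs_setT grG v.
pose e := [seq (l, f l) | l <- t].
exists (e ++ hv); split.
  move=> p; rewrite mem_cat => /orP[/mapP[l lt ->]|/hvG//].
  by case: (tf l lt).
move=> u; rewrite inE => /orP[/eqP ->|/hvs[e' e'hv ->]].
  exists e; first by move=> p pe; rewrite mem_cat pe.
  by rewrite big_map vE.
by exists e' => // p /e'hv phv; rewrite mem_cat phv orbT.
Qed.

Section Generators.
Variables (RR : realType) (k : fieldType) (R : comAlgType k) (GR : RR -> set R).
Hypotheses (grR : graded_algebra GR) (R_fg : fg_algebra R).

Let mons (xs : seq R) : set (kmod R^o) :=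
  lspan [set (mon xs a : kmod R^o) | a in [set a | size a = size xs]].

Let mon_nseq0 (xs : seq R) : mon xs (nseq (size xs) 0%N) = 1.
Proof. by elim: xs => //= x xs ->; rewrite expr0 mulr1. Qed.

Let mons_mem xs i : (i < size xs)%N -> mons xs (xs`_i : kmod R^o).
Proof.
move=> ix; apply: lspan_mem.
elim: xs i ix => [//|x xs IH] [|i] /= ix.
  by exists (1%N :: nseq (size xs) 0%N); rewrite /= ?size_nseq // mon_nseq0 expr1 mulr1.
have [a /= sa aE] := IH i ix.
by exists (0%N :: a); rewrite /= ?sa // expr0 mul1r.
Qed.

Let mons_scalar xs (c : k) : mons xs ((c%:A : R) : kmod R^o).
Proof.
have -> : ((c%:A : R) : kmod R^o) = c *: ((1 : R) : kmod R^o) :> kmod R^o.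
  by rewrite kmod_scaleE /GRing.scale /= mulr1.
apply: (subspaceZ (W := kmod R^o) c (lspan_subspace _)); apply: lspan_mem.
by exists (nseq (size xs) 0%N); rewrite /= ?size_nseq ?mon_nseq0.
Qed.

Let mons_mul xs (x y : R) :
  mons xs (x : kmod R^o) -> mons xs (y : kmod R^o) -> mons xs (x * y : kmod R^o).
Proof.
move=> mx my; elim: mx => [|c u v [a /= sa <-] _ IH].
  by rewrite mul0r; left.
rewrite mulrDl; apply: (subspaceD (lspan_subspace _)) => //.
suff : mons xs (mon xs a * y : kmod R^o).
  move=> /(subspaceZ c (lspan_subspace _)).
  by rewrite kmod_scaleE /GRing.scale /= -mulrA.
apply: (lspan_map (@scale_klinear _ _ R^o (mon xs a)) _ my) => _ [b /= sb <-].
exists (addv a b); first by rewrite /= size_addv sa.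
by rewrite mon_addv.
Qed.

(** Among the homogeneous components of generators, those of negative degree
    vanish and those of degree [0] are scalars. *)
Lemma algebra_generators : exists (xs : seq R) (ws : seq RR),
  [/\ size xs = size ws, all (> 0) ws,
      forall i, (i < size ws)%N -> GR ws`_i xs`_i &
      forall r : kmod R^o,
        lspan [set (mon xs a : kmod R^o) | a in [set a | size a = size xs]] r].
Proof.
have [s sgen] := R_fg; have [grG GM Gneg G0] := grR.
have [hv [hvG hvs]] := homogeneous_pieces s grG.
pose hx := [seq p <- hv | 0 < p.1]; pose xs := [seq p.2 | p <- hx].
exists xs, [seq p.1 | p <- hx]; rewrite !size_map; split=> //.
- by apply/allP => l /mapP[p + ->]; rewrite mem_filter => /andP[].
- move=> i ix; rewrite !(nth_map (0, 0)) //; apply: hvG.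
  by have := mem_nth (0, 0) ix; rewrite mem_filter => /andP[].
rewrite -[size hx](size_map snd) -/xs.
have clS : GRing.subalg_closed (fun r : R => `[< mons xs r >]).
  split.
  - by apply/asboolP; have := mons_scalar xs 1; rewrite scale1r.
  - move=> c u v /asboolP Su /asboolP Sv; apply/asboolP.
    have := (lspan_subspace _).2 c _ _ Su Sv.
    by rewrite kmod_scaleE /GRing.scale /= -scalerAl mul1r.
  - by move=> u v /asboolP Su /asboolP Sv; apply/asboolP; exact: mons_mul.
pose S : subalgClosed R := HB.pack_for (subalgClosed R) (fun r : R => `[< mons xs r >])
  (GRing.isSubalgClosed.Build k R (fun r : R => `[< mons xs r >]) clS).
have inS := sgen S; move=> r; suff : r \in S by move=> /asboolP.
apply: inS => {}r /hvs[e ehv ->]; rewrite big_seq; apply: rpred_sum => p /ehv phv.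
have [p0|p0|p0] := ltgtP p.1 0.
- by have := hvG p phv; rewrite Gneg // => /= ->; apply/asboolP; left.
- have phx : p \in hx by rewrite mem_filter p0.
  apply/asboolP; have := @mons_mem xs (index p hx).
  by rewrite size_map index_mem phx (nth_map (0, 0)) ?index_mem // nth_index //; apply.
- have := hvG p phv; rewrite p0 G0 => -[c _ <-]; apply/asboolP; exact: mons_scalar.
Qed.

Lemma module_generators (V : lmodType R) (G : RR -> set V) :
  graded_module GR G -> fg_module V ->
  exists xs ws vs ls, homogeneous_generators GR G xs ws vs ls.
Proof.
move=> [grG GS] [d [e egen]].
have [xs [ws [sxs ws0 xG xgen]]] := algebra_generators.
have [hv [hvG hvs]] := homogeneous_pieces [seq e i | i <- enum 'I_d] grG.
exists xs, ws, [seq p.2 | p <- hv], [seq p.1 | p <- hv]; split=> //.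
- by rewrite !size_map.
- move=> j; rewrite size_map => jh; rewrite !(nth_map (0, 0)) //.
  by apply: hvG; exact: mem_nth.
move=> v; have [c ->] := egen v.
apply: (@subspace_sum _ (kmod V)) => [|i _]; first exact: lspan_subspace.
have [|t thv ->] := hvs (e i); first by rewrite map_f // mem_enum.
rewrite scaler_sumr big_seq; apply: (@subspace_sum _ (kmod V)) => [|p /thv phv]; first exact: lspan_subspace.
have lin : linear (fun r : kmod R^o => (r : R) *: p.2 : kmod V).
  move=> a r r'; rewrite !kmod_scaleE scalerDl; congr (_ + _).
  by rewrite scalerA.
apply: (lspan_map lin _ (xgen (c i : kmod R^o))) => _ [a /= sa <-].
exists (index p hv, a).
  by rewrite /= /valid /= size_map index_mem phv sa sxs eqxx.
by rewrite /mvec /= (nth_map (0, 0)) ?index_mem // nth_index.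
Qed.

End Generators.

Section Noetherian.
Variables (RR : realType) (k : fieldType) (R : comAlgType k) (GR : RR -> set R).
Hypotheses (grR : graded_algebra GR) (R_fg : fg_algebra R).
Variables (V : lmodType R) (G : RR -> set V).
Hypotheses (grV : graded_module GR G) (V_fg : fg_module V).

Let combs (s : seq V) : set V :=
  [set v | exists c : 'I_(size s) -> R, v = \sum_i c i *: s`_i].

Let combs_closed s : GRing.submod_closed (fun v => `[< combs s v >]).
Proof.
apply: submod_closed_set.
  by exists (fun=> 0); rewrite big1 // => i _; rewrite scale0r.
move=> r u v [c ->] [d ->]; exists (fun i => r * c i + d i).
rewrite scaler_sumr -big_split; apply: eq_bigr => i _.
by rewrite scalerDl scalerA.
Qed.

(** A submodule without a finite generating set would give a strictly
    increasing sequence of submodules, hence by [std_inj] a strictly decreasing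
    sequence of sets of standard monomials. *)
Lemma submodule_fg (A : submodClosed V) : fg_module (submod A).
Proof.
have [s sA sgen] : exists2 s : seq V, {subset s <= A} & forall v, v \in A -> combs s v.
  apply: contrapT => nfg.
  have /choice[g gP] (s : seq V) : exists v,
      {subset s <= A} -> v \in A /\ ~ combs s v.
    have [sA|nsA] := pselect {subset s <= A}; last by exists 0.
    apply: contrapT => nv; apply: nfg; exists s => // v vA.
    by apply: contrapT => nc; apply: nv; exists v.
  pose S := fix S n := if n is n'.+1 then g (S n') :: S n' else [::].
  have SA n : {subset S n <= A}.
    elim: n => [//|n IH] v; rewrite /= inE => /orP[/eqP ->|/IH//].
    by have [] := gP _ IH.
  pose B n := mksub (combs_closed (S n)).
  have BS n : {subset B n <= B n.+1}.
    move=> v /mem_mksub[c ->]; apply/mem_mksub.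
    exists (fun i => if unlift ord0 i is Some j then c j else 0).
    rewrite big_ord_recl unlift_none scale0r add0r.
    by apply: eq_bigr => i _; rewrite liftK.
  have [xs [ws [vs [ls gens]]]] := module_generators grR R_fg grV V_fg.
  have stdB j n : std xs ws vs ls (B n.+1) j `<=` std xs ws vs ls (B n) j.
    move=> a aB sa [u [su uB]]; apply: (aB sa); exists u; split=> //; exact: BS.
  have [N HN] : exists N, forall j, (j < size ls)%N -> forall t, (N <= t)%N ->
      forall a, size a = size ws -> std xs ws vs ls (B N) j a ->
      std xs ws vs ls (B t) j a.
    apply: (uniform_bound (P := fun j N => forall t, (N <= t)%N -> forall a,
        size a = size ws -> std xs ws vs ls (B N) j a -> std xs ws vs ls (B t) j a)).
      move=> j jl.
      exact: (@downset_dcc (size ws) (fun n => std xs ws vs ls (B n) j)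
        (fun n => std_downset (A := B n) gens jl) (fun n => stdB j n)).
    move=> j M M' MM' H t M't a sa Da; apply: H => //; first exact: leq_trans M't.
    exact: (chain_anti (stdB j) MM') Da.
  have sub := std_inj grR grV gens (BS N) (fun j a jl sa => HN j jl N.+1 (leqnSn N) a sa).
  have [_] := gP _ (SA N); apply; apply/mem_mksub/sub/mem_mksub.
  exists (fun i => if unlift ord0 i is Some j then 0 else 1).
  rewrite big_ord_recl unlift_none scale1r big1 ?addr0 // => i _.
  by rewrite liftK scale0r.
have sA' i : (i < size s)%N -> s`_i \in A by move=> si; apply: sA; exact: mem_nth.
exists (size s), (fun i : 'I_(size s) => Submod (sA' i (ltn_ord i))) => v.
have [c vE] := sgen _ (submod_valP v); exists c; apply: val_inj.
rewrite [LHS]vE raddf_sum; apply: eq_bigr => i _.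
by [].
Qed.

End Noetherian.

(** * Hilbert functions of graded submodules *)

(** Submodules are handled as sets, for which inclusion is a partial order with
    extensional equality, as the lattice argument requires. *)

Section SubmoduleSets.
Variables (R : nzRingType) (V : lmodType R).
Implicit Types (A B : set V).

Definition rsub A := A 0 /\ forall r u v, A u -> A v -> A (r *: u + v).

Lemma rsubZ A r u : rsub A -> A u -> A (r *: u).
Proof. by move=> [A0 AZ] Au; rewrite -[_ *: _]addr0; apply: AZ. Qed.

Lemma rsubD A u v : rsub A -> A u -> A v -> A (u + v).
Proof. by move=> [A0 AZ] Au Av; rewrite -[u]scale1r; apply: AZ. Qed.

Lemma rsubN A u : rsub A -> A u -> A (- u).
Proof. by move=> As Au; rewrite -scaleN1r; apply: rsubZ. Qed.

Lemma rsubB A u v : rsub A -> A u -> A v -> A (u - v).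
Proof. by move=> As Au Av; apply: rsubD => //; apply: rsubN. Qed.

Lemma rsub_sum A (I : Type) (r : seq I) (P : pred I) (F : I -> V) :
  rsub A -> (forall i, P i -> A (F i)) -> A (\sum_(i <- r | P i) F i).
Proof.
move=> As AF; elim/big_ind: _ => //; first by case: As.
by move=> u v; apply: rsubD.
Qed.

Lemma rsubI A B : rsub A -> rsub B -> rsub (A `&` B).
Proof.
move=> [A0 AZ] [B0 BZ]; split=> // r u v [Au Bu] [Av Bv].
by split; [apply: AZ | apply: BZ].
Qed.

Definition sums A B : set V := [set v | exists u w, [/\ A u, B w & v = u + w]].

Lemma rsub_sums A B : rsub A -> rsub B -> rsub (sums A B).
Proof.
move=> [A0 AZ] [B0 BZ]; split; first by exists 0, 0; rewrite addr0.
move=> r _ _ [u [w [Au Bw ->]]] [u' [w' [Au' Bw' ->]]].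
exists (r *: u + u'), (r *: w + w').
by split; [exact: AZ | exact: BZ | rewrite scalerDr addrACA].
Qed.

Lemma sums_l A B : rsub B -> A `<=` sums A B.
Proof. by move=> [B0 _] v Av; exists v, 0; rewrite addr0. Qed.

Lemma sums_r A B : rsub A -> B `<=` sums A B.
Proof. by move=> [A0 _] v Bv; exists 0, v; rewrite add0r. Qed.

Definition line v : set V := range (fun r => r *: v).

Lemma rsub_line v : rsub (line v).
Proof.
split; first by exists 0; rewrite ?scale0r.
move=> r _ _ [a _ <-] [b _ <-]; exists (r * a + b) => //.
by rewrite scalerDl scalerA.
Qed.

Lemma rsub_submod (A : submodClosed V) : rsub [set v | v \in A].
Proof.
split; first by rewrite /= rpred0.
by move=> r u v /= uA vA; rewrite rpredD // rpredZ.
Qed.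

Lemma rsub_mksub A : rsub A -> exists B : submodClosed V, [set v | v \in B] = A.
Proof.
move=> [A0 AZ]; exists (mksub (submod_closed_set A0 AZ)).
by apply/seteqP; split=> v; [exact: (mem_mksub _ v).1 | exact: (mem_mksub _ v).2].
Qed.

Lemma rsub0 : rsub [set 0].
Proof. by split=> // r u v -> ->; rewrite scaler0 addr0. Qed.

Lemma rsubT : rsub setT.
Proof. by []. Qed.

End SubmoduleSets.

Section GradedSubmodules.
Variables (RR : realType) (R : nzRingType) (GR : RR -> set R).
Variables (V : lmodType R) (G : RR -> set V).
Hypotheses (grR : is_grading GR) (grV : graded_module GR G).
Implicit Types (A B : set V) (D : set RR).

(** For a submodule, a reformulation of [graded_submodule] which is easily
    inherited by sums and intersections. *)
Definition truncatable A := forall D v, A v ->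
  exists u, [/\ homogeneous_sums G D u, A u & homogeneous_sums G (~` D) (v - u)].

Definition gsub A := rsub A /\ truncatable A.

Lemma gsub_graded (A : submodClosed V) :
  gsub [set v | v \in A] <-> graded_submodule G A.
Proof.
have [grG _] := grV; split=> [[As At] v vA|Agr]; last first.
  split; first exact: rsub_submod.
  move=> D v /= /Agr vs.
  have [u [s [f [sf uE]]] [t [g [tg vuE]]]] := hs_split D vs.
  exists u; split.
  - by exists s, f; split=> // l /sf[[_ Dl] [Gl _]].
  - by rewrite uE big_seq; apply: rpred_sum => l /sf[_ []].
  - by exists t, g; split=> // l /tg[[_ Dl] [Gl _]].
have [s [f [us sf vE]]] := hs_uniq_form grG (hs_setT grG v).
exists s, f; split=> // l ls; split=> //; have [_ Gl] := sf l ls; split=> //=.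
have [u [lu uA nlu]] := At [set l] v vA.
have lf : homogeneous_sums G [set l] (f l) by apply: (hs_mem (l := l)).
suff -> : f l = u by [].
apply: (hs_trunc_uniq grG lf _ lu nlu).
exists [seq m <- s | m != l], f; split.
  by move=> m; rewrite mem_filter => /andP[/eqP ml /sf[]].
by rewrite vE (bigD1_seq l) //= addrC addrK big_filter.
Qed.

Lemma gsubI A B : gsub A -> gsub B -> gsub (A `&` B).
Proof.
have [grG _] := grV.
move=> [As At] [Bs Bt]; split; first exact: rsubI.
move=> D v [Av Bv]; have [u [Du uA nDu]] := At D v Av.
have [u' [Du' uB nDu']] := Bt D v Bv; exists u; split=> //; split=> //.
by rewrite (hs_trunc_uniq grG Du nDu Du' nDu').
Qed.

Lemma gsub_sums A B : gsub A -> gsub B -> gsub (sums A B).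
Proof.
have [grG _] := grV.
move=> [As At] [Bs Bt]; split; first exact: rsub_sums.
move=> D _ [v [w [/(At D)[u [Du uA nDu]] /(Bt D)[u' [Du' uB nDu']] ->]]].
exists (u + u'); split; first exact: hsD.
  by exists u, u'.
by rewrite opprD addrACA; apply: hsD.
Qed.

Lemma gsub_line l v : G l v -> gsub (line v).
Proof.
have [grG _] := grV => Gv; split; first exact: rsub_line.
move=> D _ [r _ <-].
have [c Dc nDc] := hs_split [set m | D (m + l)] (hs_setT grR r).
exists (c *: v); split; [|by exists c|].
  by apply: (hs_scale grV _ Dc (hs_mem (erefl l : [set l] l) Gv)) => m _ [_ Dm] ->.
rewrite -scalerBl.
by apply: (hs_scale grV _ nDc (hs_mem (erefl l : [set l] l) Gv)) => m _ [_ Dm] ->.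
Qed.

Lemma gsub0 : gsub [set 0].
Proof.
have [grG _] := grV; split; first exact: rsub0.
by move=> D _ ->; exists 0; rewrite subr0; split=> //; exact: hs0.
Qed.

Lemma gsubT : gsub setT.
Proof.
have [grG _] := grV; split; first exact: rsubT.
move=> D v _; have [u [s [f [sf uE]]] [t [g [tg vE]]]] := hs_split D (hs_setT grG v).
exists u; split=> //.
  by exists s, f; split=> // l /sf[[_ Dl]].
by exists t, g; split=> // l /tg[[_ Dl]].
Qed.

End GradedSubmodules.

Section HilbertOfSubsets.
Variables (RR : realType) (k : fieldType) (R : comAlgType k) (GR : RR -> set R).
Hypotheses (grR : graded_algebra GR) (R_fg : fg_algebra R).
Variables (V : lmodType R) (G : RR -> set V).
Hypotheses (grV : graded_module GR G) (V_fg : fg_module V).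
Implicit Types (A B C : set V) (x : RR).

(** Measured inside [V], which makes all submodules comparable. *)
Definition hf A x : nat := kdim (V := V) (upto G x `&` A).

Lemma rsub_subspace A : rsub A -> subspace (A : set (kmod V)).
Proof. by move=> [A0 AZ]; split=> // c u v Au Av; rewrite kmod_scaleE; apply: AZ. Qed.

Lemma upto_rsub A x : rsub A -> subspace (upto G x `&` A : set (kmod V)).
Proof.
by move=> As; apply: subspaceI; [exact: (upto_subspace grR grV) | exact: rsub_subspace].
Qed.

Lemma has_hf A x : rsub A ->
  has_codim (upto G x `&` A : set (kmod V)) [set 0] (hf A x).
Proof.
move=> As; have [xs [ws [vs [ls gens]]]] := module_generators grR R_fg grV V_fg.
have [Z ZE] := rsub_mksub (@rsub0 _ V).
have := std_codim grR grV gens Z x; rewrite ZE.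
have -> : (upto G x `&` [set 0])%classic = [set 0] :> set (kmod V).
  apply/seteqP; split=> v /=; first by case.
  by move=> ->; split=> //; exact: (upto_subspace grR grV x).1.
move=> Sd; have [d Ad _] := has_codim_sub (upto_rsub x As) (@subspace0 _ _)
  (@subIsetl _ _ _) Sd.
by rewrite /hf (kdim_eq ((has_kdimP _ _).2 Ad)).
Qed.

Lemma hf_uniq A x d : has_codim (upto G x `&` A : set (kmod V)) [set 0] d ->
  hf A x = d.
Proof. by move=> /has_kdimP/kdim_eq. Qed.

Lemma hf_le A B x : rsub A -> rsub B -> A `<=` B -> (hf A x <= hf B x)%N.
Proof.
move=> As Bs AB; apply: has_codim_le (has_hf x Bs) (has_hf x As); first exact: subspace0.
by move=> v [xv Av]; split=> //; exact: AB.
Qed.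

Lemma hf_codim A B x : rsub A -> rsub B -> A `<=` B ->
  exists2 d, has_codim (upto G x `&` B : set (kmod V)) (upto G x `&` A) d &
    hf B x = (d + hf A x)%N.
Proof.
move=> As Bs AB; have Bh := has_hf x Bs.
have [|d Bd] := @has_codim_bounded _ (kmod V) (upto G x `&` B) (upto G x `&` A)
    (hf B x) (upto_rsub x Bs) (upto_rsub x As).
  move=> d e Se eF; rewrite -[d]card_ord.
  apply: (has_codim_free_le (@subspace0 _ _) Bh Se) => c c0; apply: eF.
  by rewrite (c0 : _ = 0); exact: (upto_rsub x As).1.
exists d => //; apply: hf_uniq.
apply: has_codim_add Bd (has_hf x As); first exact: (upto_rsub x As).
- exact: subspace0.
- by move=> _ ->; exact: (upto_rsub x As).1.
- by move=> v [xv Av]; split=> //; exact: AB.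
Qed.

Lemma hf_codim_eq A B x d : rsub A -> rsub B -> A `<=` B ->
  has_codim (upto G x `&` B : set (kmod V)) (upto G x `&` A) d ->
  hf B x = (d + hf A x)%N.
Proof.
move=> As Bs AB Bd; have [d' Bd' ->] := hf_codim x As Bs AB.
by rewrite (has_codim_uniq (upto_rsub x As) Bd Bd').
Qed.

(** [A / (A `&` B)] and [(A + B) / B] are the same graded module. *)
Lemma hf_modular A B x : gsub G A -> gsub G B ->
  (hf (sums A B) x + hf (A `&` B) x = hf A x + hf B x)%N.
Proof.
have [grG _] := grV; move=> [As At] [Bs Bt].
have [d Ad ->] := hf_codim x (rsubI As Bs) As (@subIsetl _ _ _).
rewrite (@hf_codim_eq B (sums A B) x d) //.
- by rewrite addnAC.
- exact: rsub_sums.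
- exact: sums_r.
apply: (@has_codim_map _ _ _ (fun v : kmod V => v)) Ad => //.
- exact: (upto_rsub x As).
- exact: (upto_rsub x Bs).
- by move=> v [xv Av]; split=> //; exact: sums_l.
- by move=> v [xv Av]; split=> [[_ Bv]|[_ [_ Bv]]].
move=> v [xv [a [b [aA bB vE]]]]; rewrite vE in xv *; move=> {v vE}.
have [a1 [xa1 a1A na1]] := At [set l | l <= x] a aA.
have [b1 [xb1 b1B nb1]] := Bt [set l | l <= x] b bB.
have E : a + b = a1 + b1.
  apply: (hs_split_uniq grG xv _ (hsD grG xa1 xb1)).
  by rewrite opprD addrACA; apply: hsD.
exists a1 => //; rewrite E [X in _ X](_ : _ = b1) //.
by rewrite addrAC subrr add0r.
Qed.

End HilbertOfSubsets.

Section AddingGenerators.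
Variables (RR : realType) (k : fieldType) (R : comAlgType k) (GR : RR -> set R).
Hypotheses (grR : graded_algebra GR) (R_fg : fg_algebra R).

Lemma graded_regular : graded_module GR (GR : RR -> set R^o).
Proof. by have [grG GM _ _] := grR; split. Qed.

Lemma fg_regular : fg_module R^o.
Proof.
exists 1%N, (fun=> 1) => v; exists (fun=> v).
by rewrite big_ord1 /GRing.scale /= mulr1.
Qed.

Definition hR : RR -> nat := hf (V := R^o) GR setT.

Lemma hilbertE (V : lmodType R) (G : RR -> set V) :
  hilbert G = (fun x => (hf G setT x)%:R) :> (RR -> RR).
Proof. by apply/funext => x; rewrite /hilbert /hf setIT. Qed.

Variables (V : lmodType R) (G : RR -> set V).
Hypotheses (grV : graded_module GR G) (V_fg : fg_module V).
Implicit Types (A B C : set V) (x : RR).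

(** Multiplication of [v] identifies [R], with its degrees shifted by [l], with the
    quotient of [A + R v] by [A]. *)
Lemma hf_add_line A l v x : gsub G A -> G l v -> (forall c : R, A (c *: v) -> c = 0) ->
  hf G (sums A (line v)) x = (hR (x - l) + hf G A x)%N.
Proof.
have [grG _] := grV; have [grGR _ _ _] := grR.
move=> [As At] Gv Av.
have Ls := rsub_line v.
apply: (hf_codim_eq grR R_fg grV V_fg As (rsub_sums As Ls)); first exact: sums_l.
have lv : homogeneous_sums G [set l] v by apply: (hs_mem (l := l)).
have Rh := has_hf grR R_fg graded_regular fg_regular (x - l) (rsubT R^o).
apply: (@has_codim_map _ (kmod R^o) (kmod V) (fun c : kmod R^o => (c : R) *: v : kmod V))
  Rh.
- by move=> a c d; rewrite !kmod_scaleE scalerDl -scalerA.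
- exact: (upto_rsub grR graded_regular (x - l) (rsubT R^o)).
- exact: (upto_rsub grR grV x As).
- move=> c [xc _]; split.
    apply: (hs_scale grV _ xc lv) => m _ /= mx ->.
    by rewrite -lerBrDr.
  by apply: sums_r => //; exists c.
- move=> c [xc _]; split=> [[_ /Av]|->] //.
  by rewrite scale0r; exact: (upto_rsub grR grV x As).1.
- move=> w [xw [a [_ [aA [c _ <-] wE]]]]; rewrite wE in xw *; move=> {w wE}.
  have [a1 [xa1 a1A na1]] := At [set m | m <= x] a aA.
  have [c1 xc1 nc1] := hs_split [set m | m <= x - l] (hs_setT grGR c).
  have xc1v : upto G x (c1 *: v).
    by apply: (hs_scale grV _ xc1 lv) => m _ /= [_ mx] ->; rewrite -lerBrDr.
  exists c1.
    by split=> //; apply: hs_mono xc1 => m [].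
  have -> : a + c *: v = a1 + c1 *: v.
    apply: (hs_split_uniq grG xw _ (hsD grG xa1 xc1v)).
    rewrite opprD addrACA -scalerBl; apply: hsD => //.
    by apply: (hs_scale grV _ nc1 lv) => m _ /= [_ mx] -> ; rewrite -lerBrDr.
  by rewrite [X in _ X](_ : _ = a1) // [LHS]addrK.
Qed.

Lemma homogeneous_family : exists hv : seq (RR * V),
  (forall p, p \in hv -> G p.1 p.2) /\
  forall B, rsub B -> (forall p, p \in hv -> B p.2) -> forall v, B v.
Proof.
have [grG _] := grV; have [d [e egen]] := V_fg.
have [hv [hvG hvs]] := homogeneous_pieces [seq e i | i <- enum 'I_d] grG.
exists hv; split=> // B Bs hB v; have [c ->] := egen v.
apply: rsub_sum => // i _; apply: rsubZ => //.
have [|t thv ->] := hvs (e i); first by rewrite map_f // mem_enum.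
by rewrite big_seq; apply: rsub_sum => // p /thv /hB.
Qed.

(** Generators are added one at a time, skipping those of which a nonzero
    multiple is already in. *)
Lemma add_generators (hv : seq (RR * V)) A :
  (forall p, p \in hv -> G p.1 p.2) -> gsub G A ->
  exists (e : seq (RR * V)) B,
    [/\ {subset e <= hv} /\ (size e <= size hv)%N, gsub G B, A `<=` B,
        forall p, p \in hv -> exists2 c : R, c != 0 & B (c *: p.2) &
        (forall x, hf G B x = ((\sum_(p <- e) hR (x - p.1)) + hf G A x)%N) /\
        ((forall p, p \in e -> B p.2) /\
        forall c : 'I_(size e) -> R,
          A (\sum_i c i *: (nth (0, 0) e i).2) -> forall i, c i = 0)].
Proof.
move=> hvG Ag; have [grGR _ _ _] := grR.
elim: hv hvG => [|p hv IH] hvG.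
  exists [::], A; split=> //; split=> [x|]; first by rewrite big_nil.
  by split=> // c _ [].
have [|e [B [[ehv se] Bg AB Bmul [hfB [eB eF]]]]] := IH.
  by move=> q qhv; apply: hvG; rewrite inE qhv orbT.
have Gp := hvG p (mem_head _ _).
have [indep|] := pselect (forall c : R, B (c *: p.2) -> c = 0); last first.
  move=> /existsNP[c /not_implyP[Bc /eqP c0]].
  exists e, B; split=> //.
  - by split; [move=> q /ehv qhv; rewrite inE qhv orbT | exact: leqW].
  - by move=> q; rewrite inE => /orP[/eqP ->|/Bmul//]; exists c.
have Ls := rsub_line p.2; have Bs := Bg.1.
exists (p :: e), (sums B (line p.2)); split.
- split; last by rewrite /= ltnS.
  by move=> q; rewrite !inE => /orP[->//|/ehv ->]; rewrite orbT.
- by apply: (gsub_sums grV) => //; exact: (gsub_line grGR grV Gp).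
- by apply: subset_trans AB _; exact: sums_l.
- move=> q; rewrite inE => /orP[/eqP ->|/Bmul[c c0 Bc]].
    exists 1; first exact: oner_neq0.
    by apply: sums_r => //; exists 1.
  by exists c => //; exact: sums_l.
- split=> [x|]; first by rewrite (hf_add_line _ Bg Gp indep) hfB big_cons addnA.
  split=> [q|c].
    rewrite inE => /orP[/eqP ->|/eB Bq]; last exact: sums_l.
    by apply: sums_r => //; exists 1; rewrite ?scale1r.
  pose w : V := \sum_(i < size e) c (lift ord0 i) *: (nth (0, 0) e i).2.
  have Bw : B w.
    by apply: rsub_sum => // i _; apply: rsubZ => //; apply: eB; exact: mem_nth.
  rewrite big_ord_recl -[X in A (_ + X)]/w => cA.
  have c0 : c ord0 = 0.
    by apply: indep; rewrite -[_ *: _](addrK w); apply: (rsubB Bs (AB _ cA) Bw).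
  move: cA; rewrite c0 scale0r add0r => cA i.
  have [j ->|->//] := unliftP ord0 i.
  exact: (eF (fun j => c (lift ord0 j)) cA).
Qed.

Hypothesis R_domain : GRing.integral_domain_axiom R.

Lemma common_multiple (s : seq V) B : rsub B ->
  (forall v, v \in s -> exists2 c : R, c != 0 & B (c *: v)) ->
  exists2 c : R, c != 0 & forall v, v \in s -> B (c *: v).
Proof.
move=> Bs; elim: s => [|v s IH] H; first by exists 1 => //; exact: oner_neq0.
have [|c c0 cB] := IH; first by move=> u us; apply: H; rewrite inE us orbT.
have [d d0 dB] := H v (mem_head _ _).
exists (c * d).
  by apply/eqP => /R_domain; rewrite (negbTE c0) (negbTE d0).
move=> u; rewrite inE => /orP[/eqP ->|/cB Bu].
  by rewrite -scalerA; apply: rsubZ.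
by rewrite mulrC -scalerA; apply: rsubZ.
Qed.

Hypothesis V_tf : torsion_free V.

(** Multiplication by a nonzero [c] with [c *: A `<=` B] is injective and raises
    the filtration by a bounded amount. *)
Lemma hf_le_shift A B c : rsub A -> rsub B -> c != 0 ->
  (forall v, A v -> B (c *: v)) ->
  exists d : RR, forall x, (hf G A x <= hf G B (x + d))%N.
Proof.
move=> As Bs c0 cAB.
have [grGR _ _ _] := grR; have [d dc] := upto_exists c grGR; exists d => x.
have [e [Se eF _]] := has_hf grR R_fg grV V_fg x As.
rewrite -[hf G A x]card_ord.
apply: (has_codim_free_le (@subspace0 _ _)
  (has_hf grR R_fg grV V_fg (x + d) Bs) (e := fun i => c *: (e i : V) : kmod V)).
  move=> i; have [xe Ae] := Se i; split; last exact: cAB.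
  by apply: (hs_scale grV _ dc xe) => l m /= ld mx; rewrite addrC lerD.
move=> a; under eq_bigr do rewrite kmod_scaleE scalerA mulrC -scalerA -kmod_scaleE.
rewrite -[X in [set 0] X](scaler_sumr (V := V)) => /= /V_tf[/eqP|a0]; first by rewrite (negbTE c0).
exact: eF.
Qed.

End AddingGenerators.

(** * Leading and second coefficients *)

Section Antiderivatives.
Variable RR : realType.
Local Notation mu := (@lebesgue_measure RR).
Implicit Types (T c x : RR) (h J : RR -> RR).

Definition antiderivative T h J :=
  mu.-integrable `[1, T] (EFin \o h) /\ \int[mu]_(x in `[1, T]) h x = J T - J 1.

Lemma antiderivative_eq T h h' J : {in `[1, T], h =1 h'} ->
  antiderivative T h J -> antiderivative T h' J.
Proof.
move=> hh' [ih iJ]; split.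
  apply: eq_integrable ih => // x; rewrite inE /= => xT.
  by rewrite hh'.
by rewrite -iJ; apply: eq_Rintegral => x; rewrite inE /= => xT; rewrite hh'.
Qed.

Lemma antiderivativeD T h J h' J' : antiderivative T h J -> antiderivative T h' J' ->
  antiderivative T (fun x => h x + h' x) (fun x => J x + J' x).
Proof.
move=> [ih iJ] [ih' iJ']; split.
  rewrite (_ : EFin \o _ = ((EFin \o h) \+ (EFin \o h'))%E) //; exact: integrableD.
by rewrite RintegralD // iJ iJ' opprD addrACA.
Qed.

Lemma antiderivativeZ T a h J : antiderivative T h J ->
  antiderivative T (fun x => a * h x) (fun x => a * J x).
Proof.
move=> [ih iJ]; split.
  rewrite (_ : EFin \o _ = (fun x => a%:E * (EFin \o h) x)%E) //; exact: integrableZl.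
by rewrite RintegralZl // iJ mulrBr.
Qed.

Lemma antiderivative0 T : antiderivative T (fun=> 0) (fun=> 0).
Proof.
split; last by rewrite Rintegral_cst // mul0r subrr.
exact: integrable0.
Qed.

Lemma antiderivative_sum (I : Type) (r : seq I) (P : pred I) T (h J : I -> RR -> RR) :
  (forall i, P i -> antiderivative T (h i) (J i)) ->
  antiderivative T (fun x => \sum_(i <- r | P i) h i x) (fun x => \sum_(i <- r | P i) J i x).
Proof.
move=> H; elim: r => [|i r IH].
  by under eq_fun do rewrite big_nil; under [X in antiderivative _ _ X]eq_fun do
    rewrite big_nil; exact: antiderivative0.
under eq_fun do rewrite big_cons; under [X in antiderivative _ _ X]eq_fun do rewrite big_cons.
by case: (boolP (P i)) => // Pi; apply: antiderivativeD => //; exact: H.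
Qed.

Lemma antiderivative_step T c : 1 <= T ->
  antiderivative T (fun x => if c <= x then 1 else 0) (fun x => Num.max (x - c) 0).
Proof.
move=> T1.
have mC : measurable (`[c, +oo[ : set RR) by [].
have E x : (if c <= x then 1 else 0) = \1_(`[c, +oo[ : set RR) x :> RR.
  by rewrite indicE mem_setE in_itv /= andbT; case: (c <= x).
under eq_fun do rewrite E; split.
  apply: measurable_bounded_integrable => //.
  - by rewrite /= lebesgue_measure_itv /=; case: ifP => // _; rewrite -EFinB ltry.
  - exact: measurable_realfun.measurable_indic.
  - exists 1; split=> [|M M1 x _] /=; first exact: num_real.
    rewrite indicE; case: (x \in _); first by rewrite normr1 ltW.
    by rewrite normr0 (le_trans ler01) // ltW.
rewrite /Rintegral integral_indic //.
have -> : `[c, +oo[ `&` `[1, T] = `[Num.max c 1, T]%classic :> set RR.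
  apply/seteqP; split=> x /=; rewrite !in_itv /= andbT ge_max.
    by move=> [-> /andP[-> ->]].
  by move=> /andP[/andP[-> ->] ->].
rewrite /= lebesgue_measure_itv /= lte_fin; case: ifPn => [cT|].
  rewrite -EFinB /=; have cT' : c <= T.
    by apply: le_trans (ltW cT); rewrite le_max lexx.
  rewrite [Num.max (T - c) 0]max_l ?subr_ge0 //.
  have [c1|c1] := leP c 1; first by rewrite max_l ?subr_ge0 //; ring.
  by rewrite max_r ?subr_le0 ?(ltW c1) // subr0.
rewrite -leNgt => Tc /=.
have [cT|cT] := leP T c.
  by rewrite !max_r ?subr_le0 ?subrr ?(le_trans T1) // (le_trans T1 cT).
have T1' : T = 1.
  apply/eqP; rewrite eq_le T1 andbT; move: Tc; rewrite le_max.
  by rewrite leNgt cT.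
by rewrite T1' subrr.
Qed.

Lemma antiderivative_power T n : 1 <= T ->
  antiderivative T (fun x => x ^+ n) (fun x => n.+1%:R^-1 * x ^+ n.+1).
Proof.
move=> T1.
have cX : {within `[1, T], continuous (fun x : RR => x ^+ n)}.
  by apply: continuous_subspaceT => x; exact: exprn_continuous.
split; first by apply: continuous_compact_integrable => //; exact: segment_compact.
move: T1; rewrite le_eqVlt => /predU1P[<-|T1].
  by rewrite set_itv1 Rintegral_set1 subrr.
pose F x : RR := n.+1%:R^-1 * x ^+ n.+1.
have dF x : is_derive x (1 : RR) F (x ^+ n).
  have H := is_deriveZ n.+1%:R^-1 (@is_deriveX _ _ (@idfun RR) n.+1 x 1 1 (is_derive_id _ _)).
  have -> : F = n.+1%:R^-1 \*: (@idfun RR ^+ n.+1).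
    by apply/funext => y; rewrite /F exprfctE.
  apply: is_derive_eq; rewrite /GRing.scale /= mulr1 mulrA mulVf ?mul1r //.
have cF : continuous F.
  by move=> x; apply/differentiable_continuous/derivable1_diffP; case: (dF x).
rewrite /Rintegral (@continuous_FTC2 _ _ F) //.
- split; first by move=> x _; case: (dF x).
  + by apply: cvg_at_right_filter; exact: cF.
  + by apply: cvg_at_left_filter; exact: cF.
- by move=> x _; rewrite derive1E; case: (dF x).
Qed.

(** On the segment from [1] to [T] only the exponents of weight at most [T - l]
    matter, and each contributes a unit step. *)
Lemma antiderivative_mono_sum T ws (D : set (seq nat)) l : all (> 0) ws -> 1 <= T ->
  antiderivative T (fun x => mono_sum ws D (fun=> 1) (x - l))
    (fun x => mono_sum ws D id (x - l)).
Proof.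
move=> ws0 T1.
have E f x : x <= T -> mono_sum ws D f (x - l) =
    \sum_(a <- monos ws (T - l) | `[<D a>])
      if weight ws a + l <= x then f (x - l - weight ws a) else 0.
  move=> xT; rewrite -big_mkcondr /mono_sum.
  have pe : perm_eq (monos ws (x - l))
      [seq a <- monos ws (T - l) | weight ws a + l <= x].
    apply: uniq_perm; rewrite ?filter_uniq ?uniq_monos // => a.
    rewrite mem_filter !mem_monos // lerBrDr; case: eqP => //= _; last by rewrite andbF.
    case: (boolP (_ <= x)) => //= ax; symmetry; rewrite lerBrDr; exact: le_trans xT.
  by rewrite (perm_big _ pe) big_filter_cond; apply: eq_bigl => a; rewrite andbC.
have [ih iJ] := @antiderivative_sum _ (monos ws (T - l)) (fun a => `[<D a>]) T
  (fun a x => if weight ws a + l <= x then 1 else 0)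
  (fun a x => Num.max (x - (weight ws a + l)) 0)
  (fun a _ => antiderivative_step _ T1).
have E1 : {in `[1, T], (fun x => mono_sum ws D (fun=> 1) (x - l)) =1
    (fun x => \sum_(a <- monos ws (T - l) | `[<D a>])
      if weight ws a + l <= x then 1 else 0)}.
  by move=> x; rewrite in_itv /= => /andP[_ xT]; rewrite E.
have EJ x : x <= T -> mono_sum ws D id (x - l) =
    \sum_(a <- monos ws (T - l) | `[<D a>]) Num.max (x - (weight ws a + l)) 0.
  move=> xT; rewrite E //; apply: eq_bigr => a _.
  case: ifPn => [ax|]; first by rewrite max_l ?subr_ge0 // addrAC -addrA -opprD.
  by rewrite -ltNge => ax; rewrite max_r // subr_le0 ltW.
apply: (antiderivative_eq (h := fun x => \sum_(a <- monos ws (T - l) | `[<D a>])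
      if weight ws a + l <= x then 1 else 0)).
  by move=> x xT; rewrite E1.
by split=> //; rewrite iJ -!EJ.
Qed.

End Antiderivatives.

Section Coefficients.
Variable RR : realType.
Local Notation mu := (@lebesgue_measure RR).
Implicit Types (a b c e x y T : RR) (h N J : RR -> RR) (m n : nat).

(** The antiderivative is part of the notion because the second coefficient of a
    counting function is only defined in the mean, by an integral. *)
Definition has_expansion m a b h := exists J, expansion m a b h J /\
  forall T, 1 <= T -> antiderivative T h J.

Lemma has_expansionD m a b h a' b' h' : has_expansion m a b h ->
  has_expansion m a' b' h' -> has_expansion m (a + a') (b + b') (fun x => h x + h' x).
Proof.
move=> [J [E I]] [J' [E' I']]; exists (fun x => J x + J' x); split.
  exact: expansionD.
by move=> T T1; apply: antiderivativeD; [exact: I | exact: I'].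
Qed.

Lemma has_expansionB m a b h a' b' h' : has_expansion m a b h ->
  has_expansion m a' b' h' -> has_expansion m (a - a') (b - b') (fun x => h x - h' x).
Proof.
move=> E [J' [E' I']]; apply: has_expansionD E _.
exists (fun x => - J' x); split; first exact: expansionN.
move=> T T1; under eq_fun do rewrite -mulN1r.
under [X in antiderivative _ _ X]eq_fun do rewrite -mulN1r.
by apply: antiderivativeZ; exact: I'.
Qed.

Lemma has_expansion_lift m m' a b h : (m < m')%N -> has_expansion m a b h ->
  exists b', has_expansion m' 0 b' h.
Proof.
move=> mm' [J [E I]]; have [b' E'] := expansion_lift mm' E.
by exists b', J.
Qed.

Lemma has_expansion0 m : has_expansion m 0 0 (fun=> 0).
Proof.
exists (fun=> 0); split; last by move=> T _; exact: antiderivative0.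
exists 0, 0; rewrite !size_poly0 !coef0 mul0rn; split=> //.
rewrite (_ : (fun y => _) = fun y => (0 : {poly RR}).[y]); last first.
  by apply/funext => y; rewrite horner0 subr0.
split; first by apply: bigO_error_poly; rewrite size_poly0.
by apply: bigO_littleo; apply: bigO_error_poly; rewrite size_poly0.
Qed.

Lemma size_sub_monomial (p : {poly RR}) n c : (size p <= n.+1)%N -> p`_n = c ->
  (size (p - c *: 'X^n)%R <= n)%N.
Proof.
move=> sp pc; apply/leq_sizeP => j nj; rewrite coefB coefZ coefXn.
have [->|jn] := eqVneq j n; first by rewrite pc mulr1 subrr.
rewrite mulr0 subr0 nth_default // (leq_trans sp) //.
by rewrite ltn_neqAle eq_sym jn.
Qed.

Lemma expansion_lead m a b N J : expansion m a b N J ->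
  bigO_error m (fun y => N y - a * y ^+ m).
Proof.
move=> [p [q [[sp sq pm qm qb] [eN eJ]]]].
have := bigO_errorD eN (bigO_error_poly (size_sub_monomial sp pm)).
by congr bigO_error; apply/funext => y; rewrite hornerD hornerN hornerZ hornerXn; ring.
Qed.

Lemma expansion_second m a b N J : expansion m a b N J ->
  littleo_error m (fun y => J y - (a / m.+1%:R * y ^+ m.+1 + b * y ^+ m)).
Proof.
move=> [p [q [[sp sq pm qm qb] [eN eJ]]]].
have qE : q`_m.+1 = a / m.+1%:R by rewrite -qm -[q`_m.+1 *+ _]mulr_natr mulfK // pnatr_eq0.
have s1 := size_sub_monomial sq qE.
have s2 := size_sub_monomial s1 (_ : _ = b).
have {}s2 : (size (q - (a / m.+1%:R) *: 'X^(m.+1) - b *: 'X^m)%R <= m)%N.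
  by apply: s2; rewrite coefB coefZ coefXn ltn_eqF // mulr0 subr0.
have := littleo_errorD eJ (bigO_littleo (bigO_error_poly s2)).
by congr littleo_error; apply/funext => y; rewrite !(hornerD, hornerN, hornerZ, hornerXn); ring.
Qed.

Lemma expansion_lim m a b N J : expansion m a b N J ->
  littleo_error m (fun y => N y - a * y ^+ m).
Proof. by move=> /expansion_lead/bigO_littleo. Qed.

(** At a large point the difference of the two leading terms would exceed the sum
    of the errors. *)
Lemma littleo_le m c c' N N' : (forall x, N x <= N' x) ->
  littleo_error m (fun y => N y - c * y ^+ m) ->
  littleo_error m (fun y => N' y - c' * y ^+ m) -> c <= c'.
Proof.
move=> NN' [_ H] [_ H']; rewrite leNgt; apply/negP => cc'.
have e0 : 0 < (c - c') / 3%:R by rewrite divr_gt0 // subr_gt0.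
have [[K HK] [K' HK']] := (H _ e0, H' _ e0).
pose y := Num.max 1 (Num.max K K').
have y1 : 1 <= y by rewrite /y le_max lexx.
have := HK y; rewrite /y !le_max lexx !orbT -/y => /(_ isT).
have := HK' y; rewrite /y !le_max lexx !orbT -/y => /(_ isT).
have ym : 0 < y ^+ m by rewrite exprn_gt0 // (lt_le_trans ltr01).
move: (NN' y); move: (y ^+ m) (N y) (N' y) ym => t u v t0 uv.
rewrite !ler_norml => /andP[_ h1] /andP[h2 _].
have : (c - c') / 3%:R * t > 0 by rewrite mulr_gt0.
move: h1 h2; rewrite (_ : c * t = c' * t + 3%:R * ((c - c') / 3%:R * t)).
  by move: ((c - c') / 3%:R * t) (c' * t) => s r; lra.
by field.
Qed.

Lemma expansion_level_le m a b N J m' a' b' N' J' : 0 < a -> (forall x, N x <= N' x) ->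
  expansion m a b N J -> expansion m' a' b' N' J' -> (m <= m')%N.
Proof.
move=> a0 NN' E E'; rewrite leqNgt; apply/negP => m'm.
have [b1 E1] := expansion_lift m'm E'.
by have := littleo_le NN' (expansion_lim E) (expansion_lim E1); rewrite leNgt a0.
Qed.

(** The leading terms being the same, comparing the antiderivatives compares their
    terms of degree [n], up to constants, which are negligible for [n > 0]. *)
Lemma has_expansion_second_le n a b h b' h' : (0 < n)%N -> (forall x, h x <= h' x) ->
  has_expansion n a b h -> has_expansion n a b' h' -> b <= b'.
Proof.
move=> n0 hh' [J [E I]] [J' [E' I']].
have [_ H] := littleo_errorD (expansion_second E') (littleo_errorN (expansion_second E)).
rewrite leNgt; apply/negP => bb'.
have e0 : 0 < (b - b') / 2%:R by rewrite divr_gt0 // subr_gt0.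
have [K HK] := H _ e0.
pose C : RR := `|J' 1 - J 1|.
pose y := Num.max (Num.max 1 K) (C / ((b - b') / 2%:R) + 1).
have y1 : 1 <= y by rewrite /y !le_max lexx.
have := HK y; rewrite /y !le_max lexx !orbT -/y => /(_ isT).
have mono : J y - J 1 <= J' y - J' 1.
  have [[ih <-] [ih' <-]] := (I y y1, I' y y1).
  by apply: le_Rintegral.
have yn : C < (b - b') / 2%:R * y ^+ n.
  apply: (@lt_le_trans _ _ ((b - b') / 2%:R * y)).
    rewrite mulrC -ltr_pdivrMr //; apply: (@lt_le_trans _ _ (C / ((b - b') / 2%:R) + 1)).
      by rewrite ltrDl.
    by rewrite /y !le_max lexx !orbT.
  rewrite ler_wpM2l ?(ltW e0) // -(prednK n0) exprS ler_peMr //.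
    by rewrite (le_trans ler01).
  by rewrite exprn_ege1.
have := ler_norm (J 1 - J' 1); rewrite distrC -/C => JC.
rewrite ler_norml => /andP[_ h1].
move: h1 JC mono yn; rewrite (_ : b * y ^+ n = b' * y ^+ n + 2%:R * ((b - b') / 2%:R * y ^+ n)).
  clearbody C y; move: (a / _ * _) ((b - b') / 2%:R * y ^+ n) (b' * y ^+ n).
  by move: (J y) (J' y) (J 1) (J' 1) => *; lra.
by field.
Qed.

Lemma expansion_loc_bounded m a b N J : expansion m a b N J -> loc_bounded N.
Proof.
move=> /expansion_lead[bN _].
have := loc_boundedD bN (loc_bounded_poly (a *: 'X^m)).
by congr loc_bounded; apply/funext => y; rewrite hornerZ hornerXn subrK.
Qed.

Lemma littleo_up n m (g : RR -> RR) : (n <= m)%N -> littleo_error n g -> littleo_error m g.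
Proof.
by move=> /subnK <- gn; elim: (m - n)%N => [//|j /littleo_bigO/bigO_littleo].
Qed.

Lemma leading_coef_exists n h c : (0 < n)%N -> bigO_error n (fun y => h y - c * y ^+ n) ->
  is_leading_coef n h (c * n`!%:R).
Proof.
case: n => // n _ [_ [d [K H]]].
have n0 : n.+1`!%:R != 0 :> RR by rewrite pnatr_eq0 -lt0n fact_gt0.
apply/eqOP; near=> k; near=> x; rewrite mulfK //=.
have x0 : 0 <= x by near: x; apply: nbhs_pinfty_ge; exact: num_real.
apply: le_trans (H x _) _; first by near: x; apply: nbhs_pinfty_ge; exact: num_real.
rewrite /= [`|x ^+ n|]ger0_norm ?exprn_ge0 // ler_wpM2r ?exprn_ge0 //.
Unshelve. all: by end_near. Qed.

Lemma leading_coef_littleo n h A : (0 < n)%N -> loc_bounded h -> is_leading_coef n h A ->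
  littleo_error n (fun y => h y - A / n`!%:R * y ^+ n).
Proof.
case: n => // n _ bh /eqOP H; apply: bigO_littleo; split.
  apply: loc_boundedD => //; apply: loc_boundedN.
  have := loc_bounded_poly (A / n.+1`!%:R *: 'X^(n.+1)).
  by congr loc_bounded; apply/funext => y; rewrite hornerZ hornerXn.
have [M [_ HM]] := H; have M1 : M < M + 1 by rewrite ltrDl.
have [K [_ HK]] := HM _ M1.
exists (M + 1), (Num.max 0 (K + 1)) => y; rewrite ge_max => /andP[y0 yK].
have Ky : K < y by apply: lt_le_trans yK; rewrite ltrDl.
by have := HK y Ky; rewrite /= [`|y ^+ n|]ger0_norm ?exprn_ge0.
Qed.

Lemma leading_coef_uniq n a b h A : (0 < n)%N -> has_expansion n a b h ->
  is_leading_coef n h A -> A = a * n`!%:R.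
Proof.
move=> n0 [J [E _]] /(leading_coef_littleo n0 (expansion_loc_bounded E)) HA.
have Ha := expansion_lim E.
have /eqP : A / n`!%:R = a.
  by apply: le_anti; rewrite (littleo_le _ HA Ha) // (littleo_le _ Ha HA).
by move=> /eqP <-; rewrite divfK // pnatr_eq0 -lt0n fact_gt0.
Qed.

(** For [m < n] the leading term is part of the error term of level [n]. For
    [n < m] no [A] exists, as [h] grows too fast. *)
Lemma leading_coef_other n m a b h A : (0 < n)%N -> n <> m -> 0 < a ->
  has_expansion m a b h -> is_leading_coef n h A -> A = 0.
Proof.
move=> n0 nm a0 E; have [J [E' _]] := E.
have [mn|nm'|mE] := ltngtP m n; last by case: nm.
  have [b' En] := has_expansion_lift mn E.
  by move=> /(leading_coef_uniq n0 En) ->; rewrite mul0r.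
move=> /(leading_coef_littleo n0 (expansion_loc_bounded E')) /(littleo_up (ltnW nm')) HA.
have sX : (size (A / n`!%:R *: 'X^n : {poly RR}) <= m)%N.
  by rewrite (leq_trans (size_scale_leq _ _)) // size_polyXn.
have := littleo_errorD HA (bigO_littleo (bigO_error_poly sX)).
have -> : (fun y => h y - A / n`!%:R * y ^+ n + (A / n`!%:R *: 'X^n).[y]) =
    (fun y => h y - 0 * y ^+ m).
  by apply/funext => y; rewrite hornerZ hornerXn subrK mul0r subr0.
move=> H0; have := littleo_le (fun x => lexx (h x)) (expansion_lim E') H0.
by rewrite leNgt a0.
Qed.

(** The term with [B] integrates to [B / n`! * T ^+ n], up to a constant, and the
    one with [a] cancels the leading term of the antiderivative of [h]. *)
Lemma second_coef_lim n a b h B : (0 < n)%N -> has_expansion n a b h ->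
  (T ^+ n)^-1 * (\int[mu]_(x in `[1, T]) (h x - (a * n`!%:R) / n`!%:R * x ^+ n
     - B / (n.-1)`!%:R * x ^+ n.-1)) @[T --> +oo] --> b - B / n`!%:R.
Proof.
case: n => // n _ [J [E I]].
have n0 : n.+1`!%:R != 0 :> RR by rewrite pnatr_eq0 -lt0n fact_gt0.
pose c := B / n`!%:R; pose K1 := - J 1 + (a * n.+2%:R^-1 + c * n.+1%:R^-1).
have cE : c * n.+1%:R^-1 = B / n.+1`!%:R.
  by rewrite /c factS natrM invfM mulrA mulrAC.
have intE T : 1 <= T -> \int[mu]_(x in `[1, T]) (h x - (a * n.+1`!%:R) / n.+1`!%:R * x ^+ n.+1
     - B / n`!%:R * x ^+ n) =
    (J T - (a / n.+2%:R * T ^+ n.+2 + b * T ^+ n.+1)) + (b - B / n.+1`!%:R) * T ^+ n.+1 + K1.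
  move=> T1.
  have [_ ] := antiderivativeD (antiderivativeD (I T T1)
    (antiderivativeZ (- a) (antiderivative_power n.+1 T1)))
    (antiderivativeZ (- c) (antiderivative_power n T1)).
  under eq_Rintegral do rewrite !mulNr; rewrite mulfK // => ->.
  rewrite -cE /K1 !expr1n; ring.
have [_ H] := expansion_second E.
apply/cvgrPdist_le => e e0; have e2 : 0 < e / 2%:R by rewrite divr_gt0.
have [K HK] := H _ e2.
near=> T.
have T1 : 1 <= T by near: T; apply: nbhs_pinfty_ge; exact: num_real.
have Tn : 0 < T ^+ n.+1 by rewrite exprn_gt0 // (lt_le_trans ltr01).
have KT : K <= T by near: T; apply: nbhs_pinfty_ge; exact: num_real.
rewrite intE //; move: (HK T KT); set X := J T - _ => HX; clearbody X.
have -> : (T ^+ n.+1)^-1 * (X + (b - B / n.+1`!%:R) * T ^+ n.+1 + K1) =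
    (T ^+ n.+1)^-1 * X + (b - B / n.+1`!%:R) + (T ^+ n.+1)^-1 * K1.
  by rewrite !mulrDr [_ * ((b - _) * _)]mulrCA mulVf ?mulr1 // gt_eqF.
rewrite [X in `|X|](_ : _ = - ((T ^+ n.+1)^-1 * X + (T ^+ n.+1)^-1 * K1)); last by ring.
rewrite normrN; apply: le_trans (ler_normD _ _) _.
rewrite [e]splitr !normrM (gtr0_norm (_ : 0 < (T ^+ n.+1)^-1)) ?invr_gt0 //.
apply: lerD; rewrite ler_pdivrMl //; rewrite mulrC.
  by [].
apply: (@le_trans _ _ (e / 2%:R * T)).
  rewrite mulrC -ler_pdivrMr //; near: T; apply: nbhs_pinfty_ge; exact: num_real.
rewrite ler_wpM2l ?(ltW e2) // exprS ler_peMr ?(le_trans ler01) //.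
by rewrite exprn_ege1.
Unshelve. all: by end_near. Qed.

Lemma has_expansion_coefs n a b h : (0 < n)%N -> has_expansion n a b h ->
  xget 0 [set A | is_leading_coef n h A] = a * n`!%:R /\
  xget 0 [set B | is_second_coef n h (a * n`!%:R) B] = b * n`!%:R.
Proof.
move=> n0 E; have [J [E' _]] := E.
have nf : n`!%:R != 0 :> RR by rewrite pnatr_eq0 -lt0n fact_gt0.
split; apply: xget_subset1.
- exact: leading_coef_exists (expansion_lead E').
- by move=> A A' /(leading_coef_uniq n0 E) -> /(leading_coef_uniq n0 E) ->.
- have := @second_coef_lim n a b h (b * n`!%:R) n0 E.
  by rewrite [b * n`!%:R / n`!%:R]mulfK // subrr.
- move=> B B' HB HB'.
  have lim B1 : is_second_coef n h (a * n`!%:R) B1 -> B1 = b * n`!%:R.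
    move=> H1; have /esym/eqP : 0 = b - B1 / n`!%:R :> RR.
      exact: (cvg_unique _ H1 (@second_coef_lim n a b h B1 n0 E)).
    by rewrite subr_eq0 => /eqP ->; rewrite divfK.
  by rewrite (lim B) // (lim B').
Qed.

Lemma counting_expansion (ws ls : seq RR) (D : nat -> set (seq nat)) :
  all (> 0) ws -> (forall j, (j < size ls)%N -> downset (D j)) ->
  let h x := \sum_(j <- iota 0 (size ls)) mono_sum ws (D j) (fun=> 1) (x - ls`_j) in
  (forall x, h x = 0) \/ exists m a, 0 < a /\
    forall c, exists b, has_expansion m a b (fun x => h (x - c)).
Proof.
move=> ws0 dD h.
pose D' j := if (j < size ls)%N then D j else set0.
have dD' j : downset (D' j) by rewrite /D'; case: ifP => [/dD//|_] a b.
have -> : h = fun x => \sum_(j <- iota 0 (size ls)) mono_sum ws (D' j) (fun=> 1) (x - ls`_j).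
  apply/funext => x; rewrite /h big_seq [RHS]big_seq; apply: eq_bigr => j.
  by rewrite mem_iota /D' => /andP[_ ->].
have := @pos_expansion_sum _ _ (iota 0 (size ls)) _ _ (fun j => pos_expansion_shift (ls`_j)
  (downset_expansion ws0 (dD' j))).
case=> [z|[m [a [b [a0 E]]]]]; first by left => x; case: (z x).
right; exists m, a; split=> // c; have [b' E'] := expansion_shift c E.
exists b'; eexists; split; first exact: E'.
move=> T T1; apply: antiderivative_sum => j _.
under eq_fun do rewrite -addrA -opprD.
under [X in antiderivative _ _ X]eq_fun do rewrite -addrA -opprD.
exact: antiderivative_mono_sum.
Qed.

End Coefficients.

(** * Growth and rank *)

Section Growth.
Variables (RR : realType) (k : fieldType) (R : comAlgType k) (GR : RR -> set R).
Hypotheses (grR : graded_algebra GR) (R_fg : fg_algebra R).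

Lemma hf0 (V : lmodType R) (G : RR -> set V) x :
  graded_module GR G -> hf G [set 0] x = 0%N.
Proof.
move=> grV; apply: hf_uniq; exists (fun=> 0); split=> [[]//|c _ []//|v [_ ->]].
by exists (fun=> 0); rewrite big_ord0 subr0.
Qed.

Lemma whole_expansion (V : lmodType R) (G : RR -> set V) :
  graded_module GR G -> fg_module V ->
  (forall x, hf G setT x = 0%N) \/ exists m (a : RR), 0 < a /\
    forall c, exists b, has_expansion m a b (fun x => (hf G setT (x - c))%:R).
Proof.
move=> grV V_fg; have [xs [ws [vs [ls gens]]]] := module_generators grR R_fg grV V_fg.
have [S SE] := rsub_mksub (rsub0 V).
have E x : hf G setT x = size (stdl xs ws vs ls S x).
  rewrite -[RHS]addn0 -(hf0 x grV); apply: (hf_codim_eq grR R_fg grV V_fg (rsub0 V)) => //.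
  rewrite setIT -SE; exact: (std_codim grR grV gens).
have [_ ws0 _ _ _] := gens.
have := counting_expansion ws0 (fun j jl => std_downset (A := S) gens jl).
case=> [z|[m [a [a0 H]]]].
  by left => x; apply/eqP; rewrite E -(pnatr_eq0 RR) (size_stdl gens) z.
right; exists m, a; split=> // c; have [b Eb] := H c; exists b.
by congr has_expansion: Eb; apply/funext => x; rewrite E (size_stdl gens).
Qed.

Lemma ring_expansion : exists m (a : RR), 0 < a /\
  forall c, exists b, has_expansion m a b (fun x => (hR GR (x - c))%:R).
Proof.
have [z|//] := whole_expansion (graded_regular grR) (fg_regular R).
have [e [_ _ eS]] := has_hf grR R_fg (graded_regular grR) (fg_regular R) 0 (rsubT R^o).
rewrite z in e eS; have [|c] := eS (1 : R^o).
  by split=> //; apply: (hs_mem (l := 0)) => //=; exact: graded_one.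
by rewrite big_ord0 subr0 => /eqP; rewrite oner_eq0.
Qed.

(** From here on [m] is the order of growth of [R] and [aR] its leading
    coefficient, as provided by [ring_expansion]. *)

Section Ranks.
Variables (m : nat) (aR : RR).
Hypothesis aR_gt0 : 0 < aR.
Hypothesis hR_expansion :
  forall c, exists b, has_expansion m aR b (fun x => (hR GR (x - c))%:R).
Hypothesis R_domain : GRing.integral_domain_axiom R.

Lemma free_expansion (bR : RR -> RR) (I : Type) (e : seq I) (w : I -> RR) c :
  (forall d, has_expansion m aR (bR d) (fun x => (hR GR (x - d))%:R)) ->
  has_expansion m ((size e)%:R * aR) (\sum_(i <- e) bR (c + w i))
    (fun x => (\sum_(i <- e) hR GR (x - c - w i))%:R).
Proof.
move=> bRE; elim: e => [|i e IH].
  rewrite mul0r big_nil (_ : (fun x => _) = fun=> 0); first exact: has_expansion0.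
  by apply/funext => x; rewrite big_nil.
have := has_expansionD (bRE (c + w i)) IH.
rewrite big_cons -{1}[aR]mul1r -mulrDl -(natrD _ 1) add1n.
by congr has_expansion; apply/funext => x; rewrite big_cons natrD opprD addrA.
Qed.

Variables (V : lmodType R) (G : RR -> set V).
Hypotheses (grV : graded_module GR G) (V_fg : fg_module V) (V_tf : torsion_free V).

(** The family [e_j] consists of elements of degree at most [c], so the products
    of its members with a basis of [R] up to degree [x - c] are independent. *)
Lemma lin_indep_growth d (e : 'I_d -> V) : lin_indep e ->
  exists c : RR, forall x, (d * hR GR (x - c) <= hf G setT x)%N.
Proof.
move=> eI.
have [c ec] : exists c, forall j, upto G c (e j).
  have [grG _] := grV; have /choice[f fP] j := upto_exists (e j) grG.
  exists (\big[Num.max/0]_j f j) => j; apply: hs_mono (fP j) => l /= lf.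
  by apply: le_trans lf _; exact: le_bigmax.
exists c => x.
have [u [uS uF _]] := has_hf grR R_fg (graded_regular grR) (fg_regular R)
  (x - c) (rsubT R^o).
have -> : (d * hR GR (x - c))%N = #|{: 'I_d * 'I_(hR GR (x - c))}|.
  by rewrite card_prod !card_ord.
apply: (has_codim_free_le (@subspace0 _ _) (has_hf grR R_fg grV V_fg x (rsubT V))
  (e := fun p => (u p.2 : R) *: e p.1 : kmod V)).
  move=> [j i]; split=> //=; have [ui _] := uS i.
  by apply: (hs_scale grV _ ui (ec j)) => l l' /= h1 h2; rewrite -[x](subrK c) lerD.
move=> a a0.
pose s j : R := \sum_i (a (j, i))%:A * u i.
have a0' : \sum_j \sum_i ((a (j, i))%:A * u i) *: e j = 0 :> V.
  rewrite pair_bigA /= -[RHS](a0 : _ = _); apply: eq_bigr => -[j i] _ /=.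
  by rewrite kmod_scaleE scalerA.
have s0 j : s j = 0.
  apply: (eI s); rewrite -[RHS]a0'; apply: eq_bigr => j' _.
  by rewrite /s scaler_suml.
move=> [j i]; exact: (uF (fun i => a (j, i)) (s0 j) i).
Qed.

(** Let [B] be generated by a maximal independent family among homogeneous
    generators of [V], and [c *: V] contained in [B]. Then the Hilbert function of
    [V] lies between that of the free module [B] and a translate of it, so it has
    the same order and leading coefficient. A longer independent family would
    exceed this growth by [lin_indep_growth]. *)
Theorem rank_expansion : has_rank V (rank V) /\
  exists b, has_expansion m ((rank V)%:R * aR) b (fun x => (hf G setT x)%:R).
Proof.
have [hv [hvG hvgen]] := homogeneous_family grV V_fg.
have [grG _] := grV.
have [e [B [_ Bg _ Bmul [hfB [eB eF]]]]] := add_generators grR R_fg grV V_fg hvG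
  (gsub0 grV).
have [c c0 cB] : exists2 c : R, c != 0 & forall v, B (c *: v).
  have [|c c0 cB] := common_multiple R_domain (s := [seq p.2 | p <- hv]) Bg.1.
    by move=> v /mapP[p /Bmul[c c0 Bc] ->]; exists c.
  exists c => // v; apply: (hvgen [set v | B (c *: v)]); last first.
    by move=> p phv /=; apply: cB; rewrite map_f.
  have [[B0 BZ] _] := Bg; split=> [|r u w Bu Bw] /=; first by rewrite scaler0.
  by rewrite scalerDr !scalerA mulrC -scalerA; apply: BZ.
have [d Hd] := hf_le_shift grR R_fg grV V_fg V_tf (rsubT V) Bg.1 c0 (fun v _ => cB v).
have hBE x : hf G B x = (\sum_(p <- e) hR GR (x - p.1))%N by rewrite hfB hf0 ?addn0.
have BV x : (hf G B x)%:R <= (hf G setT x)%:R :> RR.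
  by rewrite ler_nat; apply: (hf_le grR R_fg grV V_fg _ Bg.1 (rsubT V)).
have VB x : (hf G setT x)%:R <= (hf G B (x + d))%:R :> RR by rewrite ler_nat.
have /choice[bR bRE] := hR_expansion; have E0 := free_expansion e fst 0 bRE.
set b0 := \sum_(i <- e) _ in E0.
have {}E0 : has_expansion m ((size e)%:R * aR) b0 (fun x => (hf G B x)%:R).
  by congr has_expansion: E0; apply/funext => x; rewrite hBE subr0.
have E1 := free_expansion e fst (- d) bRE; set b1 := \sum_(i <- e) _ in E1.
have {}E1 : has_expansion m ((size e)%:R * aR) b1 (fun x => (hf G B (x + d))%:R).
  by congr has_expansion: E1; apply/funext => x; rewrite hBE opprK.
have [b E] : exists b, has_expansion m ((size e)%:R * aR) b (fun x => (hf G setT x)%:R).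
  have [z|[m' [a' [a'0 /(_ 0)[b' E']]]]] := whole_expansion grV V_fg.
    exists b0; congr has_expansion: E0; apply/funext => x; rewrite z.
    by apply/eqP; rewrite pnatr_eq0 -leqn0 -[X in (_ <= X)%N](z x) -(ler_nat RR).
  have {}E' : has_expansion m' a' b' (fun x => (hf G setT x)%:R).
    by congr has_expansion: E'; apply/funext => x; rewrite subr0.
  have [J0 [F0 _]] := E0; have [J1 [F1 _]] := E1; have [J' [F' _]] := E'.
  have m'm := expansion_level_le a'0 VB F' F1.
  have e0 : 0 < (size e)%:R * aR :> RR.
    rewrite mulr_gt0 // ltr0n lt0n; apply/negP => /eqP/size0nil e0.
    have [J2 [F2 _]] := has_expansion0 RR m'.
    have V0 x : (hf G setT x)%:R <= 0 :> RR.
      by apply: le_trans (VB x) _; rewrite hBE e0 big_nil.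
    by have := littleo_le V0 (expansion_lim F') (expansion_lim F2); rewrite leNgt a'0.
  have mm' := expansion_level_le e0 BV F0 F'.
  have mE : m' = m by apply/eqP; rewrite eqn_leq m'm.
  rewrite mE in E' F'; exists b'; congr has_expansion: E'; apply: le_anti.
  rewrite (littleo_le VB (expansion_lim F') (expansion_lim F1)).
  by rewrite (littleo_le BV (expansion_lim F0) (expansion_lim F')).
suff rV : has_rank V (size e).
  have -> : rank V = size e.
    apply: xget_subset1 => // d1 d2 [[e1 i1] m1] [[e2 i2] m2].
    by apply/eqP; rewrite eqn_leq (m1 _ _ i2) (m2 _ _ i1).
  by split=> //; exists b.
split; first by exists (fun i => (nth (0, 0) e i).2) => a a0; exact: eF.
move=> d' e' /lin_indep_growth[x0 Hx0].
have E2 := free_expansion (nseq d' tt) (fun=> x0) 0 bRE; rewrite size_nseq in E2.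
set b2 := \sum_(i <- _) _ in E2.
have {}E2 : has_expansion m (d'%:R * aR) b2 (fun x => (d' * hR GR (x - x0))%:R).
  congr has_expansion: E2; apply/funext => x.
  by rewrite big_nseq iter_addn_0 subr0 mulnC.
have [[J2 [F2 _]] [J [F _]]] := (E2, E).
have le2 x : (d' * hR GR (x - x0))%:R <= (hf G setT x)%:R :> RR by rewrite ler_nat.
have := littleo_le le2 (expansion_lim F2) (expansion_lim F).
by rewrite ler_pM2r // ler_nat.
Qed.

Lemma rank_gt0 : nonzero_module V -> (0 < rank V)%N.
Proof.
move=> [v v0]; have [[_ rmax] _] := rank_expansion.
apply: (rmax 1%N (fun=> v)) => c; rewrite big_ord1 => /V_tf[c0 i|/eqP].
  by rewrite ord1.
by rewrite (negbTE v0).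
Qed.

End Ranks.

End Growth.

(** * Subquotients of graded modules *)

Section AdditiveMaps.
Variables (RR : realType) (V W : zmodType) (phi : V -> W).
Hypothesis phiD : {morph phi : u v / u + v}.

Lemma additive0 : phi 0 = 0.
Proof. by apply: (@addrI _ (phi 0)); rewrite -phiD !addr0. Qed.

Lemma additiveN v : phi (- v) = - phi v.
Proof. by apply: (@addrI _ (phi v)); rewrite -phiD !subrr additive0. Qed.

Lemma additiveB u v : phi (u - v) = phi u - phi v.
Proof. by rewrite phiD additiveN. Qed.

Lemma additive_sum (I : Type) (r : seq I) (F : I -> V) :
  phi (\sum_(i <- r) F i) = \sum_(i <- r) phi (F i).
Proof. exact: (big_morph phi phiD additive0). Qed.

Lemma hs_map (G : RR -> set V) (G' : RR -> set W) (D : set RR) v :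
  (forall l u, G l u -> G' l (phi u)) ->
  homogeneous_sums G D v -> homogeneous_sums G' D (phi v).
Proof.
move=> GG' [s [f [sf ->]]]; exists s, (fun l => phi (f l)); split.
  by move=> l /sf[Dl Gl]; split=> //; exact: GG'.
exact: additive_sum.
Qed.

End AdditiveMaps.

Lemma submod_valD (R : nzRingType) (V : lmodType R) (A : submodClosed V) :
  {morph @submod_val R V A : u v / u + v}.
Proof. by []. Qed.

Section Restriction.
Variables (RR : realType) (k : fieldType) (R : comAlgType k) (GR : RR -> set R).
Variables (V : lmodType R) (G : RR -> set V) (A : submodClosed V).
Hypotheses (grV : graded_module GR G) (Ag : graded_submodule G A).
Local Notation GA := (sub_grading G A).

Lemma sub_graded : graded_module GR GA.
Proof.
have [[G0 GT Gd] GZ] := grV; split; last first.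
  by move=> l m r v Gr Gv; exact: (GZ l m r (submod_val v) Gr Gv).
split.
- move=> l; have [Gl0 GlB] := G0 l; split; first exact: Gl0.
  by move=> u v Gu Gv; exact: (GlB (submod_val u) (submod_val v) Gu Gv).
- apply/seteqP; split=> // v _; have [s [f [sf vE]]] := Ag (submod_valP v).
  exists s, (fun l => insubd (0 : submod A) (f l)); split.
    move=> l ls; have [_ [Gl fA]] := sf l ls; split=> //.
    by rewrite /sub_grading /= -[submod_val _]/(val _) val_insubd (fA : f l \in A).
  apply: val_inj; rewrite [RHS]raddf_sum [LHS]vE; apply: eq_big_seq => l ls.
  have [_ [Gl fA]] := sf l ls; transitivity (val (insubd (0 : submod A) (f l))) => //.
  by rewrite val_insubd (fA : f l \in A).
- move=> s f us sf s0 l ls; apply: val_inj.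
  apply: (Gd s (fun l => submod_val (f l)) us _ _ l ls) => [m ms|].
    exact: sf.
  by rewrite -(additive_sum (@submod_valD _ _ A)) s0.
Qed.

(** Truncating [v] inside of [A] and in [V] has the same result. *)
Lemma hs_sub D (v : submod A) :
  homogeneous_sums GA D v <-> homogeneous_sums G D (submod_val v).
Proof.
have [grG _] := grV; have [grGA _] := sub_graded.
split; first by apply: hs_map => //; exact: (@submod_valD _ _ A).
move=> Dv; have [u Du nu] := hs_split D (hs_setT grGA v).
suff -> : v = u by apply: hs_mono Du => l [].
apply: val_inj; apply: (hs_split_uniq grG Dv).
  have := hs_map (G' := G) (@submod_valD _ _ A) (fun l u (h : GA l u) => h) nu.
  by apply: hs_mono => l [].
have := hs_map (G' := G) (@submod_valD _ _ A) (fun l u (h : GA l u) => h) Du.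
by apply: hs_mono => l [].
Qed.

Let upto_sub x (v : submod A) : upto GA x v <-> upto G x (submod_val v).
Proof. exact: hs_sub. Qed.

Lemma rsub_val (N : set (submod A)) : rsub N -> rsub (@submod_val _ _ A @` N).
Proof.
move=> [N0 NZ]; split; first by exists 0.
by move=> r _ _ [u Nu <-] [v Nv <-]; exists (r *: u + v) => //; exact: NZ.
Qed.

Hypotheses (grR : graded_algebra GR) (R_fg : fg_algebra R) (V_fg : fg_module V).

Lemma codim_val (N L : set (submod A)) x d : rsub N -> rsub L ->
  has_codim (upto GA x `&` N : set (kmod _)) (upto GA x `&` L) d ->
  has_codim (upto G x `&` @submod_val _ _ A @` N : set (kmod V))
    (upto G x `&` @submod_val _ _ A @` L) d.
Proof.
move=> Ns Ls; apply: (@has_codim_map _ (kmod (submod A)) (kmod V)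
  (fun v : kmod (submod A) => submod_val v : kmod V)) => //.
- exact: (upto_rsub grR sub_graded x Ns).
- exact: (upto_rsub grR grV x (rsub_val Ls)).
- by move=> v [/upto_sub xv Nv]; split=> //; exists v.
- move=> v [xv Nv]; split=> [[_ [u Lu uv]]|[_ Lv]].
    by split=> //; rewrite -(val_inj uv : u = v).
  by split; [exact/upto_sub | exists v].
- move=> w [xw [v Nv vw]]; rewrite -vw in xw *; exists v.
    by split=> //; exact/upto_sub.
  by rewrite subrr; exact: (upto_rsub grR grV x (rsub_val Ls)).1.
Qed.

Lemma hf_val (N : set (submod A)) x : rsub N ->
  hf GA N x = hf G (@submod_val _ _ A @` N) x.
Proof.
move=> Ns; apply/esym/hf_uniq.
have A_fg := submodule_fg grR R_fg grV V_fg A.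
have := has_hf grR R_fg sub_graded A_fg x Ns.
have -> : [set 0] = (upto GA x `&` [set 0])%classic :> set (kmod (submod A)).
  apply/seteqP; split=> [v ->|v []//]; split=> //.
  exact: (upto_subspace grR sub_graded x).1.
move=> /(codim_val Ns (rsub0 _)); congr has_codim; apply/seteqP; split=> v.
  by move=> [_ [u -> <-]].
move=> ->; split; first exact: (upto_subspace grR grV x).1.
by exists 0.
Qed.

End Restriction.

Section Quotient.
Variables (RR : realType) (k : fieldType) (R : comAlgType k) (GR : RR -> set R).
Variables (V : lmodType R) (G : RR -> set V) (B : submodClosed V).
Hypotheses (grV : graded_module GR G) (Bg : graded_submodule G B).
Local Notation GB := (quot_grading G B).
Local Notation pi := (quotmod_pi B).

Lemma quotmod_pi0P v : pi v = 0 <-> v \in B.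
Proof. by rewrite -(additive0 (@quotmod_piD _ _ B)) quotmod_pi_eq subr0. Qed.

Lemma quot_graded : graded_module GR GB.
Proof.
have [grG GZ] := grV; have [G0 GT Gd] := grG.
have [Bs Bt] := (gsub_graded grV B).2 Bg.
split; last first.
  move=> l m r _ Gr [v Gv <-]; exists (r *: v); first exact: GZ Gr Gv.
  by rewrite -quotmod_piZ.
split.
- move=> l; have [Gl0 GlB] := G0 l; split.
    by exists 0 => //; exact: additive0 (@quotmod_piD _ _ B).
  move=> _ _ [u Gu <-] [v Gv <-]; exists (u - v); first exact: GlB.
  exact: additiveB (@quotmod_piD _ _ B) _ _.
- apply/seteqP; split=> // q _; have [v <-] := quotmod_piP q.
  apply: (hs_map (@quotmod_piD _ _ B) _ (hs_setT grG v)) => l u Gu.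
  by exists u.
- move=> s f us sf f0 l ls.
  have /choice[g gP] m : exists u, m \in s -> G m u /\ pi u = f m.
    by have [/sf[u Gu uf]|_] := boolP (m \in s); [exists u | exists 0].
  have [gl <-] := gP l ls; apply/quotmod_pi0P.
  have gB : \sum_(m <- s) g m \in B.
    apply/quotmod_pi0P; rewrite (additive_sum (@quotmod_piD _ _ B)) -[RHS]f0.
    by apply: eq_big_seq => m ms; have [] := gP m ms.
  have [u [lu uB nlu]] := Bt [set l] _ gB.
  suff -> : g l = u by [].
  apply: (hs_trunc_uniq grG (hs_mem (erefl l : [set l] l) gl) _ lu nlu).
  exists [seq m <- s | m != l], g; split.
    by move=> m; rewrite mem_filter => /andP[/eqP ml ms]; split=> //; case: (gP m ms).
  by rewrite (bigD1_seq l) //= addrC addrK big_filter.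
Qed.

Lemma upto_quot x q : upto GB x q -> exists2 v, upto G x v & pi v = q.
Proof.
move=> [s [f [sf ->]]].
have /choice[g gP] m : exists u, m \in s -> G m u /\ pi u = f m.
  by have [/sf[_ [u Gu uf]]|_] := boolP (m \in s); [exists u | exists 0].
exists (\sum_(m <- s) g m); last first.
  rewrite (additive_sum (@quotmod_piD _ _ B)); apply: eq_big_seq => m ms.
  by have [] := gP m ms.
by exists s, g; split=> // m ms; have [mx _] := sf m ms; have [] := gP m ms.
Qed.

Lemma quot_fg : fg_module V -> fg_module (quotmod B).
Proof.
move=> [d [e egen]]; exists d, (fun i => pi (e i)) => q.
have [v <-] := quotmod_piP q; have [c ->] := egen v; exists c.
rewrite (additive_sum (@quotmod_piD _ _ B)); apply: eq_bigr => i _.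
by rewrite -quotmod_piZ.
Qed.

Lemma rsub_pi (N : set (quotmod B)) : rsub N -> rsub (pi @^-1` N).
Proof.
move=> [N0 NZ]; split; first by rewrite /= (additive0 (@quotmod_piD _ _ B)).
by move=> r u v /= Nu Nv; rewrite quotmod_piD -quotmod_piZ; exact: NZ.
Qed.

Hypotheses (grR : graded_algebra GR) (R_fg : fg_algebra R) (V_fg : fg_module V).

Lemma codim_quot (N : set (quotmod B)) x d : rsub N ->
  has_codim (upto G x `&` pi @^-1` N : set (kmod V)) (upto G x `&` [set v | v \in B]) d ->
  hf GB N x = d.
Proof.
move=> Ns Nd; apply: hf_uniq; apply: (@has_codim_map _ (kmod V) (kmod (quotmod B))
  (fun v : kmod V => pi v : kmod (quotmod B))) Nd => //.
- by move=> c u v; rewrite !kmod_scaleE [LHS]quotmod_piD -quotmod_piZ.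
- exact: (upto_rsub grR grV x (rsub_pi Ns)).
- exact: subspace0.
- move=> v [xv Nv]; split=> //; apply: (hs_map (@quotmod_piD _ _ B)) xv => l u Gu.
  by exists u.
- move=> v [xv Nv]; split=> [/quotmod_pi0P Bv|[_ Bv]]; first by split.
  exact/quotmod_pi0P.
- move=> q [/upto_quot[v xv vq] Nq]; exists v; last by rewrite vq subrr.
  by split=> //; rewrite /preimage /= vq.
Qed.

End Quotient.

Section Subquotient.
Variables (RR : realType) (k : fieldType) (R : comAlgType k) (GR : RR -> set R).
Variables (V : lmodType R) (G : RR -> set V) (S T : submodClosed V).
Hypotheses (grV : graded_module GR G).
Hypotheses (Sg : graded_submodule G S) (Tg : graded_submodule G T).
Hypothesis TS : {subset T <= S}.
Implicit Types (N : set (subquot S T)) (C : set V).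
Local Notation GQ := (subquot_grading G S T).
Local Notation GS := (sub_grading G S).
Local Notation TinS := (restr_submod S T : submodClosed (submod S)).
Local Notation pi := (quotmod_pi TinS).

(** The correspondence between submodules of [S / T] and submodules between [T] and
    [S]; the two maps are in terms of the inclusion of [S] and the projection. *)
Definition pullback N : set V := @submod_val _ _ S @` (pi @^-1` N).

Definition pushforward C : set (subquot S T) := pi @` (@submod_val _ _ S @^-1` C).

Let mem_restr (v : submod S) : (v \in TinS) = (submod_val v \in T).
Proof. by []. Qed.

Let lift v (vS : v \in S) : {u : submod S | submod_val u = v}.
Proof. by exists (Submod vS). Qed.

Lemma restr_graded : graded_submodule GS TinS.
Proof.
apply/(gsub_graded (sub_graded grV Sg)); split; first exact: rsub_submod.
move=> D v vT; have [_ Tt] := (gsub_graded grV T).2 Tg.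
have [u [Du uT nu]] := Tt D (submod_val v) vT.
have [u' uE] := lift (TS uT); rewrite -uE in Du uT nu.
by exists u'; split=> //; apply/(hs_sub grV Sg).
Qed.

Lemma subquot_graded : graded_module GR GQ.
Proof. exact: (quot_graded (sub_graded grV Sg) restr_graded). Qed.

Lemma pullback_gsub N : gsub GQ N -> gsub G (pullback N).
Proof.
have [grGQ _] := subquot_graded; have [grGS _] := sub_graded grV Sg.
move=> [Ns Nt]; split; first exact: (rsub_val (rsub_pi Ns)).
move=> D _ [v Nv <-]; have [q [Dq qN nq]] := Nt D _ Nv.
have [u Du nu] := hs_split D (hs_setT grGS v).
have {}Du : homogeneous_sums GS D u by apply: hs_mono Du => l [].
have {}nu : homogeneous_sums GS (~` D) (v - u) by apply: hs_mono nu => l [].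
have piG l w : GS l w -> GQ l (pi w) by exists w.
have uq : pi u = q.
  apply: (hs_trunc_uniq grGQ (hs_map (@quotmod_piD _ _ TinS) piG Du) _ Dq nq).
  rewrite -(additiveB (@quotmod_piD _ _ TinS)).
  exact: (hs_map (@quotmod_piD _ _ TinS) piG nu).
have DuV := (hs_sub grV Sg D u).1 Du.
have nuV := (hs_sub grV Sg (~` D) (v - u)).1 nu.
exists (submod_val u); split=> //; exists u => //.
by rewrite /preimage /= uq.
Qed.

Lemma pushforward_gsub C : gsub G C -> C `<=` [set v | v \in S] ->
  gsub GQ (pushforward C).
Proof.
move=> [[C0 CZ] Ct] CS; split.
  split; first by exists 0 => //; exact: (additive0 (@quotmod_piD _ _ TinS)).
  move=> r _ _ [u Cu <-] [v Cv <-]; exists (r *: u + v); first exact: CZ.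
  by rewrite quotmod_piD -quotmod_piZ.
move=> D _ [v Cv <-]; have [u [Du Cu nu]] := Ct D _ Cv.
have [u' uE] := lift (CS _ Cu); rewrite -uE in Du Cu nu.
have {}Du := (hs_sub grV Sg D u').2 Du.
have {}nu := (hs_sub grV Sg (~` D) (v - u')).2 nu.
have piG l w : GS l w -> GQ l (pi w) by exists w.
exists (pi u'); split; first exact: (hs_map (@quotmod_piD _ _ TinS) piG).
  by exists u'.
rewrite -(additiveB (@quotmod_piD _ _ TinS)).
exact: (hs_map (@quotmod_piD _ _ TinS) piG).
Qed.

Lemma pushforwardK C : rsub C -> [set v | v \in T] `<=` C -> C `<=` [set v | v \in S] ->
  pullback (pushforward C) = C.
Proof.
move=> Cs TC CS; apply/seteqP; split=> [_ [v [u Cu /quotmod_pi_eq uv] <-]|v Cv].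
  have := rsubB Cs Cu (TC _ uv).
  by rewrite /= opprB addrC subrK.
by have [u uE] := lift (CS _ Cv); exists u => //; exists u => //; rewrite /preimage /= uE.
Qed.

Lemma sub_pullback N : rsub N -> [set v | v \in T] `<=` pullback N.
Proof.
move=> [N0 _] v vT; have [u uE] := lift (TS vT); exists u => //.
suff -> : (pi @^-1` N) u = N 0 by [].
by congr N; apply/quotmod_pi0P; rewrite mem_restr uE.
Qed.

Lemma pullback_sub N : pullback N `<=` [set v | v \in S].
Proof. by move=> _ [u _ <-]; exact: submod_valP. Qed.

Lemma pullbackT : pullback setT = [set v | v \in S].
Proof.
apply/seteqP; split; first exact: pullback_sub.
by move=> v vS; have [u uE] := lift vS; exists u.
Qed.

Lemma pullback_subT N : pullback N `<=` [set v | v \in T] <-> N `<=` [set 0].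
Proof.
split=> [NT q|N0 _ [u Nu <-]].
  have [u <-] := quotmod_piP q => Nu; apply/quotmod_pi0P; rewrite mem_restr.
  by apply: NT; exists u.
by have /quotmod_pi0P := N0 _ Nu.
Qed.

Lemma subquot_torsion_free : torsion_free (subquot S T) <->
  forall r v, v \in S -> r *: v \in T -> r = 0 \/ v \in T.
Proof.
split=> [tf r v vS rvT|tf r q].
  have [u uE] := lift vS; have [||/quotmod_pi0P] := tf r (pi u).
  - rewrite -[_ *: _]/(quotmod_scale r (pi u)) quotmod_piZ; apply/quotmod_pi0P.
    by rewrite mem_restr /= uE.
  - by left.
  - by rewrite mem_restr uE; right.
have [u <-] := quotmod_piP q.
rewrite -[_ *: _]/(quotmod_scale r (pi u)) quotmod_piZ => /quotmod_pi0P ruT.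
have [||uT] := tf r (submod_val u) (submod_valP u); first exact: ruT.
  by left.
by right; apply/quotmod_pi0P.
Qed.

Hypotheses (grR : graded_algebra GR) (R_fg : fg_algebra R) (V_fg : fg_module V).

Lemma subquot_fg : fg_module (subquot S T).
Proof. exact: (@quot_fg _ _ _ TinS (submodule_fg grR R_fg grV V_fg S)). Qed.

Lemma hf_pullback N x : rsub N ->
  hf G (pullback N) x = (hf GQ N x + hf G [set v | v \in T] x)%N.
Proof.
move=> Ns; have grS := sub_graded grV Sg.
have S_fg := submodule_fg grR R_fg grV V_fg S.
have NT : [set v | v \in TinS] `<=` pi @^-1` N.
  move=> v /quotmod_pi0P v0; rewrite /preimage /= v0; exact: Ns.1.
have [d Nd _] := hf_codim grR R_fg grS S_fg x (rsub_submod TinS) (rsub_pi Ns) NT.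
rewrite (codim_quot grS grR Ns Nd).
apply: (hf_codim_eq grR R_fg grV V_fg (rsub_submod T) (rsub_val (rsub_pi Ns))).
  exact: sub_pullback.
have := codim_val grV Sg grR (rsub_pi Ns) (rsub_submod TinS) Nd.
congr has_codim; congr (_ `&` _); apply/seteqP; split=> [_ [u uT <-]//|v vT].
by have [u uE] := lift (TS vT); exists u => //=; rewrite mem_restr uE.
Qed.

End Subquotient.

(** * Saturation *)

Section TopComponents.
Variables (RR : realType) (V : zmodType) (G : RR -> set V).
Hypothesis grG : is_grading G.

(** Induction on the number of homogeneous components, splitting off the top one. *)
Lemma hs_top_ind (P : V -> Prop) : P 0 ->
  (forall d u v, G d u -> homogeneous_sums G [set l | l < d] v -> P v -> P (u + v)) ->
  forall v, P v.
Proof.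
move=> P0 PS v; have [s [f [us sf ->]]] := hs_uniq_form grG (hs_setT grG v).
pose ger (x y : RR) := y <= x.
have ger_total : total ger by move=> x y; exact: le_total.
have ger_trans : transitive ger by move=> y x z yx zy; exact: le_trans zy yx.
rewrite -(perm_big _ (permEl (perm_sort ger s))) /=.
have := sort_sorted ger_total s; have : uniq (sort ger s) by rewrite sort_uniq.
have : forall l, l \in sort ger s -> G l (f l).
  by move=> l; rewrite mem_sort => /sf[].
elim: (sort ger s) => [|d t IH] tG ut st; first by rewrite big_nil.
have td l : l \in t -> l < d.
  move=> lt; rewrite lt_neqAle; have /allP/(_ l lt) ld := order_path_min ger_trans st.
  rewrite [l <= d]ld andbT; have /andP[dt _] := ut.
  by apply: contraNneq dt => <-.
have tG' l : l \in t -> G l (f l) by move=> lt; apply: tG; rewrite inE lt orbT.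
rewrite big_cons; apply: (PS d); first by apply: tG; exact: mem_head.
  by exists t, f; split=> // l lt; split; [exact: td | exact: tG'].
by apply: IH => //; [case/andP: ut | exact: path_sorted st].
Qed.

Lemma top_component v : v != 0 -> exists d u,
  [/\ u != 0, G d u & homogeneous_sums G [set l | l < d] (v - u)].
Proof.
apply: (hs_top_ind (P := fun v => v != 0 -> _)) => {v} [|d u v Gu vd IH uv0].
  by rewrite eqxx.
have [u0|u0] := eqVneq u 0; first by move: uv0; rewrite u0 add0r.
by exists d, u; split=> //; rewrite addrAC subrr add0r.
Qed.

End TopComponents.

Section Saturation.
Variables (RR : realType) (R : comNzRingType) (GR : RR -> set R).
Variables (V : lmodType R) (G : RR -> set V).
Hypotheses (R_domain : GRing.integral_domain_axiom R).
Hypotheses (grR : is_grading GR) (grV : graded_module GR G).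
Implicit Types (A B : set V).

Definition torsion_free_over A B := forall r v, A v -> B (r *: v) -> r = 0 \/ B v.

Definition saturated_closure A : set V := [set v | exists2 r : R, r != 0 & A (r *: v)].

Lemma domain_mul_neq0 (r s : R) : r != 0 -> s != 0 -> r * s != 0.
Proof.
by move=> r0 s0; apply/eqP => /R_domain; rewrite (negbTE r0) (negbTE s0).
Qed.

Lemma sub_saturated A : A `<=` saturated_closure A.
Proof. by move=> v Av; exists 1; rewrite ?oner_neq0 ?scale1r. Qed.

Lemma saturated_torsion_free A : torsion_free_over setT (saturated_closure A).
Proof.
move=> r v _ [s s0 As]; have [->|r0] := eqVneq r 0; [by left | right].
by exists (s * r); [exact: domain_mul_neq0 | rewrite -scalerA].
Qed.

Lemma rsub_saturated A : rsub A -> rsub (saturated_closure A).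
Proof.
move=> As; split; first by apply: sub_saturated; exact: As.1.
move=> a u v [r r0 Au] [s s0 Av]; exists (r * s); first exact: domain_mul_neq0.
rewrite scalerDr; apply: rsubD => //.
  by rewrite scalerA -mulrA mulrC -scalerA; apply: rsubZ.
by rewrite -scalerA; apply: rsubZ.
Qed.

(** If [r *: (u + v)] lies in [A], where [u] is the top component of [u + v], then
    so does its own top component [r' *: u], where [r'] is the top component of
    [r]; thus [u], and then [v], belong to the closure. *)
Lemma gsub_saturated A : gsub G A -> gsub G (saturated_closure A).
Proof.
have [grG _] := grV; move=> [As At]; have Ss := rsub_saturated As.
split=> // D v; move: v D; apply: (hs_top_ind grG) => [D _|d u v Gu vd IH D [r r0 Auv]].
  exists 0; rewrite subr0; split; [exact: hs0| |exact: hs0].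
  by case: Ss.
have [e [r' [r'0 Gr' re]]] := top_component grR r0.
have [w [Dw Aw nDw]] := At [set e + d] _ Auv.
have ud : homogeneous_sums G [set d] u by apply: (hs_mem (l := d)).
have wE : w = r' *: u.
  apply: (hs_trunc_uniq grG Dw nDw).
    apply: (hs_scale grV _ (hs_mem (erefl e : [set e] e) Gr') ud).
    by move=> l m -> ->.
  rewrite scalerDr addrAC -scalerBl; apply: (hsD grG).
    apply: (hs_scale grV _ re ud) => l m /= le -> /eqP.
    by apply/negP; rewrite lt_eqF // ltrD2r.
  have rle : homogeneous_sums GR [set l | l <= e] r.
    rewrite -[r](subrK r'); apply: (hsD grR).
      by apply: hs_mono re => l; exact: ltW.
    by apply: (hs_mem (l := e)) => //=.
  apply: (hs_scale grV _ rle vd) => l m /= le md /eqP.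
  by apply/negP; rewrite lt_eqF // ler_ltD.
have Su : saturated_closure A u by exists r' => //; rewrite -wE.
have Sv : saturated_closure A v.
  by rewrite -[v](addKr u); apply: rsubD => //; [exact: rsubN | exists r].
have [t [Dt St nDt]] := IH D Sv.
have [Dd|nDd] := pselect (D d).
  exists (u + t); split; [|exact: rsubD|].
    by apply: (hsD grG) => //; apply: (hs_mem Dd).
  by rewrite opprD addrACA subrr add0r.
exists t; split=> //; rewrite -addrA; apply: (hsD grG) => //.
exact: (hs_mem (l := d)).
Qed.

End Saturation.

(** * Rank and degree as functions on the lattice of graded submodules *)

Section MaximalFamilies.
Variables (R : comNzRingType) (V : lmodType R).
Hypothesis R_domain : GRing.integral_domain_axiom R.
Implicit Types (A B : set V).

Definition indep_in A d := exists e : 'I_d -> V, (forall i, A (e i)) /\ lin_indep e.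

Definition max_indep A d := indep_in A d /\ forall d', indep_in A d' -> (d' <= d)%N.

Lemma max_indep_submod (S : submodClosed V) d :
  has_rank (submod S) d -> max_indep [set v | v \in S] d.
Proof.
move=> [[e eI] emax]; split.
  exists (fun i => submod_val (e i)); split=> [i|c c0]; first exact: submod_valP.
  apply: eI; apply: val_inj; rewrite [RHS](_ : _ = 0) // -[RHS]c0.
  exact: (additive_sum (@submod_valD _ _ S)).
move=> d' [f [fS fI]]; apply: (emax d' (fun i => Submod (fS i))) => c c0.
apply: fI; have := congr1 (@submod_val _ V S) c0.
by rewrite (additive_sum (@submod_valD _ _ S)).
Qed.

Lemma max_indep_le A B d d' : A `<=` B -> max_indep A d -> max_indep B d' ->
  (d <= d')%N.
Proof. by move=> AB [[e [eA eI]] _] [_ H]; apply: H; exists e; split=> // i; exact: AB. Qed.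

(** The members of an independent family of [B] have nonzero multiples in [A],
    which are independent too. *)
Lemma max_indep_saturated A B d d' : (forall v, B v -> saturated_closure A v) ->
  max_indep A d -> max_indep B d' -> (d' <= d)%N.
Proof.
move=> BA [_ H] [[e [eB eI]] _]; apply: H.
have /choice[r rP] i : exists r, r != 0 /\ A (r *: e i).
  by have [r r0 Ar] := BA _ (eB i); exists r.
exists (fun i => r i *: e i); split=> [i|c c0 i]; first by case: (rP i).
have /eI/(_ i) /R_domain : \sum_i (c i * r i) *: e i = 0.
  by rewrite -[RHS]c0; apply: eq_bigr => j _; rewrite scalerA.
by have [r0 _] := rP i; rewrite (negbTE r0) orbF => /eqP.
Qed.

(** An element [v] outside of [B] can be added to any independent family of [B]. *)
Lemma max_indep_torsion_free A B d : rsub B -> B `<=` A -> torsion_free_over A B ->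
  max_indep B d -> max_indep A d -> A `<=` B.
Proof.
move=> Bs BA t [[e [eB eI]] _] [_ H] v Av; apply: contrapT => nBv.
suff /H : indep_in A d.+1 by rewrite ltnn.
exists (fun i => if unlift ord0 i is Some j then e j else v); split=> [i|c].
  by case: unliftP => // j _; exact/BA/eB.
rewrite big_ord_recl unlift_none => c0.
have c0E : c ord0 *: v = - \sum_(j < d) c (lift ord0 j) *: e j.
  apply/eqP; rewrite -addr_eq0; apply/eqP; rewrite -[RHS]c0; congr (_ + _).
  by apply: eq_bigr => j _; rewrite liftK.
have [c00|//] : c ord0 = 0 \/ B v.
  apply: t => //; rewrite c0E; apply: rsubN => //; apply: rsub_sum => // j _.
  exact: rsubZ.
move=> i; have [j ->|->//] := unliftP ord0 i.
apply: (eI (fun j => c (lift ord0 j))); apply/eqP; rewrite -oppr_eq0 -c0E c00.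
by rewrite scale0r.
Qed.

End MaximalFamilies.

Section Uniqueness.
Variable RR : realType.

Lemma has_expansion_fst_uniq n (a b a' b' : RR) h : has_expansion n a b h ->
  has_expansion n a' b' h -> a = a'.
Proof.
move=> [J [E _]] [J' [E' _]]; apply: le_anti.
by rewrite (littleo_le _ (expansion_lim E) (expansion_lim E'))
  ?(littleo_le _ (expansion_lim E') (expansion_lim E)).
Qed.

Lemma has_expansion_snd_uniq n (a b a' b' : RR) h : (0 < n)%N -> a = a' ->
  has_expansion n a b h -> has_expansion n a' b' h -> b = b'.
Proof.
move=> n0 <- E E'; apply: le_anti.
by rewrite (has_expansion_second_le n0 _ E E') ?(has_expansion_second_le n0 _ E' E).
Qed.

End Uniqueness.

Section Invariants.
Variables (RR : realType) (k : fieldType) (R : comAlgType k) (GR : RR -> set R).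
Hypotheses (grR : graded_algebra GR) (R_fg : fg_algebra R).
Hypothesis R_domain : GRing.integral_domain_axiom R.
Variables (m : nat) (aR : RR).
Hypothesis aR_gt0 : 0 < aR.
Hypothesis hR_expansion :
  forall c, exists b, has_expansion m aR b (fun x => (hR GR (x - c))%:R).
Variables (V : lmodType R) (G : RR -> set V).
Hypotheses (grV : graded_module GR G) (V_fg : fg_module V) (V_tf : torsion_free V).
Implicit Types (A B C : set V).

Let grGR : is_grading GR. Proof. by have [] := grR. Qed.

(** Chosen at once for all graded submodules, rank and second coefficient can be
    used as functions on the lattice. *)
Lemma invariants_exist : exists (rho : set V -> nat) (b : set V -> RR),
  forall A, gsub G A -> max_indep A (rho A) /\
    has_expansion m ((rho A)%:R * aR) (b A) (fun x => (hf G A x)%:R).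
Proof.
have /choice[f fP] A : exists rb : nat * RR, gsub G A -> max_indep A rb.1 /\
    has_expansion m (rb.1%:R * aR) rb.2 (fun x => (hf G A x)%:R).
  have [Ag|nAg] := pselect (gsub G A); last by exists (0%N, 0).
  have [S SA] := rsub_mksub Ag.1.
  have Sg : graded_submodule G S by apply/(gsub_graded grV); rewrite SA.
  have S_fg := submodule_fg grR R_fg grV V_fg S.
  have S_tf : torsion_free (submod S).
    move=> r v rv0; have := congr1 (@submod_val _ V S) rv0 => /V_tf[|v0]; first by left.
    by right; apply: val_inj.
  have [Sr [b E]] := rank_expansion grR R_fg aR_gt0 hR_expansion R_domain
    (sub_graded grV Sg) S_fg S_tf.
  exists (rank (submod S), b) => _ /=; split; first by rewrite -SA; exact: max_indep_submod.
  congr has_expansion: E; apply/funext => x.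
  rewrite (hf_val grV Sg grR R_fg V_fg x (rsubT _)) -SA; congr (hf _ _ _)%:R.
  by apply/seteqP; split=> [_ [v _ <-]|v vS]; [exact: submod_valP | exists (Submod vS)].
by exists (fun A => (f A).1), (fun A => (f A).2).
Qed.

Variables (rho : set V -> nat) (b : set V -> RR).
Hypothesis inv : forall A, gsub G A -> max_indep A (rho A) /\
    has_expansion m ((rho A)%:R * aR) (b A) (fun x => (hf G A x)%:R).

Lemma rho_modular A B : gsub G A -> gsub G B ->
  (rho (sums A B) + rho (A `&` B) = rho A + rho B)%N.
Proof.
move=> Ag Bg; have [_ EA] := inv Ag; have [_ EB] := inv Bg.
have [_ ES] := inv (gsub_sums grV Ag Bg); have [_ EI] := inv (gsubI grV Ag Bg).
have E1 := has_expansionD ES EI; have E2 := has_expansionD EA EB.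
have hE : (fun x => (hf G (sums A B) x)%:R + (hf G (A `&` B) x)%:R) =
    (fun x => (hf G A x)%:R + (hf G B x)%:R) :> (RR -> RR).
  by apply/funext => x; rewrite -!natrD (hf_modular grR R_fg grV V_fg).
rewrite hE in E1; have /eqP := has_expansion_fst_uniq E1 E2.
by rewrite -!mulrDl -!natrD (inj_eq (mulIf (lt0r_neq0 aR_gt0))) eqr_nat => /eqP.
Qed.

Lemma second_modular A B : (0 < m)%N -> gsub G A -> gsub G B ->
  b (sums A B) + b (A `&` B) = b A + b B.
Proof.
move=> m0 Ag Bg; have [_ EA] := inv Ag; have [_ EB] := inv Bg.
have [_ ES] := inv (gsub_sums grV Ag Bg); have [_ EI] := inv (gsubI grV Ag Bg).
have E1 := has_expansionD ES EI; have E2 := has_expansionD EA EB.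
apply: (has_expansion_snd_uniq m0 _ E1).
  by rewrite -mulrDl -natrD rho_modular.
rewrite -mulrDl -natrD in E2; congr has_expansion: E2; apply/funext => x.
by rewrite -!natrD (hf_modular grR R_fg grV V_fg).
Qed.

Lemma rho_mono A B : gsub G A -> gsub G B -> A `<=` B -> (rho A <= rho B)%N.
Proof. by move=> /inv[mA _] /inv[mB _] AB; exact: max_indep_le AB mA mB. Qed.

Lemma second_mono A B : (0 < m)%N -> gsub G A -> gsub G B -> A `<=` B ->
  rho A = rho B -> b A <= b B.
Proof.
move=> m0 Ag Bg AB rE; have [_ EA] := inv Ag; have [_ EB] := inv Bg.
rewrite rE in EA; apply: (has_expansion_second_le m0 _ EA EB) => x.
by rewrite ler_nat; apply: (hf_le grR R_fg grV V_fg _ Ag.1 Bg.1).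
Qed.

Lemma rho_torsion_free A B C : gsub G B -> gsub G C -> B `<=` C -> C `<=` A ->
  torsion_free_over A B -> rho C = rho B -> C `<=` B.
Proof.
move=> Bg Cg BC CA t rE; have [mB _] := inv Bg; have [mC _] := inv Cg.
rewrite rE in mC; apply: (max_indep_torsion_free Bg.1 BC _ mB mC).
by move=> r v Cv; apply: t; exact: CA.
Qed.

Lemma rho_saturated A B : gsub G A -> gsub G B -> A `<=` B ->
  (forall v, B v -> saturated_closure A v) -> rho B = rho A.
Proof.
move=> Ag Bg AB BA; apply/eqP; rewrite eqn_leq (rho_mono Ag Bg AB) andbT.
exact: (max_indep_saturated R_domain BA (inv Ag).1 (inv Bg).1).
Qed.

Lemma saturation_exists A : gsub G A ->
  exists A', [/\ gsub G A', A `<=` A', rho A' = rho A & torsion_free_over setT A'].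
Proof.
move=> Ag; have Sg := gsub_saturated R_domain grGR grV Ag.
have AS := @sub_saturated _ _ A.
exists (saturated_closure A); split=> //; first exact: rho_saturated.
exact: saturated_torsion_free.
Qed.

(** Let [B] be obtained from [A] by adding generators of [V] as long as they are
    independent. Then [B] and [V] have the same rank, so the second coefficient of
    [B] is at most that of [V], and it exceeds that of [A] by the contributions of
    the added generators, which are among finitely many. *)
Lemma second_bounded : (0 < m)%N -> exists K, forall A, gsub G A -> b A <= K.
Proof.
move=> m0; have [hv [hvG hvgen]] := homogeneous_family grV V_fg.
have /choice[bs bsE] := hR_expansion.
exists (b setT + (\sum_(p <- hv) `|bs p.1|) *+ size hv) => A Ag.
have [e [B [[ehv se] Bg AB Bmul [hfB _]]]] := add_generators grR R_fg grV V_fg hvG Ag.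
have rB : rho setT = rho B.
  apply: rho_saturated => //; first exact: (gsubT grV).
  move=> v _; apply: hvgen; first exact: (rsub_saturated R_domain Bg.1).
  by move=> p /Bmul[c c0 Bc]; exists c.
have le1 := second_mono m0 Bg (gsubT grV) (@subsetT _ _) (esym rB).
have [_ EB] := inv Bg; have [_ EA] := inv Ag.
have Ee : has_expansion m ((size e)%:R * aR) (\sum_(p <- e) bs p.1)
    (fun x => (\sum_(p <- e) hR GR (x - p.1))%:R).
  have := free_expansion e fst 0 bsE; under eq_bigr do rewrite add0r.
  by congr has_expansion; apply/funext => x; rewrite subr0.
have E := has_expansionD Ee EA.
have {}E : has_expansion m ((size e)%:R * aR + (rho A)%:R * aR)
    (\sum_(p <- e) bs p.1 + b A) (fun x => (hf G B x)%:R).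
  by congr has_expansion: E; apply/funext => x; rewrite hfB natrD.
have bB : b B = \sum_(p <- e) bs p.1 + b A.
  exact: (has_expansion_snd_uniq m0 (has_expansion_fst_uniq EB E) EB E).
have -> : b A = b B - \sum_(p <- e) bs p.1 by rewrite bB addrAC subrr add0r.
rewrite lerD //; apply: le_trans (ler_norm _) _; rewrite normrN.
apply: le_trans (ler_norm_sum _ _ _) _.
have bd p : p \in hv -> `|bs p.1| <= \sum_(p <- hv) `|bs p.1|.
  move=> phv; rewrite (big_rem p) //= lerDl; exact: sumr_ge0.
apply: (@le_trans _ _ (\sum_(p <- e) \sum_(p <- hv) `|bs p.1|)).
  by rewrite big_seq [leRHS]big_seq; apply: ler_sum => p /ehv/bd.
rewrite big_const_seq iter_addr_0 count_predT; apply: ler_wpMn2l => //.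
exact: sumr_ge0.
Qed.

End Invariants.

(** * Harder-Narasimhan filtrations in a modular lattice *)

(** [L] is the set of elements of a modular lattice of subsets of [M], [rho] plays
    the role of the rank and [beta] that of the degree; [tf A B] stands for the
    torsion-freeness of [A / B]. *)

Section AbstractHN.
Variables (RR : realType) (M : Type).
Variables (L : set M -> Prop) (join : set M -> set M -> set M) (bot : set M).
Variables (rho : set M -> nat) (beta : set M -> RR) (tf : set M -> set M -> Prop).
Implicit Types (A B C D : set M) (F : nat -> set M) (s e : RR).

Hypothesis L_I : forall A B, L A -> L B -> L (A `&` B).
Hypothesis L_join : forall A B, L A -> L B -> L (join A B).
Hypothesis L_top : L setT.
Hypothesis L_bot : L bot.
Hypothesis join_l : forall A B, L A -> L B -> A `<=` join A B.
Hypothesis join_r : forall A B, L A -> L B -> B `<=` join A B.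
Hypothesis join_sub : forall A B C, L C -> A `<=` C -> B `<=` C -> join A B `<=` C.
Hypothesis rho_mod : forall A B, L A -> L B ->
  (rho (join A B) + rho (A `&` B) = rho A + rho B)%N.
Hypothesis beta_mod : forall A B, L A -> L B ->
  beta (join A B) + beta (A `&` B) = beta A + beta B.
Hypothesis rho_le : forall A B, L A -> L B -> A `<=` B -> (rho A <= rho B)%N.
Hypothesis beta_le : forall A B, L A -> L B -> A `<=` B -> rho A = rho B ->
  beta A <= beta B.
Hypothesis beta_bounded : exists K, forall A, L A -> beta A <= K.
Hypothesis tf_rho : forall A B C, L A -> L B -> L C -> B `<=` C -> C `<=` A ->
  tf A B -> rho C = rho B -> C `<=` B.
Hypothesis tf_sub : forall A B C, L A -> L B -> L C -> B `<=` C -> C `<=` A ->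
  tf A B -> tf C B.
Hypothesis tf_bot : tf setT bot.
Hypothesis saturation : forall A, L A ->
  exists A', [/\ L A', A `<=` A', rho A' = rho A & tf setT A'].

Definition rel_slope A B : RR := (beta A - beta B) / ((rho A)%:R - (rho B)%:R).

Definition abstract_HN l F := [/\ F 0%N = bot /\ F l = setT,
  forall i, (i <= l)%N -> L (F i),
  forall i, (i < l)%N -> [/\ F i `<=` F i.+1, ~ F i.+1 `<=` F i & tf (F i.+1) (F i)],
  forall i, (i < l)%N -> forall C, L C -> F i `<=` C -> C `<=` F i.+1 ->
    ~ C `<=` F i -> rel_slope C (F i) <= rel_slope (F i.+1) (F i) &
  forall i, (i.+1 < l)%N -> rel_slope (F i.+2) (F i.+1) < rel_slope (F i.+1) (F i)].

(** For [rho B < rho A] this has the sign of the slope of [A] over [B] minus [s].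
    Unlike the slope it is modular in [A], and meaningful for [A = B]. *)
Let excess B s A : RR := beta A - beta B - s * ((rho A)%:R - (rho B)%:R).

(** The maximal destabilizing element over [B], with its slope. *)
Definition max_destab B A s := [/\ L A, B `<=` A, ~ A `<=` B, excess B s A = 0 &
  forall C, L C -> B `<=` C -> excess B s C <= 0 /\ (excess B s C = 0 -> C `<=` A)].

Lemma rho_lt A B C : L A -> L B -> L C -> tf A B -> B `<=` C -> C `<=` A ->
  ~ C `<=` B -> (rho B < rho C)%N.
Proof.
move=> LA LB LC t BC CA nCB; rewrite ltn_neqAle rho_le // andbT.
by apply/negP => /eqP rE; apply: nCB; apply: tf_rho t _.
Qed.

Lemma excess_slope B s A : (rho B < rho A)%N ->
  excess B s A = (rel_slope A B - s) * ((rho A)%:R - (rho B)%:R).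
Proof.
move=> BA; rewrite /excess /rel_slope mulrBl divfK //.
by rewrite subr_eq0 eqr_nat gtn_eqF.
Qed.

Lemma excess_join B s A C : L A -> L C ->
  excess B s (join A C) + excess B s (A `&` C) = excess B s A + excess B s C.
Proof.
move=> LA LC; have := beta_mod LA LC.
have : (rho (join A C))%:R + (rho (A `&` C))%:R = (rho A)%:R + (rho C)%:R :> RR.
  by rewrite -!natrD rho_mod.
rewrite /excess => h1 h2.
have -> : beta (join A C) = beta A + beta C - beta (A `&` C) by rewrite -h2 addrK.
have -> : (rho (join A C))%:R = (rho A)%:R + (rho C)%:R - (rho (A `&` C))%:R :> RR.
  by rewrite -h1 addrK.
by ring.
Qed.

(** Let [s] be the supremum of the slopes over [B], and [r] the largest rank for
    which elements of rank [r] have excess arbitrarily close to [0]. Let [A], [C] be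
    two of them, [A] saturated. The excess of the intersection being nonpositive,
    that of the sum is close to [0] too, so the sum has rank [r] and [C] is
    contained in [A]: thus the excess of [A] is exactly [0]. *)
Lemma max_destab_exists B : L B -> tf setT B -> ~ setT `<=` B ->
  exists A s, max_destab B A s /\ tf setT A.
Proof.
move=> LB tB nTB.
pose above C := [/\ L C, B `<=` C & ~ C `<=` B].
have aboveT : above setT by split.
have rho_above C : above C -> (rho B < rho C)%N.
  by move=> [LC BC nCB]; apply: (rho_lt L_top LB LC tB BC _ nCB).
pose S := [set rel_slope C B | C in above].
have [K HK] := beta_bounded.
have Sub : has_sup S.
  split; first by exists (rel_slope setT B), setT.
  exists `|K - beta B| => _ [C aC <-]; have [LC BC nCB] := aC.
  have d1 : 1 <= (rho C)%:R - (rho B)%:R :> RR.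
    by rewrite lerBrDr -(natrD _ 1) ler_nat add1n rho_above.
  rewrite /rel_slope ler_pdivrMr ?(lt_le_trans ltr01) //.
  apply: (@le_trans _ _ `|K - beta B|); last by rewrite ler_peMr.
  by apply: le_trans (ler_norm _); rewrite lerD2r HK.
pose s := sup S; pose N := rho setT.
have excess_le0 C : L C -> B `<=` C -> excess B s C <= 0.
  move=> LC BC; have [CB|nCB] := pselect (C `<=` B).
    have -> : C = B by apply/seteqP.
    by rewrite /excess !subrr mulr0 subrr.
  have aC : above C by [].
  rewrite excess_slope ?rho_above // mulr_le0_ge0 ?subr_ge0 ?ler_nat ?rho_le //.
  by rewrite subr_le0; apply: ub_le_sup; [case: Sub | exists C].
(* Ranks at which the supremum is approached. *)
pose near0 r := forall e, 0 < e -> exists C, [/\ above C, rho C = r & - e < excess B s C].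
(* As there are finitely many ranks, at all the others the excess is bounded away
   from [0] by a common [e0]. *)
have [e0 e00 far] : exists2 e0 : RR, 0 < e0 &
    forall C, above C -> ~ near0 (rho C) -> excess B s C <= - e0.
  have [e0 [e00 H]] : exists e0 : RR, 0 < e0 /\ forall C, above C -> (rho C < N.+1)%N ->
      ~ near0 (rho C) -> excess B s C <= - e0.
    elim: N.+1 => [|n [e1 [e10 H1]]]; first by exists 1; split.
    have [nn|nn] := pselect (near0 n).
      exists e1; split=> // C aC; rewrite ltnS leq_eqVlt => /predU1P[-> /(_ nn)//|Cn].
      exact: H1.
    have [e2 /not_implyP[e20 H2]] : exists e2, ~ (0 < e2 -> exists C,
        [/\ above C, rho C = n & - e2 < excess B s C]) by exact/existsNP.
    exists (Num.min e1 e2); split; first by rewrite lt_min e10.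
    move=> C aC; rewrite ltnS leq_eqVlt => /predU1P[Cn _|Cn nC].
      rewrite leNgt; apply/negP => lt2; apply: H2; exists C; split=> //.
      by apply: le_lt_trans lt2; rewrite lerN2 ge_min lexx orbT.
    by apply: le_trans (H1 C aC Cn nC) _; rewrite lerN2 ge_min lexx.
  by exists e0 => // C aC; apply: H => //; have [LC _ _] := aC; rewrite ltnS rho_le.
have [r nr rmax] : exists2 r, near0 r & forall r', near0 r' -> (r' <= r)%N.
  have near_le r' : near0 r' -> (r' <= N)%N.
    by move=> /(_ 1 ltr01)[C [[LC _ _] <- _]]; rewrite rho_le.
  have [r0 nr0] : exists r0, near0 r0.
    apply: contrapT => none.
    have N0 : 0 < (N.+1)%:R :> RR by rewrite ltr0n.
    have [_ [C aC <-]] := sup_adherent (divr_gt0 e00 N0) Sub.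
    rewrite -/s => hC; have := far C aC (fun h => none (ex_intro _ _ h)).
    rewrite leNgt => /negP; apply.
    rewrite excess_slope ?rho_above //.
    have [LC BC _] := aC; have rC := rho_above C aC.
    pose d : RR := (rho C)%:R - (rho B)%:R; rewrite -/d.
    have d0 : 0 < d by rewrite subr_gt0 ltr_nat.
    have dN : d < N.+1%:R.
      by apply: (@le_lt_trans _ _ (rho C)%:R); rewrite ?gerBl ?ler0n // ltr_nat ltnS rho_le.
    rewrite ltrNl -mulNr opprB; have [hs|hs] := leP (s - rel_slope C B) 0.
      by apply: le_lt_trans e00; rewrite mulr_le0_ge0 // ltW.
    apply: (@lt_trans _ _ ((s - rel_slope C B) * N.+1%:R)); first by rewrite ltr_pM2l.
    by rewrite -ltr_pdivlMr // ltrBlDr addrC -ltrBlDr.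
  have exr : exists r0, `[< near0 r0 >] by exists r0; exact/asboolP.
  case: (ex_maxnP exr (m := N)) => [r' /asboolP/near_le//|r /asboolP nr rm].
  by exists r => // r' nr'; apply: rm; exact/asboolP.
have far_rank C : above C -> (r < rho C)%N -> excess B s C <= - e0.
  by move=> aC rC; apply: far => // /rmax; rewrite leqNgt rC.
have [A0 [[LA0 BA0 nA0B] rA0 eA0]] := nr (e0 / 2%:R) (divr_gt0 e00 (ltr0Sn _ _)).
have [A [LA A0A rA tA]] := saturation LA0.
have BA : B `<=` A by exact: subset_trans A0A.
have nAB : ~ A `<=` B by move=> AB; apply: nA0B; exact: subset_trans AB.
have aA : above A by [].
have eA : - (e0 / 2%:R) < excess B s A.
  apply: lt_le_trans eA0 _; rewrite /excess rA lerD2r lerD2r.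
  by apply: beta_le.
have absorb C : L C -> B `<=` C -> - (e0 / 2%:R) < excess B s C -> C `<=` A.
  move=> LC BC eC; have LJ := L_join LA LC.
  have AJ := join_l LA LC; have CJ := join_r LA LC.
  have aJ : above (join A C).
    split=> //; first exact: subset_trans AJ.
    by move=> JB; apply: nAB; exact: subset_trans JB.
  have eI : excess B s (A `&` C) <= 0.
    by apply: excess_le0; [exact: L_I | move=> x Bx; split; [exact: BA | exact: BC]].
  have eJ : - e0 < excess B s (join A C).
    have := excess_join B s LA LC; move: eA eC eI.
    move: (excess B s A) (excess B s C) (excess B s (A `&` C)) (excess B s (join A C)) => *.
    by lra.
  have rJ : rho (join A C) = rho A.
    apply/eqP; rewrite eqn_leq (rho_le LA LJ AJ) andbT rA rA0 leqNgt.
    apply/negP => rJ; by have := far_rank _ aJ rJ; rewrite leNgt eJ.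
  exact: subset_trans CJ (tf_rho L_top LA LJ AJ (@subsetT _ _) tA rJ).
have A0E : excess B s A = 0.
  apply: le_anti; rewrite excess_le0 //= leNgt; apply/negP => eA_lt0.
  have e1 : 0 < Num.min (e0 / 2%:R) (- excess B s A).
    by rewrite lt_min divr_gt0 //= oppr_gt0.
  have [C [[LC BC nCB] rC eC]] := nr _ e1.
  have CA : C `<=` A.
    by apply: absorb => //; apply: le_lt_trans eC; rewrite lerN2 ge_min lexx.
  have : excess B s C <= excess B s A.
    rewrite /excess rC rA rA0 !lerD2r; apply: beta_le => //.
    by rewrite rC rA.
  rewrite leNgt => /negP; apply; apply: le_lt_trans eC.
  by rewrite lerNr ge_min lexx orbT.
exists A, s; split=> //; split=> // C LC BC; split; first exact: excess_le0.
by move=> eC; apply: absorb => //; rewrite eC oppr_lt0 divr_gt0.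
Qed.

Lemma max_destab_uniq B A A' s s' : L B -> max_destab B A s -> max_destab B A' s' ->
  (rho B < rho A)%N -> (rho B < rho A')%N -> A = A'.
Proof.
move=> LB [LA BA nAB eA mA] [LA' BA' nAB' eA' mA'] rA rA'.
have d0 : 0 < (rho A)%:R - (rho B)%:R :> RR by rewrite subr_gt0 ltr_nat.
have d0' : 0 < (rho A')%:R - (rho B)%:R :> RR by rewrite subr_gt0 ltr_nat.
have ss' : s' = s.
  apply: le_anti; apply/andP; split.
    have := (mA A' LA' BA').1; rewrite /excess subr_le0.
    by move/eqP: eA'; rewrite /excess subr_eq0 => /eqP ->; rewrite ler_pM2r.
  have := (mA' A LA BA).1; rewrite /excess subr_le0.
  by move/eqP: eA; rewrite /excess subr_eq0 => /eqP ->; rewrite ler_pM2r.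
apply/seteqP; split; first by apply: (mA' A LA BA).2; rewrite ss'.
by apply: (mA A' LA' BA').2; rewrite -ss'.
Qed.

(** Intersecting [C] with the filtration bounds its excess by contributions of the
    successive slopes, only the first of which can vanish on a nonzero part. This is
    what uniqueness rests on, because it determines each step by the previous one. *)
Lemma HN_max_destab l F i : abstract_HN l F -> (i < l)%N ->
  max_destab (F i) (F i.+1) (rel_slope (F i.+1) (F i)) /\ (rho (F i) < rho (F i.+1))%N.
Proof.
move=> [[F0 Fl] FL Fsub Fss Fslope] il.
set s := rel_slope _ _.
have rlt j : (j < l)%N -> (rho (F j) < rho (F j.+1))%N.
  move=> jl; have [sj nj tj] := Fsub j jl.
  by apply: (rho_lt (FL _ jl) (FL _ (ltnW jl)) (FL _ jl) tj).
split; last exact: rlt.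
have [si ni ti] := Fsub i il.
have slope_lt j : (i < j)%N -> (j < l)%N -> rel_slope (F j.+1) (F j) < s.
  elim: j => [//|j IH]; rewrite ltnS leq_eqVlt => /predU1P[<- jl|ij jl].
    exact: Fslope.
  by apply: lt_trans (Fslope j jl) (IH ij (ltnW jl)).
split=> //; first exact: FL.
  by rewrite excess_slope ?rlt // subrr mul0r.
move=> C LC FC; pose C' j := C `&` F j.
have LC' j : (j <= l)%N -> L (C' j) by move=> jl; apply: L_I => //; exact: FL.
have C'sub j : (j < l)%N -> C' j `<=` C' j.+1.
  by move=> jl x [Cx Fx]; split=> //; have [h _ _] := Fsub j jl; exact: h.
have step j : (j < l)%N -> beta (C' j.+1) - beta (C' j) <=
    rel_slope (F j.+1) (F j) * ((rho (C' j.+1))%:R - (rho (C' j))%:R) /\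
    (rho (C' j.+1) = rho (C' j) -> C' j.+1 `<=` C' j).
  move=> jl; have [sj nj tj] := Fsub j jl.
  have LF := FL j (ltnW jl); have LF1 := FL j.+1 jl; have LC1 := LC' j.+1 jl.
  pose D := join (C' j.+1) (F j); have LD : L D := L_join LC1 LF.
  have FD : F j `<=` D := join_r LC1 LF.
  have CD : C' j.+1 `<=` D := join_l LC1 LF.
  have DF : D `<=` F j.+1 by apply: join_sub => // x [].
  have IE : C' j.+1 `&` F j = C' j.
    apply/seteqP; split=> x; first by move=> [[Cx _] Fx].
    by move=> [Cx Fx]; split=> //; split=> //; exact: sj.
  have rD : (rho D + rho (C' j) = rho (C' j.+1) + rho (F j))%N by rewrite -IE rho_mod.
  have bD : beta D - beta (F j) = beta (C' j.+1) - beta (C' j).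
    by have := beta_mod LC1 LF; rewrite IE -/D => h; rewrite -[beta D](addrK (beta (C' j))) h; ring.
  have rD' : (rho D)%:R - (rho (F j))%:R = (rho (C' j.+1))%:R - (rho (C' j))%:R :> RR.
    have : (rho D)%:R + (rho (C' j))%:R = (rho (C' j.+1))%:R + (rho (F j))%:R :> RR.
      by rewrite -!natrD rD.
    by move=> h; rewrite -[(rho D)%:R](addrK (rho (C' j))%:R) h; ring.
  split; last first.
    move=> rE; have rDE : rho D = rho (F j).
      by apply/eqP; rewrite -(eqn_add2r (rho (C' j))) rD rE addnC.
    have DFj := tf_rho LF1 LF LD FD DF tj rDE.
    by move=> x Cx; split; [case: Cx | apply: DFj; exact: CD].
  rewrite -bD -rD'; have [DFj|nDF] := pselect (D `<=` F j).
    have -> : D = F j by apply/seteqP.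
    by rewrite !subrr mulr0.
  have rlt' := rho_lt LF1 LF LD tj FD DF nDF.
  have := Fss j jl D LD FD DF nDF.
  by rewrite {1}/rel_slope ler_pdivrMr // subr_gt0 ltr_nat.
have main j : (i < j)%N -> (j <= l)%N -> excess (F i) s (C' j) <= 0 /\
    (excess (F i) s (C' j) = 0 -> C' j `<=` F i.+1).
  elim: j => [//|j IH]; rewrite ltnS leq_eqVlt => /predU1P[<- {IH} _|ij jl].
    have C'i : C' i = F i by apply/seteqP; split=> [x []//|x Fx]; split=> //; exact: FC.
    split; last by move=> _ x [].
    have := (step i il).1; rewrite C'i -/s => h.
    by rewrite /excess subr_le0.
  have [IHle IHeq] := IH ij (ltnW jl); have [sle srho] := step j jl.
  have E : excess (F i) s (C' j.+1) = excess (F i) s (C' j) +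
      (beta (C' j.+1) - beta (C' j) - s * ((rho (C' j.+1))%:R - (rho (C' j))%:R)).
    by rewrite /excess; ring.
  have slt := slope_lt j ij jl.
  have := rho_le (LC' j (ltnW jl)) (LC' j.+1 jl) (C'sub j jl).
  rewrite leq_eqVlt => /predU1P[rE|rlt'].
    have CE : C' j.+1 = C' j.
      by apply/seteqP; split; [exact: srho | exact: C'sub].
    by rewrite CE.
  have d0 : 0 < (rho (C' j.+1))%:R - (rho (C' j))%:R :> RR by rewrite subr_gt0 ltr_nat.
  have lt0 : excess (F i) s (C' j.+1) < 0.
    rewrite E; have : rel_slope (F j.+1) (F j) * ((rho (C' j.+1))%:R - (rho (C' j))%:R) <
        s * ((rho (C' j.+1))%:R - (rho (C' j))%:R) by rewrite ltr_pM2r.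
    by move: sle IHle => h1 h2 h3; rewrite -(addr0 0) ler_ltD // subr_lt0 (le_lt_trans h1).
  by split; [exact: ltW | move=> h; move: lt0; rewrite h ltxx].
have := main l il (leqnn l).
by have -> : C' l = C by rewrite /C' Fl setIT.
Qed.

(** Iterate [max_destab_exists]; the rank increases at each step. Slopes decrease
    because an equality would put the second step into the first one, by the
    maximality of that one. *)
Theorem abstract_HN_exists : exists l F, abstract_HN l F.
Proof.
suff chain n B : (rho setT - rho B < n)%N -> L B -> tf setT B -> exists l F,
    [/\ F 0%N = B, F l = setT, forall i, (i <= l)%N -> L (F i) /\ tf setT (F i) &
     forall i, (i < l)%N -> exists s, max_destab (F i) (F i.+1) s].
  have [l [F [F0 Fl FL Fd]]] := chain _ bot (ltnSn _) L_bot tf_bot.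
  have tfF i : (i < l)%N -> tf (F i.+1) (F i).
    move=> il; have [s [_ si ni _ _]] := Fd i il.
    apply: tf_sub (FL i (ltnW il)).2 => //; [exact: (FL i (ltnW il)).1|exact: (FL i.+1 il).1].
  have rlt i : (i < l)%N -> (rho (F i) < rho (F i.+1))%N.
    move=> il; have [s [LF si ni _ _]] := Fd i il.
    exact: (rho_lt LF (FL i (ltnW il)).1 LF (tfF i il)).
  have dest i : (i < l)%N -> max_destab (F i) (F i.+1) (rel_slope (F i.+1) (F i)).
    move=> il; have [s [LF si ni es ms]] := Fd i il.
    suff -> : rel_slope (F i.+1) (F i) = s by [].
    move/eqP: es; rewrite excess_slope ?rlt // mulf_eq0 subr_eq0 => /orP[/eqP//|].
    by rewrite subr_eq0 eqr_nat gtn_eqF // rlt.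
  exists l, F; split=> // [i il|i il|i il C LC FC CF nCF|i il].
  - exact: (FL i il).1.
  - by have [s [_ si ni _ _]] := Fd i il; split=> //; exact: tfF.
  - have [_ _ _ _ ms] := dest i il; have [+ _] := ms C LC FC.
    have rC := rho_lt (FL i.+1 il).1 (FL i (ltnW il)).1 LC (tfF i il) FC CF nCF.
    by rewrite excess_slope // pmulr_lle0 ?subr_gt0 ?ltr_nat // subr_le0.
  - have [LF1 s1 n1 e1 m1] := dest i (ltnW il); have [LF2 s2 n2 e2 m2] := dest i.+1 il.
    have [le0 eq0] := m1 _ LF2 (subset_trans s1 s2).
    rewrite ltNge; apply/negP => sle; apply: n2; apply: eq0; apply: le_anti.
    rewrite le0 /=.
    have -> : excess (F i) (rel_slope (F i.+1) (F i)) (F i.+2) =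
        excess (F i) (rel_slope (F i.+1) (F i)) (F i.+1) +
        excess (F i.+1) (rel_slope (F i.+1) (F i)) (F i.+2) by rewrite /excess; ring.
    rewrite e1 add0r excess_slope ?rlt // mulr_ge0 ?subr_ge0 // ler_nat.
    by rewrite ltnW // rlt.
elim: n B => [//|n IH] B rB LB tB.
have [TB|nTB] := pselect (setT `<=` B).
  have BT : B = setT by apply/seteqP.
  exists 0%N, (fun=> B); split=> //.
have [A [s [dA tA]]] := max_destab_exists LB tB nTB.
have [LA BA nAB _ _] := dA.
have rA : (rho setT - rho A < n)%N.
  have := rho_lt L_top LB LA tB BA (@subsetT _ _) nAB.
  have := rho_le LA L_top (@subsetT _ _); move: rB; lia.
have [l [F [F0 Fl FL Fd]]] := IH A rA LA tA.
exists l.+1, (fun i => if i is j.+1 then F j else B); split=> //.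
- by case=> [|i] //; rewrite ltnS; exact: FL.
- by case=> [|i]; [exists s; rewrite F0 | rewrite ltnS; exact: Fd].
Qed.

Theorem abstract_HN_unique l F l' F' : abstract_HN l F -> abstract_HN l' F' ->
  l' = l /\ forall i, (i <= l)%N -> F' i = F i.
Proof.
move=> H H'; have [[F0 Fl] FL Fsub _ _] := H; have [[F0' Fl'] FL' Fsub' _ _] := H'.
have eqF i : (i <= l)%N -> (i <= l')%N -> F' i = F i.
  elim: i => [|i IH] il il'; first by rewrite F0 F0'.
  have [d r] := HN_max_destab H il; have [d' r'] := HN_max_destab H' il'.
  have E := IH (ltnW il) (ltnW il'); rewrite E in d' r'.
  exact: (max_destab_uniq (FL i (ltnW il)) d' d r' r).
suff ll' : l' = l by split=> // i il; apply: eqF => //; rewrite ll'.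
have [lt|lt|//] := ltngtP l' l.
- have [_ + _] := Fsub l' lt; rewrite -(eqF l' (ltnW lt) (leqnn _)) Fl'.
  by case; exact: subsetT.
- have [_ + _] := Fsub' l lt; rewrite (eqF l (leqnn _) (ltnW lt)) Fl.
  by case; exact: subsetT.
Qed.

End AbstractHN.

(** * Slopes of subquotients *)

Section SlopeFormula.
Variables (RR : realType) (k : fieldType) (R : comAlgType k) (GR : RR -> set R).
Hypotheses (grR : graded_algebra GR) (R_fg : fg_algebra R).
Hypothesis R_domain : GRing.integral_domain_axiom R.
Variables (n m : nat) (aR bR : RR).
Hypotheses (n_gt0 : (0 < n)%N) (aR_gt0 : 0 < aR).
Hypothesis hR_expansion :
  forall c, exists b, has_expansion m aR b (fun x => (hR GR (x - c))%:R).
Hypothesis bR_expansion : has_expansion m aR bR (fun x => (hR GR x)%:R).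

Lemma leading_coefE (V : lmodType R) (G : RR -> set V) a b : 0 < a ->
  has_expansion m a b (fun x => (hf G setT x)%:R) ->
  leading_coef n G = if n == m then a * n`!%:R else 0.
Proof.
move=> a0 E; rewrite /leading_coef hilbertE; case: eqVneq => [nm|/eqP nm].
  by rewrite -nm in E; have [] := has_expansion_coefs n_gt0 E.
by case: xgetP => // A _ HA; exact: (leading_coef_other n_gt0 nm a0 E HA).
Qed.

Lemma second_coefE (V : lmodType R) (G : RR -> set V) a b : 0 < a -> n = m ->
  has_expansion m a b (fun x => (hf G setT x)%:R) -> second_coef n G = b * n`!%:R.
Proof.
move=> a0 nm E; rewrite /second_coef (leading_coefE a0 E) hilbertE nm eqxx.
by have [] := has_expansion_coefs (_ : (0 < m)%N) E; rewrite -?nm.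
Qed.

Lemma slopeE (V : lmodType R) (G : RR -> set V) : graded_module GR G ->
  fg_module V -> torsion_free V -> nonzero_module V -> exists2 b : RR,
    has_expansion m ((rank V)%:R * aR) b (fun x => (hf G setT x)%:R) &
    slope n GR G =
      if n == m then (b - (rank V)%:R * bR) / ((rank V)%:R * aR) else 0.
Proof.
move=> grV V_fg V_tf V0.
have [_ [b E]] := rank_expansion grR R_fg aR_gt0 hR_expansion R_domain grV V_fg V_tf.
have r0 := rank_gt0 grR R_fg aR_gt0 hR_expansion R_domain grV V_fg V_tf V0.
have a0 : 0 < (rank V)%:R * aR by rewrite mulr_gt0 // ltr0n.
exists b => //; rewrite /slope (leading_coefE a0 E); case: eqP => [nm|]; last first.
  by rewrite invr0 mulr0.
rewrite /degree (second_coefE a0 nm E) (second_coefE (V := R^o) aR_gt0 nm bR_expansion).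
have n0 : n`!%:R != 0 :> RR by rewrite pnatr_eq0 -lt0n fact_gt0.
by rewrite mulrA -mulrBl -mulf_div divff // mulr1.
Qed.

Variables (V : lmodType R) (G : RR -> set V) (rho : set V -> nat) (b : set V -> RR).
Hypothesis inv : forall A, gsub G A -> max_indep A (rho A) /\
    has_expansion m ((rho A)%:R * aR) (b A) (fun x => (hf G A x)%:R).

(** Normalized so that the slope of a subquotient is the quotient of the differences
    of [reduced_degree] and of [rho]. If [n] is not the order of growth, the
    leading coefficients vanish, and division by [0] makes all slopes [0]. *)
Definition reduced_degree (A : set V) : RR :=
  if n == m then (b A - (rho A)%:R * bR) / aR else 0.

Lemma slope_difference (Q : lmodType R) (GQ : RR -> set Q) (A B : set V) :
  graded_module GR GQ -> fg_module Q -> torsion_free Q -> nonzero_module Q ->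
  gsub G A -> gsub G B -> (forall x, hf G A x = (hf GQ setT x + hf G B x)%N) ->
  slope n GR GQ = rel_slope rho reduced_degree A B.
Proof.
move=> grQ Q_fg Q_tf Q0 /inv[_ EA] /inv[_ EB] hE.
have [bQ E ->] := slopeE grQ Q_fg Q_tf Q0.
rewrite /rel_slope /reduced_degree; case: eqP => [nm|]; last by rewrite subr0 mul0r.
have m0 : (0 < m)%N by rewrite -nm.
have {}E : has_expansion m ((rank Q)%:R * aR) bQ
    (fun x => (hf G A x)%:R - (hf G B x)%:R).
  by congr has_expansion: E; apply/funext => x; rewrite hE natrD addrK.
have E' := has_expansionB EA EB.
have aE := has_expansion_fst_uniq E E'; have bE := has_expansion_snd_uniq m0 aE E E'.
move: aE; rewrite -mulrBl => /(mulIf (lt0r_neq0 aR_gt0)) ->.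
by rewrite bE -mulrBl -[RHS]mulrA -invfM [aR * _]mulrC; congr (_ / _); ring.
Qed.

End SlopeFormula.

(** * Translation to the lattice of graded submodules *)

Section Translation.
Variables (RR : realType) (k : fieldType) (R : comAlgType k) (GR : RR -> set R).
Hypotheses (grR : graded_algebra GR) (R_fg : fg_algebra R).
Hypothesis R_domain : GRing.integral_domain_axiom R.
Variables (n m : nat) (aR bR : RR).
Hypotheses (n_gt0 : (0 < n)%N) (aR_gt0 : 0 < aR).
Hypothesis hR_expansion :
  forall c, exists b, has_expansion m aR b (fun x => (hR GR (x - c))%:R).
Hypothesis bR_expansion : has_expansion m aR bR (fun x => (hR GR x)%:R).
Variables (V : lmodType R) (G : RR -> set V).
Hypotheses (grV : graded_module GR G) (V_fg : fg_module V).
Variables (rho : set V -> nat) (b : set V -> RR).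
Hypothesis inv : forall A, gsub G A -> max_indep A (rho A) /\
    has_expansion m ((rho A)%:R * aR) (b A) (fun x => (hf G A x)%:R).
Local Notation beta := (reduced_degree n m aR bR rho b).
Local Notation carrier S := [set v | v \in S].

Section OneSubquotient.
Variables (S T : submodClosed V).
Hypotheses (Sg : graded_submodule G S) (Tg : graded_submodule G T).
Hypothesis TS : {subset T <= S}.
Hypothesis tf : torsion_free_over (carrier S) (carrier T).
Local Notation GQ := (subquot_grading G S T).

Let grQ : graded_module GR GQ. Proof. exact: subquot_graded. Qed.
Let Q_fg : fg_module (subquot S T). Proof. exact: subquot_fg grV grR R_fg V_fg. Qed.
Let Q_tf : torsion_free (subquot S T). Proof. exact/subquot_torsion_free. Qed.

Lemma subquot_nonzero : nonzero_module (subquot S T) <-> ~ carrier S `<=` carrier T.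
Proof.
rewrite -(pullbackT S T); split=> [[q q0] /pullback_subT/(_ q Logic.I) qE|H].
  by rewrite (qE : q = 0) eqxx in q0.
apply: contrapT => Q0; apply: H; apply/pullback_subT => q _; apply/eqP.
by apply/negPn/negP => q0; apply: Q0; exists q.
Qed.

Lemma slope_subquot : ~ carrier S `<=` carrier T ->
  slope n GR GQ = rel_slope rho beta (carrier S) (carrier T).
Proof.
move=> /subquot_nonzero Q0.
apply: (slope_difference grR R_fg R_domain n_gt0 aR_gt0 hR_expansion bR_expansion inv
  grQ Q_fg Q_tf Q0).
- exact/(gsub_graded grV).
- exact/(gsub_graded grV).
- move=> x; rewrite -(hf_pullback grV Sg TS grR R_fg V_fg) ?pullbackT //.
Qed.

Lemma slope_pullback (N : submodClosed (subquot S T)) :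
  graded_submodule GQ N -> nonzero_module (submod N) ->
  [/\ gsub G (pullback (carrier N)), ~ pullback (carrier N) `<=` carrier T &
  slope n GR (sub_grading GQ N) = rel_slope rho beta (pullback (carrier N)) (carrier T)].
Proof.
move=> Ng N0; have Cg : gsub G (pullback (carrier N)).
  by apply: (pullback_gsub grV Sg Tg TS); exact/(gsub_graded grQ).
split=> //.
  move=> /pullback_subT N0'; have [v v0] := N0; move/eqP: v0; apply.
  by apply: val_inj; exact: (N0' _ (submod_valP v)).
apply: (slope_difference grR R_fg R_domain n_gt0 aR_gt0 hR_expansion bR_expansion inv) => //.
- exact: sub_graded.
- exact: (submodule_fg grR R_fg grQ Q_fg).
- move=> r v rv0; have := congr1 (@submod_val _ _ N) rv0 => /Q_tf[|v0]; first by left.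
  by right; apply: val_inj.
- exact/(gsub_graded grV).
move=> x; rewrite (hf_pullback grV Sg TS grR R_fg V_fg) ?rsub_submod //; last exact: rsub_submod.
rewrite (hf_val grQ Ng grR R_fg Q_fg x (rsubT _)); congr (hf _ _ _ + _)%N.
by apply/seteqP; split=> [v vN|_ [v _ <-]]; [exists (Submod vN) | exact: submod_valP].
Qed.

Lemma semistable_subquot : semistable n GR GQ <-> ~ carrier S `<=` carrier T /\
  forall C, gsub G C -> carrier T `<=` C -> C `<=` carrier S -> ~ C `<=` carrier T ->
    rel_slope rho beta C (carrier T) <= rel_slope rho beta (carrier S) (carrier T).
Proof.
split=> [[_ /subquot_nonzero Q0 _ _ ss]|[nST ss]].
  split=> // C Cg TC CS nCT; rewrite -slope_subquot //.
  have Pg := pushforward_gsub T grV Sg Cg CS; have [N NE] := rsub_mksub Pg.1.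
  have Ng : graded_submodule GQ N by apply/(gsub_graded grQ); rewrite NE.
  have NC : pullback (carrier N) = C by rewrite NE pushforwardK //; case: Cg.
  have N0 : nonzero_module (submod N).
    apply: contrapT => N0; apply: nCT; rewrite -NC; apply/pullback_subT => q qN.
    apply: contrapT => q0; apply: N0; exists (Submod qN); apply/eqP => h; apply: q0.
    exact: (congr1 (@submod_val _ _ N) h).
  by have [_ _] := slope_pullback Ng N0; rewrite NC => <-; exact: ss.
split=> //; first exact/subquot_nonzero.
move=> N Ng N0; have [Cg nCT ->] := slope_pullback Ng N0.
rewrite slope_subquot //; apply: ss => //; last exact: pullback_sub.
by apply: sub_pullback => //; exact: rsub_submod.
Qed.

End OneSubquotient.

Lemma HN_filtrationE l (F : nat -> submodClosed V) : HN_filtration n GR G l F <->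
  abstract_HN (gsub G) [set 0] rho beta (@torsion_free_over R V) l
    (fun i => carrier (F i)).
Proof.
split=> [[[F0 Fl] Fs Fg Fss Fsl]|[[F0 Fl] Fg Fs Fss Fsl]].
  have tf i : (i < l)%N -> torsion_free_over (carrier (F i.+1)) (carrier (F i)).
    by move=> il; have [/subquot_torsion_free] := Fss i il.
  have ss i (il : (i < l)%N) := (semistable_subquot (Fg _ il) (Fg _ (ltnW il)) (Fs i il)
    (tf i il)).1 (Fss i il).2.
  split=> [|i il|i il|i il C|i il].
  - split; apply/seteqP; split=> v //=; rewrite ?F0 ?Fl //.
      by move=> /eqP.
    by move=> ->; rewrite inE.
  - exact/(gsub_graded grV)/Fg.
  - by split; [exact: Fs | case: (ss i il) | exact: tf].
  - exact: (ss i il).2.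
  - have := Fsl i il.
    rewrite (slope_subquot (Fg _ il) (Fg _ (ltnW il)) (Fs _ il) (tf _ il) (ss _ il).1).
    by rewrite (slope_subquot (Fg _ (ltnW il)) (Fg _ (ltnW (ltnW il))) (Fs _ (ltnW il))
      (tf _ (ltnW il)) (ss _ (ltnW il)).1).
have gr i : (i <= l)%N -> graded_submodule G (F i).
  by move=> il; apply/(gsub_graded grV)/Fg.
have sub i : (i < l)%N -> {subset F i <= F i.+1} by move=> il; have [] := Fs i il.
have tf i : (i < l)%N -> torsion_free_over (carrier (F i.+1)) (carrier (F i)).
  by move=> il; have [] := Fs i il.
have nz i : (i < l)%N -> ~ carrier (F i.+1) `<=` carrier (F i).
  by move=> il; have [] := Fs i il.
split=> // [|i il|i il].
- split=> v; rewrite inE.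
    apply/idP/eqP => [vF|->]; last by rewrite rpred0.
    by have : carrier (F 0%N) v by []; rewrite F0.
  by have : carrier (F l) v by rewrite Fl.
- split; first exact/subquot_torsion_free/tf.
  apply/(semistable_subquot (gr _ il) (gr _ (ltnW il)) (sub _ il) (tf _ il)).
  split; first exact: nz.
  exact: Fss.
- rewrite (slope_subquot (gr _ il) (gr _ (ltnW il)) (sub _ il) (tf _ il) (nz _ il)).
  rewrite (slope_subquot (gr _ (ltnW il)) (gr _ (ltnW (ltnW il))) (sub _ (ltnW il))
      (tf _ (ltnW il)) (nz _ (ltnW il))).
  exact: Fsl.
Qed.

End Translation.

(** * Existence and uniqueness of the filtration *)

Theorem theorem2p14 (RR : realType) (k : closedFieldType) (R : comAlgType k)
    (GR : RR -> set R) (n : nat) (M : lmodType R) (GM : RR -> set M)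
    (R_domain : GRing.integral_domain_axiom R)
    (R_graded : graded_algebra GR)
    (R_fg : fg_algebra R)
    (R_dim : krull_dim R n)
    (n_ge1 : (1 <= n)%N)
    (M_graded : graded_module GR GM)
    (M_fg : fg_module M)
    (M_tf : torsion_free M) :
  exists (l : nat) (F : nat -> submodClosed M),
    HN_filtration n GR GM l F /\
    forall (l' : nat) (F' : nat -> submodClosed M),
      HN_filtration n GR GM l' F' ->
      l' = l /\ forall i : nat, (i <= l)%N -> F' i =i F i.
Proof.
have [m [aR [aR0 hRE]]] := ring_expansion R_graded R_fg.
have [bR bRE] : exists bR, has_expansion m aR bR (fun x => (hR GR x)%:R).
  have [bR E] := hRE 0; exists bR; congr has_expansion: E; apply/funext => x.
  by rewrite subr0.
have [rho [b inv]] := invariants_exist R_graded R_fg R_domain aR0 hRE M_graded M_fg M_tf.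
have HN := HN_filtrationE R_graded R_fg R_domain n_ge1 aR0 hRE bRE M_graded M_fg inv.
have L_I := gsubI M_graded; have L_join := gsub_sums M_graded.
have join_l A B (_ : gsub GM A) (Bg : gsub GM B) : A `<=` sums A B := sums_l Bg.1.
have join_r A B (Ag : gsub GM A) (_ : gsub GM B) : B `<=` sums A B := sums_r Ag.1.
have join_sub A B C (Cg : gsub GM C) (AC : A `<=` C) (BC : B `<=` C) : sums A B `<=` C.
  by move=> _ [u [v [Au Bv ->]]]; apply: (rsubD Cg.1); [exact: AC | exact: BC].
have rho_mod := rho_modular R_graded R_fg aR0 M_graded M_fg inv.
have rho_le := rho_mono inv.
have tf_rho A B C : gsub GM A -> gsub GM B -> gsub GM C -> B `<=` C -> C `<=` A ->
    torsion_free_over A B -> rho C = rho B -> C `<=` B.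
  by move=> _; exact: (rho_torsion_free inv).
pose beta := reduced_degree n m aR bR rho b.
have beta_mod A B : gsub GM A -> gsub GM B ->
    beta (sums A B) + beta (A `&` B) = beta A + beta B.
  move=> Ag Bg; rewrite /beta /reduced_degree; case: eqP => [nm|_]; last by rewrite !addr0.
  have m0 : (0 < m)%N by rewrite -nm.
  rewrite -!mulrDl; congr (_ / _).
  have E1 := second_modular R_graded R_fg aR0 M_graded M_fg inv m0 Ag Bg.
  have E2 : (rho (sums A B))%:R + (rho (A `&` B))%:R = (rho A)%:R + (rho B)%:R :> RR.
    by rewrite -!natrD rho_mod.
  by rewrite addrACA E1 -opprD -mulrDl E2 mulrDl opprD addrACA.
have beta_le A B : gsub GM A -> gsub GM B -> A `<=` B -> rho A = rho B ->
    beta A <= beta B.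
  move=> Ag Bg AB rE; rewrite /beta /reduced_degree; case: eqP => // nm.
  have m0 : (0 < m)%N by rewrite -nm.
  rewrite ler_pM2r ?invr_gt0 // rE lerD2r.
  exact: (second_mono R_graded R_fg M_graded M_fg inv).
have beta_bounded : exists K, forall A, gsub GM A -> beta A <= K.
  rewrite /beta /reduced_degree; case: eqP => [nm|_]; last by exists 0.
  have m0 : (0 < m)%N by rewrite -nm.
  have [K HK] := second_bounded R_graded R_fg R_domain hRE M_graded M_fg inv m0.
  exists ((K + (rho setT)%:R * `|bR|) / aR) => A Ag.
  rewrite ler_pM2r ?invr_gt0 // lerD ?HK // -mulrN.
  apply: (@le_trans _ _ ((rho A)%:R * `|bR|)).
    by rewrite ler_wpM2l // -normrN ler_norm.
  by rewrite ler_wpM2r // ler_nat rho_le //; exact: (gsubT M_graded).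
have tf_sub A B C : gsub GM A -> gsub GM B -> gsub GM C -> B `<=` C -> C `<=` A ->
    torsion_free_over A B -> torsion_free_over C B.
  by move=> _ _ _ _ CA t r v Cv; apply: t; exact: CA.
have tf_bot : torsion_free_over (setT : set M) [set 0] by move=> r v _ /M_tf.
have sat := saturation_exists R_graded R_domain M_graded inv.
have [l [F HF]] := abstract_HN_exists L_I L_join (gsubT M_graded) (gsub0 M_graded)
  join_l join_r rho_mod beta_mod rho_le beta_le beta_bounded tf_rho tf_sub tf_bot sat.
have /choice[S SF] i : exists S : submodClosed M, (i <= l)%N -> [set v | v \in S] = F i.
  have [il|li] := leqP i l; last by exists (mksub (submod_closed_set (erefl 0) (rsub0 M).2)).
  have [_ FL _ _ _] := HF; have [S SE] := rsub_mksub (FL i il).1.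
  by exists S.
exists l, S; have HS : HN_filtration n GR GM l S.
  apply/HN; have [[F0 Fl] FL Fs Fss Fsl] := HF.
  split=> [|i il|i il|i il|i il]; rewrite ?SF //; try exact: ltnW.
  - exact: FL.
  - exact: Fs.
  - exact: Fss.
  - exact: Fsl.
  by rewrite ltnW // ltnW.
split=> // l' F' /HN HF'.
have [ll' FE] := abstract_HN_unique L_I L_join join_l join_r join_sub rho_mod beta_mod
  rho_le tf_rho ((HN l S).1 HS) HF'.
by split=> // i il v; have := congr1 (fun A : set M => A v) (FE i il) => /= /is_true_inj.
Qed.
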